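(* Let $\lambda<\Lambda^\star$, $\beta,\gamma>0$ and $\lambda+(\beta+\gamma)^2<\Lambda^\star$. Let $f\in\mathcal{L}^2_{\beta,\gamma}(\Omega^\bullet)$ and let $u\in W^{1+}_{-\beta,-\gamma,0}(\Omega^\bullet)$ satisfy $$(\nabla u,\nabla v)_{\Omega^\bullet}-\lambda(u,v)_{\Omega^\bullet}=(f,v)_{\Omega^\bullet}\qquad\forall v\in W^{1+}_{\beta,\gamma,0}(\Omega^\bullet).$$ Then $u$ belongs to $W^{1-}_{\beta,-\gamma,0}(\Omega^\bullet)$ and $$\|u;W^{1-}_{\beta,-\gamma,0}(\Omega^\bullet)\|\le c\left(\|f;\mathcal{L}^2_{\beta,\gamma}(\Omega^\bullet)\|+\|u;W^{1+}_{-\beta,-\gamma,0}(\Omega^\bullet)\|\right),$$ where the factor $c$ depends on $\lambda$, $\beta$, $\gamma$ but is independent of $f$ and $u$.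
   Context: Normalize $l_1=1/2$, let $l_2>0$, $\mathbb{Q}=\{x\in\mathbb{R}^2:|x_j|<l_j,\ j=1,2\}$, $\omega\subset\mathbb{R}^2$ a non-empty open set with smooth boundary, $\overline\omega\subset\mathbb{Q}$, $\varpi=\mathbb{Q}\setminus\overline\omega$, $\omega(\alpha)=\{x:(x_1-2\alpha_1l_1,x_2-2\alpha_2l_2)\in\omega\}$ for $\alpha\in\mathbb{Z}^2$, $\Omega^\circ=\mathbb{R}^2\setminus\bigcup_{\alpha\in\mathbb{Z}^2}\overline{\omega(\alpha)}$ (a domain, i.e. connected). Let $J\in\mathbb{N}$, $\Xi^+=(l_1,+\infty)\times(l_2,(2J+1)l_2)$ and $\Omega^\bullet=\Omega^\circ\cup\Xi^+$. $\Lambda^\star>0$ is the smallest eigenvalue of the mixed problem $-\Delta U=\Lambda^\star U$ in $\varpi$, $\partial_\nu U=0$ on $\partial\mathbb{Q}$, $U=0$ on $\partial\omega$. $W^{l\pm}_{\beta,\gamma}(\Omega^\bullet)$ (weight indexes of any sign) is the completion of $C_c^\infty(\overline{\Omega^\bullet})$ in the norm $$\|v;W^{l\pm}_{\beta,\gamma}(\Omega^\bullet)\|=\Big(\sum_{k=0}^l\|e^{\beta|x_2|+\gamma x_1^\pm}\nabla^kv;L^2(\Omega^\bullet)\|^2\Big)^{1/2},\qquad x_1^+=|x_1|,\ x_1^-=x_1,$$ and $W^{1\pm}_{\beta,\gamma,0}(\Omega^\bullet)$ is its subspace ($l=1$) of functions vanishing on $\partial\Omega^\bullet$, with the same norm.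 $\mathcal{L}^2_{\beta,\gamma}(\Omega^\bullet)$ is the weighted Lebesgue space with norm $\|e^{\beta|x_2|+\gamma|x_1|}f;L^2(\Omega^\bullet)\|$. $(\cdot,\cdot)_{\Omega^\bullet}$ is the extension of the $L^2(\Omega^\bullet)$ scalar product to the duality between spaces with opposite weights. *)

(* Defs.v *)
From HB Require Import structures.
From mathcomp Require Import all_boot all_order all_algebra.
From mathcomp Require Import complex.
From mathcomp Require Import all_classical all_reals all_analysis.

Set Implicit Arguments.
Unset Strict Implicit.
Unset Printing Implicit Defensive.

Import Order.TTheory GRing.Theory Num.Theory.
Import numFieldNormedType.Exports.

Local Open Scope classical_set_scope.
Local Open Scope ring_scope.
Local Open Scope complex_scope.

Section Plane.
Context {R : realType}.

Local Notation P := (R * R)%type.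

(* R * R with the Borel structure that carries the Lebesgue measure. *)
Definition plane := (measurableTypeR R * measurableTypeR R)%type.

Definition plane_measure : set plane -> \bar R :=
  (@lebesgue_measure R \x @lebesgue_measure R)%E.

Definition evec (j : 'I_2) : P := if j == 0 then (1, 0) else (0, 1).

Fixpoint Ck (k : nat) (f : P -> R) : Prop :=
  if k is k'.+1 then
    [/\ continuous f,
        forall j x, derivable f x (evec j) &
        forall j, Ck k' (fun x => 'D_(evec j) f x)]
  else continuous f.

Definition smooth (f : P -> R) : Prop := forall k, Ck k f.

Definition boundary (A : set P) : set P := closure A `\` interior A.

(* C^oo boundary: near each boundary point, A is the sublevel set {rho < 0}
   of a smooth function rho with nonzero gradient there. *)
Definition smooth_boundary (A : set P) : Prop :=
  forall x, boundary A x ->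
    exists rho : P -> R,
      [/\ smooth rho,
          exists j, 'D_(evec j) rho x != 0 &
          \forall y \near x, A y <-> rho y < 0].

End Plane.

(* Functions are complex-valued; analytic notions are taken on the real and
   imaginary parts.  Sobolev functions are handled as pairs (u, p) of a
   function u and its gradient p = (p 0, p 1), both up to a.e. equality. *)
Section ComplexFunctions.
Context {R : realType}.

Local Notation P := (R * R)%type.
Local Notation C := (R[i]).
Local Notation plane := (@plane R).

Definition measurable_cfun (D : set P) (f : P -> C) : Prop :=
  measurable_fun (D : set plane) (fun x : plane => complex.Re (f x)) /\
  measurable_fun (D : set plane) (fun x : plane => complex.Im (f x)).

Definition cintegral (D : set P) (f : P -> C) : C :=
  (\int[plane_measure]_(x in D) complex.Re (f x))
  +i* (\int[plane_measure]_(x in D) complex.Im (f x)).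

Definition scal (D : set P) (f g : P -> C) : C :=
  cintegral D (fun x => f x * conjc (g x)).

Definition gscal (D : set P) (p q : 'I_2 -> P -> C) : C :=
  \sum_(j < 2) scal D (p j) (q j).

Definition csmooth (f : P -> C) : Prop :=
  smooth (fun x => complex.Re (f x)) /\ smooth (fun x => complex.Im (f x)).

Definition cgrad (f : P -> C) (j : 'I_2) (x : P) : C :=
  ('D_(evec j) (fun y => complex.Re (f y)) x)
  +i* ('D_(evec j) (fun y => complex.Im (f y)) x).

Definition test_fun (G : set P) (f : P -> C) : Prop :=
  [/\ csmooth f, compact (closure [set x | f x != 0]) &
      forall x, G x -> f x = 0].

Definition L2sq (D : set P) (w : P -> R) (f : P -> C) : \bar R :=
  (\int[plane_measure]_(x in D)
     ((w x * Normc.normc (f x)) ^+ 2)%:E)%E.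

Definition L2norm (D : set P) (w : P -> R) (f : P -> C) : \bar R :=
  sqrte (L2sq D w f).

Definition L2 (D : set P) (w : P -> R) (f : P -> C) : Prop :=
  measurable_cfun D f /\ (L2norm D w f < +oo)%E.

Definition W1norm (D : set P) (w : P -> R) (u : P -> C) (p : 'I_2 -> P -> C)
    : \bar R :=
  sqrte (L2sq D w u + \sum_(j < 2) L2sq D w (p j))%E.

(* The completion, in the weighted H^1(D) norm, of the restrictions to D of
   the functions of C_c^oo(R^2) vanishing on G, realized as the closure of the
   graph of the gradient in the weighted L^2 space; p is then necessarily the
   distributional gradient of u in the open set D. *)
Definition W1 (D : set P) (w : P -> R) (G : set P)
    (u : P -> C) (p : 'I_2 -> P -> C) : Prop :=
  [/\ measurable_cfun D u,
      forall j, measurable_cfun D (p j) &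
      exists phi : nat -> P -> C,
        (forall n, test_fun G (phi n)) /\
        W1norm D w (fun x => phi n x - u x)
                   (fun j x => cgrad (phi n) j x - p j x)
          @[n --> \oo] --> 0%E].

End ComplexFunctions.

Section Geometry.
Context {R : realType}.
Variable l2 : R.

Local Notation P := (R * R)%type.

Definition l1 : R := 2^-1.

Definition cellQ : set P := [set x | `|x.1| < l1 /\ `|x.2| < l2].

Definition perforated_cell (omega : set P) : set P := cellQ `\` closure omega.

Definition hole (omega : set P) (alpha : int * int) : set P :=
  [set x | omega (x.1 - 2 * alpha.1%:~R * l1, x.2 - 2 * alpha.2%:~R * l2)].

Definition Omega_circ (omega : set P) : set P :=
  ~` \bigcup_(alpha in [set: int * int]) closure (hole omega alpha).

Definition Xi_plus (J : nat) : set P :=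
  [set x | l1 < x.1 /\ l2 < x.2 < (2 * J + 1)%:R * l2].

Definition Omega_bullet (omega : set P) (J : nat) : set P :=
  Omega_circ omega `|` Xi_plus J.

End Geometry.

Section Spaces.
Context {R : realType}.

Local Notation P := (R * R)%type.
Local Notation C := (R[i]).

(* Eigenvalues of the mixed problem in the variational sense: the Neumann
   condition on the boundary of the cell is the natural one. *)
Definition mixed_eigenvalue (l2 : R) (omega : set P) (mu : R) : Prop :=
  let D := perforated_cell l2 omega in
  let H := W1 D (fun=> 1) (boundary omega) in
  exists (U : P -> C) (dU : 'I_2 -> P -> C),
    [/\ H U dU,
        L2norm D (fun=> 1) U != 0%E &
        forall (V : P -> C) (dV : 'I_2 -> P -> C), H V dV ->
          gscal D dU dV = mu%:C * scal D U V].

Definition smallest_mixed_eigenvalue (l2 : R) (omega : set P) (mu : R) : Prop :=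
  mixed_eigenvalue l2 omega mu /\
  forall nu, mixed_eigenvalue l2 omega nu -> mu <= nu.

Definition weight_plus (beta gamma : R) (x : P) : R :=
  expR (beta * `|x.2| + gamma * `|x.1|).

Definition weight_minus (beta gamma : R) (x : P) : R :=
  expR (beta * `|x.2| + gamma * x.1).

Definition W1plus0 (beta gamma : R) (D : set P) :=
  W1 D (weight_plus beta gamma) (boundary D).

Definition W1minus0 (beta gamma : R) (D : set P) :=
  W1 D (weight_minus beta gamma) (boundary D).

End Spaces.

(* Main.v *)
Require Import Defs.
From HB Require Import structures.
From mathcomp Require Import all_boot all_order all_algebra.
From mathcomp Require Import complex.
From mathcomp Require Import ring lra.
From mathcomp Require Import all_classical all_reals all_analysis measurable_realfun.
Import Order.TTheory GRing.Theory Num.Theory.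
Import numFieldNormedType.Exports.
Local Open Scope classical_set_scope.
Local Open Scope ring_scope.
Local Open Scope complex_scope.
Set Implicit Arguments.
Unset Strict Implicit.
Unset Printing Implicit Defensive.

(** Let [w] be a positive smooth weight with [|d_j w| <= k_j w], where
    [k = (gamma, beta)].  Testing the equation with [w^2 u] and using the identity
      [grad u . grad (w^2 u) = |grad (w u)|^2 - |grad w|^2 u^2]
    shows that [U = w u] satisfies
      [int |grad U|^2 - (lambda + beta^2 + gamma^2) int U^2 <= int f w^2 u].
    On every perforated cell the spectral inequality
    [Lambda int U^2 <= int |grad U|^2] holds, and [lambda + beta^2 + gamma^2] is
    smaller than [Lambda].  So the left-hand side controls the energy of [U], up
    to the squared norm of [U] on the half-strip, where there are no holes.  There
    [x_2] is bounded and [x_1] positive, so that a weight [w] of the size of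
    [exp (beta |x_2| - gamma x_1)] is comparable with
    [exp (- beta |x_2| - gamma |x_1|)]; the squared norm of [U] on the half-strip
    is thus bounded by the given norm of [u].  This is [a_priori].

    The function [w^2 u] is an admissible test function only if [w] is bounded by
    the decaying weight of [u].  Hence [w] is taken of the form [wlim * cutoff]:
    [wlim] is a smooth version of [exp (beta |x_2| - gamma x_1)], and the cutoff
    depends on a small parameter in such a way that the rates [k_j] do not
    ([pd_wreg_le], [wreg_le_wn]).  The estimate is uniform in the parameter, and
    Fatou's lemma gives the bound for the limit weight ([energy_wm]).  The products
    of [u] with the cutoffs are approximable by test functions and converge to [u]
    by dominated convergence, so that [u] belongs to the completion ([rW1_wm]).

    The spectral inequality is not part of the definition of [Lambda] as the
    smallest eigenvalue.  It is derived in [cell_inequality]: if it failed for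
    a test function, the infimum of the Rayleigh quotient would lie below [Lambda]
    and would be attained at an eigenfunction ([rayleigh_infimum_attained]).
    Attainment rests on compactness.  A test function vanishes on the boundary of
    the hole; after extension by zero into the hole its increments along the
    coordinate lines are still bounded by integrals of its derivative
    ([trunc_increment]), and this is enough for a Poincare inequality on
    rectangles ([rect_poincare]) and for compactness by subdivision
    ([ultra_rellich]).  The parallelogram identity and the Riesz-Fischer argument
    then produce the minimizer.

    The cells are assembled in [domain_inequality].  A function that vanishes on
    the boundary of the domain has to vanish on the boundary of every hole off the
    half-strip, and this is where the smoothness of the holes enters: a boundary
    point of a hole is not interior to the closure of the hole
    ([smooth_boundary_exterior]).

    Since the coefficients are real, the real and the imaginary part of [u] are
    treated separately ([weak_real], [real_estimate]). *)


(** * Functions of class C^k on the plane *)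

Section SmoothFunctions.
Context {R : realType}.
Local Notation P := (R * R)%type.
Implicit Types (f g : P -> R) (x : P).

Lemma eq_Ck k f g : f =1 g -> Ck k g -> Ck k f.
Proof. by move=> /funext ->. Qed.

Lemma CkS k f : Ck k.+1 f -> Ck k f.
Proof.
elim: k f => [|k IH] f; first by case.
case=> cf df Df; split=> // j; exact: IH (Df j).
Qed.

Lemma Ck_cst k (a : R) : Ck k (fun _ : P => a).
Proof.
elim: k a => [|k IH] a; first exact: cst_continuous.
split; first exact: cst_continuous.
  by move=> j x; exact: derivable_cst.
by move=> j; apply: (eq_Ck _ (IH 0)) => x; rewrite derive_cst.
Qed.

Lemma Ck_add k f g : Ck k f -> Ck k g -> Ck k (fun x => f x + g x).
Proof.
elim: k f g => [|k IH] f g; first by move=> cf cg x; apply: cvgD; [exact: cf|exact: cg].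
move=> [cf df Df] [cg dg Dg]; split.
- by move=> x; apply: cvgD; [exact: cf|exact: cg].
- by move=> j x; apply: derivableD.
- move=> j; apply: (eq_Ck _ (IH _ _ (Df j) (Dg j))) => x.
  by rewrite deriveD.
Qed.

Lemma Ck_mul k f g : Ck k f -> Ck k g -> Ck k (fun x => f x * g x).
Proof.
elim: k f g => [|k IH] f g; first by move=> cf cg x; apply: cvgM; [exact: cf|exact: cg].
move=> Cf Cg; have [cf df Df] := Cf; have [cg dg Dg] := Cg; split.
- by move=> x; apply: cvgM; [exact: cf|exact: cg].
- by move=> j x; apply: derivableM.
- move=> j; apply: (@eq_Ck _ _
    (fun x => f x * 'D_(evec j) g x + g x * 'D_(evec j) f x)) => [x|].
    by rewrite deriveM.
  by apply: Ck_add; [exact: (IH _ _ (CkS Cf) (Dg j))|exact: (IH _ _ (CkS Cg) (Df j))].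
Qed.

Lemma Ck_inv k f : (forall x, f x != 0) -> Ck k f -> Ck k (fun x => (f x)^-1).
Proof.
move=> f0; elim: k => [|k IH] Cf; first by move=> x; apply: cvgV => //; exact: Cf.
have [cf df Df] := Cf; split.
- by move=> x; apply: cvgV => //; exact: cf.
- by move=> j x; apply: derivableV.
- move=> j; apply: (@eq_Ck _ _
    (fun x => ((f x)^-1 * (f x)^-1) * (-1 * 'D_(evec j) f x))) => [x|].
    by rewrite deriveV // mulN1r /GRing.scale/= -invfM -expr2 mulNr mulrN.
  have Cv := IH (CkS Cf).
  exact: (Ck_mul (Ck_mul Cv Cv) (Ck_mul (Ck_cst _ _) (Df j))).
Qed.

Lemma derive_line f x v :
  'D_1 (fun h : R => f (h *: v + x)) 0 = 'D_v f x.
Proof.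
rewrite /derive.
suff -> : (fun h : R => h^-1 *: (((fun h : R => f (h *: v + x)) \o shift 0) (h *: 1)
    - f ((0 : R) *: v + x))) =
  (fun h : R => h^-1 *: ((f \o shift x) (h *: v) - f x)) by [].
apply/funext => h /=.
by rewrite /shift/= addr0 scale0r add0r [h *: 1]mulr1.
Qed.

Lemma is_derive_lineP f x v df :
  is_derive (0 : R) 1 (fun h => f (h *: v + x)) df -> is_derive x v f df.
Proof.
case=> d1 e1; apply: DeriveDef; first exact/derivable1P.
by rewrite -e1 derive_line.
Qed.

Lemma is_derive_line f x v df :
  is_derive x v f df -> is_derive (0 : R) 1 (fun h => f (h *: v + x)) df.
Proof.
case=> d1 e1; apply: DeriveDef; first by move/derivable1P : d1.
by rewrite -e1 derive_line.
Qed.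

Lemma is_derive_along f x v (t : R) : derivable f (t *: v + x) v ->
  is_derive t (1 : R) (fun r => f (r *: v + x)) ('D_v f (t *: v + x)).
Proof.
have E : (fun k : R => k^-1 *: (((fun r => f (r *: v + x)) \o shift t) (k *: 1) - f (t *: v + x))) =
  (fun k : R => k^-1 *: ((f \o shift (t *: v + x)) (k *: v) - f (t *: v + x))).
  apply/funext => k; rewrite /= /shift; congr (_ *: (f _ - _)).
  by rewrite addrA -scalerDl [k *: 1]mulr1.
by move=> df; apply: DeriveDef; rewrite /derivable /derive E.
Qed.

Lemma continuous_along x v : continuous (fun r : R => r *: v + x : P).
Proof.
move=> h; apply: cvgD; last exact: cvg_cst.
by apply: cvgZ; [exact: cvg_id|exact: cvg_cst].
Qed.

Definition comp2 (a b : R) (j : 'I_2) : R := if j == 0 then a else b.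

Lemma is_derive_explin (a b : R) x j :
  is_derive x (evec j) (fun y => expR (a * y.1 + b * y.2))
    (comp2 a b j * expR (a * x.1 + b * x.2)).
Proof.
apply: is_derive_lineP.
set c := comp2 a b j; set d := a * x.1 + b * x.2.
rewrite (_ : (fun h => _) = fun h : R => expR (h * c + d)); last first.
  apply/funext => h; congr expR; rewrite /c /comp2 /evec /d.
  by case: (j == 0) => /=; rewrite /GRing.scale/=; ring.
have H : is_derive (0 : R) 1 (fun h : R => h * c + d) c.
  by apply: is_derive_eq; rewrite scaler0 add0r addr0 [_ *: _]mulr1.
have := @is_derive1_comp _ expR (fun h : R => h * c + d) 0 _ _
  (is_derive_expR ((0 : R) * c + d)) H.
by rewrite mul0r add0r mulrC.
Qed.

Lemma continuous_explin (a b : R) :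
  continuous (fun y : P => expR (a * y.1 + b * y.2)).
Proof.
move=> x; apply: (@continuous_comp _ _ _ (fun y : P => a * y.1 + b * y.2) expR).
  by apply: cvgD; apply: cvgM; [exact: cvg_cst|exact: cvg_fst|exact: cvg_cst|exact: cvg_snd].
exact: continuous_expR.
Qed.

Lemma Ck_explin k (a b : R) : Ck k (fun y : P => expR (a * y.1 + b * y.2)).
Proof.
elim: k => [|k IH]; first exact: continuous_explin.
split; first exact: continuous_explin.
  by move=> j x; have [] := is_derive_explin a b x j.
move=> j; apply: (@eq_Ck _ _
  (fun y => comp2 a b j * expR (a * y.1 + b * y.2))) => [x|].
  by have [_] := is_derive_explin a b x j.
exact: (Ck_mul (Ck_cst _ _) IH).
Qed.

Lemma is_derive_shift2 f (a : P) x v df :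
  is_derive (x + a) v f df -> is_derive x v (fun y => f (y + a)) df.
Proof.
move=> /is_derive_line H; apply: is_derive_lineP.
by under eq_fun do rewrite -addrA.
Qed.

Lemma derive_shift2 f (a : P) x v : derivable f (x + a) v ->
  'D_v (fun y => f (y + a)) x = 'D_v f (x + a).
Proof.
by move=> /derivableP H; have [] := is_derive_shift2 H.
Qed.

Lemma Ck_shift k f (a : P) : Ck k f -> Ck k (fun y => f (y + a)).
Proof.
have cs g : continuous g -> continuous (fun y : P => g (y + a)).
  move=> cg y; apply: (@continuous_comp _ _ _ (fun y : P => y + a) g); last exact: cg.
  by apply: cvgD; [exact: cvg_id|exact: cvg_cst].
elim: k f => [|k IH] f; first exact: cs.
move=> [cf df Df]; split; first exact: cs.
  by move=> j x; have [] := is_derive_shift2 (derivableP (df j (x + a))).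
by move=> j; apply: (eq_Ck _ (IH _ (Df j))) => x; rewrite derive_shift2.
Qed.

End SmoothFunctions.

(** * Square-integrable functions *)

Lemma limn_esup_between (R : realType) (u : nat -> \bar R) (k : nat) (a b : \bar R) :
  (forall n, (k <= n)%N -> (a <= u n <= b)%E) -> (a <= limn_esup u <= b)%E.
Proof.
move=> uab; apply/andP; split.
  apply: le_ereal_inf_tmp => _ [A [r /= _ rA] <-].
  have Am : A (maxn k r) by apply: rA; rewrite /= leq_maxr.
  apply: (@le_trans _ _ (u (maxn k r))).
    by case/andP : (uab _ (leq_maxl k r)).
  by apply: ereal_sup_ubound; exists (maxn k r).
apply: (@le_trans _ _ (ereal_sup (u @` [set n | (k <= n)%N]))).
  by apply: ereal_inf_lbound; exists [set n | (k <= n)%N] => //; exists k.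
by apply: ge_ereal_sup => _ [n /= /uab/andP[_ ?] <-].
Qed.

Section SquareIntegrable.
Context d (T : measurableType d) (R : realType).
Variable mu : {measure set T -> \bar R}.
Variable D : set T.
Hypothesis mD : measurable D.
Implicit Types (f g : T -> R).

Notation intg f := (mu.-integrable D (EFin \o f)).
Notation Int f := (Rintegral mu D f).

Lemma intg_measurable f : intg f -> measurable_fun D f.
Proof. by move=> /integrableP[/measurable_EFinP]. Qed.

Lemma intg_le f g : measurable_fun D f -> intg g ->
  (forall x, D x -> `|f x| <= g x) -> intg f.
Proof.
move=> mf ig fg; apply: (le_integrable mD _ _ ig); first exact/measurable_EFinP.
by move=> x Dx /=; rewrite lee_fin (le_trans (fg x Dx))// ler_norm.
Qed.

Lemma intgD f g : intg f -> intg g -> intg (fun x => f x + g x).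
Proof. by move=> fi gi; exact: (integrableD mD fi gi). Qed.

Lemma intgB f g : intg f -> intg g -> intg (fun x => f x - g x).
Proof. by move=> fi gi; exact: (integrableB mD fi gi). Qed.

Lemma intgZ a f : intg f -> intg (fun x => a * f x).
Proof. by move=> fi; exact: (integrableZl mD a fi). Qed.

Lemma Int_ereal f : intg f -> (\int[mu]_(x in D) (f x)%:E)%E = (Int f)%:E.
Proof. by move=> fi; rewrite /Rintegral fineK// integrable_fin_num. Qed.

Definition sqint f := measurable_fun D f /\ intg (fun x => f x ^+ 2).

Lemma intg_ereal_lt f : measurable_fun D f -> (forall x, D x -> 0 <= f x) ->
  (\int[mu]_(x in D) (f x)%:E < +oo)%E -> intg f.
Proof.
move=> mf f0 foo; apply/integrableP; split; first exact/measurable_EFinP.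
rewrite (eq_integral (fun x => (f x)%:E)) // => x /set_mem Dx /=.
by rewrite ger0_norm// f0.
Qed.

Lemma sqint_ereal f : measurable_fun D f ->
  (\int[mu]_(x in D) (f x ^+ 2)%:E < +oo)%E -> sqint f.
Proof.
move=> mf foo; split=> //; apply: intg_ereal_lt => //.
  exact: measurable_funX.
by move=> x _; exact: sqr_ge0.
Qed.

Lemma sqint_mul f g : sqint f -> sqint g -> intg (fun x => f x * g x).
Proof.
move=> [mf fi] [mg gi]; apply: intg_le (intgD fi gi) _.
  exact: measurable_funM.
move=> x _; rewrite normrM -(real_normK (num_real (f x))) -(real_normK (num_real (g x))).
have := sqr_ge0 (`|f x| - `|g x|); have := normr_ge0 (f x); have := normr_ge0 (g x).
nra.
Qed.

Lemma sqintZ a f : sqint f -> sqint (fun x => a * f x).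
Proof.
move=> [mf fi]; split; first exact: measurable_funM.
apply: eq_integrable (intgZ (a ^+ 2) fi) => //.
by move=> x _ /=; rewrite exprMn.
Qed.

Lemma sqint_le f g : measurable_fun D f -> sqint g ->
  (forall x, D x -> `|f x| <= `|g x|) -> sqint f.
Proof.
move=> mf [mg gi] fg; split => //; apply: intg_le gi _ => //.
  exact: measurable_funX.
move=> x Dx; rewrite ger0_norm ?sqr_ge0//.
rewrite -(real_normK (num_real (f x))) -(real_normK (num_real (g x))).
by rewrite lerXn2r ?nnegrE ?normr_ge0 ?fg.
Qed.

Lemma sqintD f g : sqint f -> sqint g -> sqint (fun x => f x + g x).
Proof.
move=> sf sg; have [mf fi] := sf; have [mg gi] := sg; split.
  exact: measurable_funD.
apply: intg_le (intgD (intgZ 2 fi) (intgZ 2 gi)) _.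
  by apply: measurable_funX; exact: measurable_funD.
move=> x _; rewrite ger0_norm ?sqr_ge0//.
have := sqr_ge0 (f x - g x); nra.
Qed.

Lemma sqintB f g : sqint f -> sqint g -> sqint (fun x => f x - g x).
Proof.
move=> sf sg; have := sqintD sf (sqintZ (-1) sg).
by under eq_fun do rewrite mulN1r.
Qed.

(** Young's inequality with parameter [s] on the cross term of
    [g^2 = (f + (g - f))^2]; the parameter is free, so that a small distance
    gives a small difference of the squared norms. *)
Lemma sq_perturb f g s : 0 < s -> sqint f -> sqint g ->
  `|Int (fun x => g x ^+ 2) - Int (fun x => f x ^+ 2)| <=
  s * Int (fun x => f x ^+ 2) + (1 + s^-1) * Int (fun x => (g x - f x) ^+ 2).
Proof.
move=> s0 sf sg; have [mf fi] := sf; have [mg gi] := sg.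
have [mh hi] := sqintB sg sf.
have key x : `|g x ^+ 2 - f x ^+ 2| <=
    s * f x ^+ 2 + (1 + s^-1) * (g x - f x) ^+ 2.
  have si0 : 0 < s^-1 by rewrite invr_gt0.
  have ssi : s * s^-1 = 1 by rewrite divff// gt_eqF.
  set a := f x; set b := g x - a; have -> : g x = a + b by rewrite /b; ring.
  have H1 : 0 <= (s * a + b) ^+ 2 * s^-1 by rewrite mulr_ge0// ?sqr_ge0// ltW.
  have H2 : 0 <= (s * a - b) ^+ 2 * s^-1 by rewrite mulr_ge0// ?sqr_ge0// ltW.
  have H3 := sqr_ge0 b.
  have E1 : (s * a + b) ^+ 2 * s^-1 = s * a ^+ 2 * (s * s^-1) + 2 * a * b * (s * s^-1) + s^-1 * b ^+ 2 by ring.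
  have E2 : (s * a - b) ^+ 2 * s^-1 = s * a ^+ 2 * (s * s^-1) - 2 * a * b * (s * s^-1) + s^-1 * b ^+ 2 by ring.
  rewrite ssi !mulr1 in E1 E2.
  by rewrite ler_norml; apply/andP; split; nra.
rewrite -RintegralB// (le_trans (le_normr_Rintegral mD _))//; first exact: intgB.
rewrite -RintegralZl// -RintegralZl//.
rewrite -RintegralD//; [|exact: intgZ|exact: intgZ].
apply: le_Rintegral => //.
- by apply: intg_le (intgD fi gi) _;
    [apply: measurableT_comp => //; apply: measurable_funB; exact: measurable_funX
    |move=> x _; rewrite normr_id (le_trans (ler_normB _ _))// addrC !ger0_norm ?sqr_ge0].
- by apply: intgD; exact: intgZ.
Qed.

(** The weighted series [S = sum_k 4^k (f_(k+1) - f_k)^2] is integrable, and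
    where it is finite the telescoping series converges geometrically, with
    [(lim f - f_k)^2 <= 4 * 4^-k * S]; this holds trivially where [S] is
    infinite, so that no exceptional null set has to be discussed. *)
Lemma riesz_fischer (f : nat -> T -> R) :
  (forall k, measurable_fun D (f k)) ->
  (forall k, (\int[mu]_(x in D) ((f k.+1 x - f k x) ^+ 2)%:E <= (8^-1 ^+ k)%:E)%E) ->
  exists g, measurable_fun D g /\
    forall k, (\int[mu]_(x in D) ((g x - f k x) ^+ 2)%:E <= (8 * 4^-1 ^+ k)%:E)%E.
Proof.
move=> mf df.
pose t k x : R := 4 ^+ k * (f k.+1 x - f k x) ^+ 2.
have t0 k x : 0 <= t k x by rewrite mulr_ge0 ?sqr_ge0// exprn_ge0.
have mt k : measurable_fun D (t k).
  by apply: measurable_funM => //; apply: measurable_funX; exact: measurable_funB.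
pose S x : \bar R := (\sum_(k <oo) (t k x)%:E)%E.
have S0 x : (0 <= S x)%E by apply: nneseries_ge0 => k _ _; rewrite lee_fin.
have mS : measurable_fun D S.
  apply: ge0_emeasurable_sum => [k x _ _|k _]; first by rewrite lee_fin.
  exact/measurable_EFinP.
have IS : (\int[mu]_(x in D) S x <= 2%:E)%E.
  rewrite integral_nneseries//; last 2 first.
    by move=> k; exact/measurable_EFinP.
    by move=> k x _; rewrite lee_fin.
  have /cvg_lim := @cvg_geometric_eseries_half R 2 0.
  rewrite expr0 divr1 => <- //.
  apply: lee_nneseries => [k _ _|k _].
    by apply: integral_ge0 => x _; rewrite lee_fin.
  under eq_integral do rewrite EFinM.
  rewrite ge0_integralZl_EFin ?exprn_ge0//; last 2 first.
    by move=> x _; rewrite lee_fin sqr_ge0.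
    by apply/measurable_EFinP; apply: measurable_funX; exact: measurable_funB.
  apply: (@le_trans _ _ ((4 ^+ k)%:E * (8^-1 ^+ k)%:E)%E).
    by apply: lee_wpmul2l => //; rewrite lee_fin exprn_ge0.
  rewrite -EFinM lee_fin addn1 -exprMn natrX exprS invfM mulrA divff ?pnatr_eq0// mul1r.
  by rewrite -exprVn lerXn2r// ?nnegrE; lra.
pose g x : R := fine (limn_esup (fun k => (f k x)%:E)).
have mg : measurable_fun D g.
  apply: measurableT_comp => //; apply: measurable_fun_limn_esup => k.
  exact/measurable_EFinP.
have gS k x : (((g x - f k x) ^+ 2)%:E <= (4 * 4^-1 ^+ k)%:E * S x)%E.
  have := S0 x; case E : (S x) => [s| |//]; last first.
    by rewrite gt0_muley ?leey// lte_fin mulr_gt0// exprn_gt0// invr_gt0.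
  rewrite lee_fin => s0.
  have ts n : t n x <= s.
    rewrite -lee_fin -E /S.
    apply: le_trans (nneseries_lim_ge n.+1 _); last first.
      by move=> m _ _; rewrite lee_fin.
    rewrite big_nat_recr//= leeDr// sume_ge0// => m _.
    by rewrite lee_fin.
  have step n : `|f n.+1 x - f n x| <= Num.sqrt s * 2^-1 ^+ n.
    rewrite -ler_sqr ?nnegrE ?mulr_ge0 ?exprn_ge0 ?sqrtr_ge0//.
    rewrite real_normK ?num_real// exprMn sqr_sqrtr// -exprM mulnC exprM.
    have -> : 2^-1 ^+ 2 = 4^-1 :> R by lra.
    by rewrite exprVn ler_pdivlMr ?exprn_gt0// mulrC ts.
  have cauchy n : `|f (n + k)%N x - f k x| <= 2 * Num.sqrt s * 2^-1 ^+ k.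
    have H : `|f (n + k)%N x - f k x| <= 2 * Num.sqrt s * (2^-1 ^+ k - 2^-1 ^+ (n + k)).
      elim: n => [|n IH]; first by rewrite add0n !subrr normr0 mulr0.
      rewrite addSn (_ : f (n + k).+1 x - f k x =
        (f (n + k).+1 x - f (n + k)%N x) + (f (n + k)%N x - f k x)); last by ring.
      rewrite (le_trans (ler_normD _ _))// (le_trans (lerD (step _) IH))//.
      by rewrite exprS; lra.
    apply: le_trans H _; apply: ler_wpM2l; first by rewrite mulr_ge0// sqrtr_ge0.
    by rewrite gerBl exprn_ge0.
  have : `|g x - f k x| <= 2 * Num.sqrt s * 2^-1 ^+ k.
    rewrite ler_distl.
    set dl := 2 * _ * _ in cauchy *.
    have : ((f k x - dl)%:E <= limn_esup (fun n => (f n x)%:E) <= (f k x + dl)%:E)%E.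
      apply: (@limn_esup_between _ _ k) => n kn; rewrite !lee_fin -ler_distl.
      by rewrite -(subnK kn) cauchy.
    rewrite /g; case: (limn_esup _) => [r| |] /=; rewrite ?lee_fin//.
      by case/andP.
  rewrite -ler_sqr ?nnegrE ?mulr_ge0 ?exprn_ge0 ?sqrtr_ge0// => H.
  rewrite real_normK ?num_real// in H; apply: le_trans H _.
  rewrite !exprMn sqr_sqrtr// -exprM mulnC exprM.
  have -> : 2^-1 ^+ 2 = 4^-1 :> R by lra.
  by rewrite le_eqVlt; apply/orP; left; apply/eqP; ring.
exists g; split=> // k.
apply: (@le_trans _ _ (\int[mu]_(x in D) ((4 * 4^-1 ^+ k)%:E * S x))%E).
  apply: ge0_le_integral => //.
  - by move=> x _; rewrite lee_fin sqr_ge0.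
  - by apply/measurable_EFinP; apply: measurable_funX; exact: measurable_funB.
  - exact: measurable_funeM.
rewrite ge0_integralZl_EFin// ?mulr_ge0 ?exprn_ge0//.
apply: (@le_trans _ _ ((4 * 4^-1 ^+ k)%:E * 2%:E)%E).
  by apply: lee_wpmul2l => //; rewrite lee_fin mulr_ge0// exprn_ge0.
by rewrite -EFinM lee_fin; lra.
Qed.

Section FiniteMeasure.
Variable h : R.
Hypothesis h0 : 0 < h.
Hypothesis muD : mu D = h%:E.

Lemma intg_cst (c : R) : intg (fun _ => c).
Proof.
apply/integrableP; split; first exact: measurable_cst.
rewrite (eq_integral (fun _ => `|c|%:E)) => [|x _ //].
by rewrite integral_cst//= muD -EFinM ltry.
Qed.

Lemma Int_cst (c : R) : Int (fun _ => c) = c * h.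
Proof. by rewrite Rintegral_cst// muD. Qed.

Lemma bounded_intg f M : measurable_fun D f -> (forall x, D x -> `|f x| <= M) ->
  intg f.
Proof. by move=> mf fM; apply: intg_le (intg_cst M) fM. Qed.

Lemma bounded_sqint f M : measurable_fun D f -> (forall x, D x -> `|f x| <= M) ->
  sqint f.
Proof.
move=> mf fM; split=> //; apply: (@bounded_intg _ (M ^+ 2)).
  exact: measurable_funX.
move=> x Dx; rewrite normrX lerXn2r ?nnegrE ?fM//.
by rewrite (le_trans _ (fM _ Dx)).
Qed.

(** Integration of [f^2 >= 2 m f - m^2], where [m] is the mean of [f]. *)
Lemma jensen_sq f : intg f -> sqint f ->
  (Int f) ^+ 2 <= h * Int (fun x => f x ^+ 2).
Proof.
move=> fi [_ f2i]; set m := Int f / h.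
have : Int (fun x => (2 * m) * f x - m ^+ 2) <= Int (fun x => f x ^+ 2).
  apply: le_Rintegral => //; first by apply: intgB (intgZ _ fi) (intg_cst _).
  by move=> x _; have := sqr_ge0 (f x - m); nra.
rewrite RintegralB ?Int_cst ?RintegralZl//; [|exact: intgZ|exact: intg_cst].
have -> : Int f = m * h by rewrite /m divfK// gt_eqF.
move=> H; have := ler_wpM2l (ltW h0) H.
by apply: le_trans; rewrite le_eqVlt; apply/orP; left; apply/eqP; ring.
Qed.

(** A function differs from its mean by at most its oscillation [dl].  When
    [dl] is the integral of a bound of the derivative, this is the Poincare
    inequality on an interval. *)
Lemma second_moment_oscillation f dl : intg f -> sqint f ->
  (forall x y, D x -> D y -> `|f x - f y| <= dl) ->
  Int (fun x => f x ^+ 2) <= h^-1 * (Int f) ^+ 2 + h * dl ^+ 2.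
Proof.
move=> fi [mf f2i] osc; set m := Int f / h.
have Im : Int f = m * h by rewrite /m divfK// gt_eqF.
have fm x : D x -> `|f x - m| <= dl.
  move=> Dx; rewrite ler_norml.
  have L : Int (fun _ => f x - dl) <= Int f.
    apply: le_Rintegral => //; first exact: intg_cst.
    by move=> y Dy; have := osc x y Dx Dy; rewrite ler_norml => /andP[_]; lra.
  have U : Int f <= Int (fun _ => f x + dl).
    apply: le_Rintegral => //; first exact: intg_cst.
    by move=> y Dy; have := osc x y Dx Dy; rewrite ler_norml => /andP[]; lra.
  rewrite !Int_cst Im !ler_pM2r// in L U.
  by apply/andP; split; lra.
have : Int (fun x => f x ^+ 2) <= Int (fun x => (2 * m) * f x + (dl ^+ 2 - m ^+ 2)).
  apply: le_Rintegral => //; first by apply: intgD (intgZ _ fi) (intg_cst _).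
  move=> x Dx; have := fm x Dx; rewrite -ler_sqr ?nnegrE//; last first.
    by rewrite (le_trans _ (fm x Dx)).
  by rewrite real_normK ?num_real//; nra.
rewrite RintegralD ?Int_cst ?RintegralZl//; [|exact: intgZ|exact: intg_cst].
rewrite Im => H; apply: le_trans H _.
rewrite le_eqVlt; apply/orP; left; apply/eqP.
have hh : h^-1 * h = 1 by rewrite mulVf// gt_eqF.
have -> : h^-1 * (m * h) ^+ 2 = m ^+ 2 * h * (h^-1 * h) by ring.
by rewrite hh; ring.
Qed.

End FiniteMeasure.

End SquareIntegrable.

(** * Truncation along a line *)

(** The situation is that of a line crossing a hole: [K] and [W] are the traces
    of the closed and of the open hole. *)
Section LineTruncation.
Context {R : realType}.
Notation leb := (@lebesgue_measure R).
Variables (f : R -> R) (K W : set R).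
Hypothesis df : forall t, derivable f t 1.
Hypothesis cf' : continuous (fun t : R => 'D_1 f t).
Hypothesis clK : closed K.
Hypothesis opW : open W.
Hypothesis WK : W `<=` K.
Hypothesis f0 : forall t, K t -> ~ W t -> f t = 0.

Let g t := `|'D_1 f t| * \1_(~` K) t.
Let J a b := Rintegral leb `[a, b] g.

Let cf : continuous f.
Proof.
by move=> t; apply: differentiable_continuous; exact/derivable1_diffP.
Qed.

Let g0 t : 0 <= g t.
Proof. by rewrite mulr_ge0. Qed.

Let ig a b : leb.-integrable `[a, b] (EFin \o g).
Proof.
have i' : leb.-integrable `[a, b] (EFin \o (fun t : R => `|'D_1 f t|)).
  apply: integrable_norm; apply: continuous_compact_integrable.
    exact: segment_compact.
  exact: continuous_subspaceT.
have mg : measurable_fun `[a, b] g.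
  apply: measurable_funM.
    apply: measurable_funTS; apply: (measurableT_comp (@normr_measurable R setT)).
    exact: continuous_measurable_fun.
  by apply: measurable_indic; apply: measurableC; exact: closed_measurable.
apply: intg_le i' _ => // x _; rewrite ger0_norm ?g0// /g ler_piMr//.
Qed.

Let Jadd a b c : a <= b -> b <= c -> J a c = J a b + J b c.
Proof.
move=> ab bc; rewrite /J; have := @Rintegral_itvB _ g (BLeft a) (BRight c) b (ig a c).
rewrite !bnd_simp => /(_ ab bc) H.
rewrite -[X in _ + X]Rintegral_itv_obnd_cbnd; first by rewrite -H addrC subrK.
apply: integrableS (ig b c) => //.
by apply: subset_itvr; rewrite bnd_simp.
Qed.

Let J0 a b : 0 <= J a b.
Proof. by apply: Rintegral_ge0 => x _; exact: g0. Qed.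

Let free a b : a <= b -> (forall t, a < t < b -> ~ K t) -> `|f b - f a| <= J a b.
Proof.
rewrite le_eqVlt => /predU1P[->|ab] Kt; first by rewrite subrr normr0.
have c' : {within `[a, b], continuous (fun t : R => 'D_1 f t)}.
  exact: continuous_subspaceT.
have := @continuous_FTC2 _ (fun t => 'D_1 f t) f a b ab c'.
have i' : leb.-integrable `[a, b] (EFin \o (fun t : R => 'D_1 f t)).
  apply: continuous_compact_integrable => //; exact: segment_compact.
rewrite Int_ereal// => H.
have {H} : f b - f a = Rintegral leb `[a, b] (fun t : R => 'D_1 f t).
  have : (f b - f a)%:E = (Rintegral leb `[a, b] (fun t : R => 'D_1 f t))%:E.
    rewrite H; first by [].
      split; first by move=> x _; exact: df.
        by apply: cvg_at_right_filter; exact: cf.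
      by apply: cvg_at_left_filter; exact: cf.
    by move=> x _; rewrite derive1E.
  by case.
move=> ->; apply: le_trans (le_normr_Rintegral _ _) _ => //.
rewrite /J.
rewrite -Rintegral_itv_bndo_bndc; last first.
  apply: integrableS (integrable_norm i') => //.
  by apply: subset_itvl; rewrite bnd_simp.
rewrite -[leRHS]Rintegral_itv_bndo_bndc; last first.
  apply: integrableS (ig a b) => //.
  by apply: subset_itvl; rewrite bnd_simp.
rewrite -Rintegral_itv_obnd_cbnd; last first.
  by apply: integrableS (integrable_norm i') => //; exact: subset_itv_oo_cc.
rewrite -[leRHS]Rintegral_itv_obnd_cbnd; last first.
  by apply: integrableS (ig a b) => //; exact: subset_itv_oo_cc.
rewrite le_eqVlt; apply/orP; left; apply/eqP.
apply: eq_Rintegral => x; rewrite inE/= in_itv/= => /Kt nKx.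
by rewrite /g indicE mem_set// mulr1.
Qed.

Let zero_of_left x a : x < a -> K a -> (forall t, x <= t < a -> ~ K t) -> f a = 0.
Proof.
move=> xa Ka nK; apply: f0 => // Wa.
have : \forall t \near a^'-, W t.
  by apply: (cvg_at_left_filter cvg_id); exact: open_nbhs_nbhs.
move=> Wn; have : \forall t \near a^'-, False.
  near=> t; apply: (nK t); last by apply: WK; near: t.
  apply/andP; split; last by near: t; exact: nbhs_left_lt.
  by apply: ltW; near: t; exact: nbhs_left_gt.
by case/filter_ex.
Unshelve. all: by end_near. Qed.

Let zero_of_right y b : b < y -> K b -> (forall t, b < t <= y -> ~ K t) -> f b = 0.
Proof.
move=> by_ Kb nK; apply: f0 => // Wb.
have : \forall t \near b^'+, W t.
  by apply: (cvg_at_right_filter cvg_id); exact: open_nbhs_nbhs.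
move=> Wn; have : \forall t \near b^'+, False.
  near=> t; apply: (nK t); last by apply: WK; near: t.
  apply/andP; split; first by near: t; exact: nbhs_right_gt.
  by apply: ltW; near: t; exact: nbhs_right_lt.
by case/filter_ex.
Unshelve. all: by end_near. Qed.

Let cptK x z : compact (K `&` `[x, z]).
Proof.
apply: (subclosed_compact _ (@segment_compact _ x z)) => //.
apply: closedI => //; exact: interval_closed.
Qed.

Let first_zero x z : x <= z -> ~ K x -> K z ->
  exists a, [/\ x <= a, a <= z & f a = 0 /\ forall t, x < t < a -> ~ K t].
Proof.
move=> xz nKx Kz.
have A0 : K `&` `[x, z] !=set0 by exists z; split => //=; rewrite in_itv/= xz lexx.
have [a] := @compact_EVT_min R R id _ A0 (@cptK x z) (continuous_subspaceT (fun t => cvg_id)).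
rewrite inE /= in_itv/= => -[Ka /andP[xa az]] amin.
have xa' : x < a by rewrite lt_neqAle xa andbT; apply: contra_notN nKx => /eqP ->.
have nK t : x <= t < a -> ~ K t.
  move=> /andP[xt ta] Kt; suff : a <= t by rewrite leNgt ta.
  by apply: amin; rewrite inE /= in_itv/= xt (le_trans (ltW ta)).
exists a; split => //; split; first exact: (zero_of_left xa').
by move=> t /andP[xt ta]; apply: nK; rewrite (ltW xt).
Qed.

Let last_zero y z : z <= y -> ~ K y -> K z ->
  exists b, [/\ z <= b, b <= y & f b = 0 /\ forall t, b < t < y -> ~ K t].
Proof.
move=> zy nKy Kz.
have A0 : K `&` `[z, y] !=set0 by exists z; split => //=; rewrite in_itv/= zy lexx.
have [b] := @compact_EVT_max R R id _ A0 (@cptK z y) (continuous_subspaceT (fun t => cvg_id)).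
rewrite inE /= in_itv/= => -[Kb /andP[zb b_y]] bmax.
have b_y' : b < y by rewrite lt_neqAle b_y andbT; apply: contra_notN nKy => /eqP <-.
have nK t : b < t <= y -> ~ K t.
  move=> /andP[bt ty] Kt; suff : t <= b by rewrite leNgt bt.
  by apply: bmax; rewrite inE /= in_itv/= ty andbT (le_trans zb (ltW bt)).
exists b; split => //; split; first exact: (zero_of_right b_y').
by move=> t /andP[bt ty]; apply: nK; rewrite bt ltW.
Qed.

(** Extension by zero keeps the fundamental theorem of calculus as an
    inequality: a path that enters [K] does so through [K `\` W], where [f]
    vanishes, and only the parts of the path outside [K] contribute. *)
Lemma trunc_increment x y : x <= y ->
  `|f x * \1_(~` K) x - f y * \1_(~` K) y| <=
  Rintegral leb `[x, y] (fun t => `|'D_1 f t| * \1_(~` K) t).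
Proof.
move=> xy; rewrite -/g -/(J x y).
have [Kx|nKx] := pselect (K x); have [Ky|nKy] := pselect (K y).
- by rewrite !indicE !memNset//= !mulr0 subrr normr0.
- have [b [xb b_y [fb nK]]] := last_zero xy nKy Kx.
  rewrite !indicE memNset//= mem_set//= mulr0 mulr1 sub0r normrN.
  rewrite (Jadd xb b_y) -[f y]subr0 -fb (le_trans (free b_y nK))//.
  by rewrite lerDr.
- have [a [xa ay [fa nK]]] := first_zero xy nKx Ky.
  rewrite !indicE mem_set//= memNset//= mulr0 mulr1 subr0.
  rewrite (Jadd xa ay) -normrN -[- f x]add0r -fa (le_trans (free xa nK))//.
  by rewrite lerDl.
- rewrite !indicE !mem_set//= !mulr1 distrC.
  have [[z [Kz xz zy]]|none] := pselect (exists z, [/\ K z, x <= z & z <= y]); last first.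
    apply: free => // t /andP[xt ty] Kt; apply: none; exists t.
    by split=> //; exact: ltW.
  have [b [zb b_y [fb nKb]]] := last_zero zy nKy Kz.
  have [a [xa az [fa nKa]]] := first_zero xz nKx Kz.
  rewrite (Jadd xa (le_trans az (le_trans zb b_y))) (Jadd (le_trans az zb) b_y).
  have -> : f y - f x = (f a - f x) + (f y - f b) by rewrite fa fb; ring.
  rewrite (le_trans (ler_normD _ _))// lerD//; first exact: free.
  by rewrite (le_trans (free b_y nKb))// lerDr.
Qed.

End LineTruncation.

(** * Lebesgue measure on the plane *)

HB.instance Definition _ (R : realType) := Measure.on (@plane_measure R).

Section PlaneMeasure.
Context {R : realType}.
Local Notation P := (R * R)%type.
Local Notation leb := (@lebesgue_measure R).
Local Notation pm := (@plane_measure R).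
Local Notation plane := (@plane R).

(** The measurable sets of the plane are generated by products, hence the
    covering by rational boxes. *)
Lemma open_plane_measurable (O : set P) : open O -> measurable (O : set plane).
Proof.
move=> oO.
pose box (q : (rat * rat) * (rat * rat)) : set plane :=
  `]ratr q.1.1, ratr q.1.2[ `*` `]ratr q.2.1, ratr q.2.2[.
pose F q : set plane := if `[< box q `<=` O >] then box q else set0.
have -> : O = \bigcup_q F q.
  apply/seteqP; split => [x Ox|x [q _]]; last first.
    by rewrite /F; case: asboolP => // /[apply].
  have /nbhs_ballP[e /= e0 eO] : nbhs x O by exact: open_nbhs_nbhs.
  have q1 (t : R) : exists q : rat, t - e < ratr q < t.
    have /rat_in_itvoo[q] : t - e < t by rewrite ltrBlDr ltrDl.
    by rewrite in_itv/= => ?; exists q.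
  have q2 (t : R) : exists q : rat, t < ratr q < t + e.
    have /rat_in_itvoo[q] : t < t + e by rewrite ltrDl.
    by rewrite in_itv/= => ?; exists q.
  have [a /andP[a1 a2]] := q1 x.1; have [b /andP[b1 b2]] := q2 x.1.
  have [c /andP[c1 c2]] := q1 x.2; have [d /andP[d1 d2]] := q2 x.2.
  exists ((a, b), (c, d)) => //; rewrite /F asboolT.
    by split => /=; rewrite in_itv/= ?a2 ?b1 ?c2 ?d1.
  move=> y [/=]; rewrite !in_itv/= => /andP[ay yb] /andP[cy yd].
  by apply: eO; split; rewrite /ball/= ltr_distlC; apply/andP; split; lra.
apply: countable_bigcupT_measurable => // q.
rewrite /F; case: ifP => _ //.
by apply: measurableX; exact: measurable_itv.
Qed.

Lemma closed_plane_measurable (O : set P) : closed O -> measurable (O : set plane).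
Proof.
by move=> cO; rewrite -(setCK O); apply: measurableC; apply: open_plane_measurable; exact: closed_openC.
Qed.

Lemma continuous_plane_measurable (D : set plane) (f : P -> R) :
  continuous f -> measurable_fun D (f : plane -> R).
Proof.
move=> /continuousP cf; apply: measurable_funTS.
apply: (measurability _ (RGenOpens.measurableE R)).
move=> _ [_ [a [b ->] <-]]; rewrite setTI; apply: open_plane_measurable.
exact/cf/interval_open.
Qed.

Lemma plane_measureX (A B : set R) :
  measurable (A : set (measurableTypeR R)) -> measurable (B : set (measurableTypeR R)) ->
  pm (A `*` B) = (leb A * leb B)%E.
Proof. by move=> mA mB; rewrite /plane_measure product_measure1E. Qed.

Lemma vline_null (c : R) : pm ([set c] `*` setT) = 0%E.
Proof. by rewrite plane_measureX// lebesgue_measure_set1 mul0e. Qed.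

Lemma hline_null (c : R) : pm (setT `*` [set c]) = 0%E.
Proof. by rewrite plane_measureX// lebesgue_measure_set1 mule0. Qed.

Lemma measurable_shift1 (a : R) : measurable_fun setT (fun x : measurableTypeR R => x + a : measurableTypeR R).
Proof. exact: measurable_funD. Qed.

Lemma lebesgue_shift (a : R) (A : set (measurableTypeR R)) : measurable A ->
  leb ((fun x => x + a) @^-1` A) = leb A.
Proof.
move=> mA.
pose phi : {mfun measurableTypeR R >-> measurableTypeR R} :=
  HB.pack (fun x : measurableTypeR R => x + a : measurableTypeR R)
   (isMeasurableFun.Build _ _ _ _ _ (measurable_shift1 a)).
suff : leb A = pushforward leb phi A by move=> ->.
apply: lebesgue_measure_unique => // _ [[b c]] _ <-.
transitivity (leb `](b - a), (c - a)]); last first.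
  congr (leb _); apply/seteqP; split => x /=; rewrite !in_itv/=.
    by rewrite ltrBlDr lerBrDr.
  by rewrite ltrBlDr lerBrDr.
by rewrite !lebesgue_measure_itv/= !lte_fin ltrD2r -!EFinB; case: ifP => // _; congr EFin; ring.
Qed.

Lemma measurable_shift2 (a : P) : measurable_fun setT (fun x : plane => x + a : plane).
Proof.
apply: measurable_fun_pair => /=.
  by apply: (measurableT_comp (measurable_shift1 a.1)); exact: measurable_fst.
by apply: (measurableT_comp (measurable_shift1 a.2)); exact: measurable_snd.
Qed.

(** A product measure is determined by its values on rectangles, where
    translation invariance is that of the one-dimensional measure. *)
Lemma plane_shift (a : P) (g : P -> \bar R) (D : set P) :
  measurable (D : set plane) -> measurable_fun (D : set plane) (g : plane -> \bar R) ->
  (forall x, (0 <= g x)%E) ->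
  (\int[pm]_(x in D) g x = \int[pm]_(x in [set x : P | D (x + a)%R]) g (x + a)%R)%E.
Proof.
move=> mD mg g0.
pose phi : {mfun plane >-> plane} :=
  HB.pack (fun x : plane => x + a : plane)
   (isMeasurableFun.Build _ _ _ _ _ (measurable_shift2 a)).
have -> : (\int[pm]_(x in [set x : P | D (x + a)%R]) g (x + a)%R =
   \int[pushforward pm phi]_(x in D) g x)%E.
  by rewrite ge0_integral_pushforward.
apply: eq_measure_integral => X mX _.
rewrite [RHS]/= /plane_measure.
apply: (product_measure_unique (m' := pushforward pm phi)) => // A B mA mB.
rewrite /pushforward.
transitivity (pm (((fun x : R => x + a.1) @^-1` A) `*` ((fun x : R => x + a.2) @^-1` B))).
  by [].
rewrite plane_measureX; last 2 first.
- by rewrite -[X in measurable X]setTI; exact: measurable_shift1.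
- by rewrite -[X in measurable X]setTI; exact: measurable_shift1.
by congr mule; exact: lebesgue_shift.
Qed.

End PlaneMeasure.

(** * Iterated integrals on a rectangle *)

Lemma Int_subset d (T : measurableType d) (R : realType)
    (mu : {measure set T -> \bar R}) (A B : set T) (f : T -> R) :
  measurable A -> measurable B -> A `<=` B -> mu.-integrable B (EFin \o f) ->
  (forall x, B x -> 0 <= f x) -> Rintegral mu A f <= Rintegral mu B f.
Proof.
move=> mA mB AB fi f0.
have fiA : mu.-integrable A (EFin \o f) by exact: integrableS fi.
rewrite -lee_fin -!Int_ereal//; apply: ge0_subset_integral => //.
by apply/measurable_EFinP; exact: (intg_measurable fi).
Qed.

Section RectangleTonelli.
Context {R : realType}.
Local Notation leb := (@lebesgue_measure R).
Local Notation pm := (@plane_measure R).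
Local Notation plane := (@plane R).
Local Notation mR := (measurableTypeR R).
Variables (A B : set mR) (ha hb : R).
Hypothesis mA : measurable A.
Hypothesis mB : measurable B.
Hypothesis lA : leb A = ha%:E.
Hypothesis lB : leb B = hb%:E.

Definition int_fst (F : R * R -> R) (s : R) := Rintegral leb A (fun t => F (t, s)).
Definition int_snd (F : R * R -> R) (t : R) := Rintegral leb B (fun s => F (t, s)).

Section OneFunction.
Variables (F : R * R -> R) (M : R).
Hypothesis mF : measurable_fun (setT : set plane) (F : plane -> R).
Hypothesis FM : forall x, `|F x| <= M.

Lemma measurable_slice_fst s (D : set mR) : measurable_fun D (fun t : mR => F (t, s)).
Proof. by apply: measurable_funTS; apply: (measurableT_comp mF); exact: pair2_measurable. Qed.

Lemma measurable_slice_snd t (D : set mR) : measurable_fun D (fun s : mR => F (t, s)).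
Proof. by apply: measurable_funTS; apply: (measurableT_comp mF); exact: pair1_measurable. Qed.

Lemma slice_fst_intg s : leb.-integrable A (EFin \o (fun t => F (t, s))).
Proof.
by apply: (bounded_intg mA lA (M := M)) => //; exact: measurable_slice_fst.
Qed.

Lemma slice_snd_intg t : leb.-integrable B (EFin \o (fun s => F (t, s))).
Proof.
by apply: (bounded_intg mB lB (M := M)) => //; exact: measurable_slice_snd.
Qed.

Lemma slice_fst_sqint s : sqint leb A (fun t => F (t, s)).
Proof.
by apply: (bounded_sqint mA lA (M := M)) => //; exact: measurable_slice_fst.
Qed.

Lemma slice_snd_sqint t : sqint leb B (fun s => F (t, s)).
Proof.
by apply: (bounded_sqint mB lB (M := M)) => //; exact: measurable_slice_snd.
Qed.

Lemma int_fst_bounded s : `|int_fst F s| <= M * ha.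
Proof.
apply: le_trans (le_normr_Rintegral mA (slice_fst_intg s)) _.
rewrite -(Int_cst mA lA); apply: le_Rintegral => //.
  by apply: integrable_norm; exact: slice_fst_intg.
exact: (intg_cst mA lA).
Qed.

Lemma int_snd_bounded t : `|int_snd F t| <= M * hb.
Proof.
apply: le_trans (le_normr_Rintegral mB (slice_snd_intg t)) _.
rewrite -(Int_cst mB lB); apply: le_Rintegral => //.
  by apply: integrable_norm; exact: slice_snd_intg.
exact: (intg_cst mB lB).
Qed.

End OneFunction.

Section NonnegativeFunction.
Variables (F : R * R -> R) (M : R).
Hypothesis mF : measurable_fun (setT : set plane) (F : plane -> R).
Hypothesis FM : forall x, `|F x| <= M.
Hypothesis F0 : forall x, 0 <= F x.

Let f : plane -> \bar R := (EFin \o F) \_ (A `*` B).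

Let mf : measurable_fun setT f.
Proof.
apply/(measurable_restrictT _ _).1; first exact: measurableX.
by apply/measurable_EFinP; exact: measurable_funTS.
Qed.

Let f0 x : (0 <= f x)%E.
Proof. by apply: erestrict_ge0 => y _; rewrite lee_fin. Qed.

Let inner_fst s : (\int[leb]_t f (t, s))%E = ((EFin \o int_fst F) \_ B) s.
Proof.
rewrite patchE; case: ifPn => Bs.
  rewrite /= /int_fst -Int_ereal//; last exact: (slice_fst_intg mF FM).
  rewrite [RHS]integral_mkcond; apply: eq_integral => t _.
  by rewrite /f !patchE in_setX/= Bs andbT.
by rewrite integral0_eq// => t _; rewrite /f patchE in_setX/= (negbTE Bs) andbF.
Qed.

Let inner_snd t : (\int[leb]_s f (t, s))%E = ((EFin \o int_snd F) \_ A) t.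
Proof.
rewrite patchE; case: ifPn => At.
  rewrite /= /int_snd -Int_ereal//; last exact: (slice_snd_intg mF FM).
  rewrite [RHS]integral_mkcond; apply: eq_integral => s _.
  by rewrite /f !patchE in_setX/= At.
by rewrite integral0_eq// => s _; rewrite /f patchE in_setX/= (negbTE At).
Qed.

Lemma tonelli_fst : Rintegral pm (A `*` B) F = Rintegral leb B (int_fst F).
Proof.
rewrite /Rintegral integral_mkcond -/f /plane_measure fubini_tonelli2//.
rewrite [in RHS]integral_mkcond; congr fine; apply: eq_integral => s _.
by rewrite -inner_fst.
Qed.

Lemma tonelli_snd : Rintegral pm (A `*` B) F = Rintegral leb A (int_snd F).
Proof.
rewrite /Rintegral integral_mkcond -/f /plane_measure fubini_tonelli1//.
rewrite [in RHS]integral_mkcond; congr fine; apply: eq_integral => t _.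
by rewrite -inner_snd.
Qed.

Lemma int_fst_ge0_measurable : measurable_fun B (int_fst F).
Proof.
have : measurable_fun setT (fubini_G leb f).
  exact: measurable_fun_fubini_tonelli_G.
move=> /(measurable_funS measurableT (@subsetT _ B)) H.
apply/measurable_EFinP; apply: eq_measurable_fun H => s Bs.
by rewrite /fubini_G inner_fst patchE Bs.
Qed.

Lemma int_snd_ge0_measurable : measurable_fun A (int_snd F).
Proof.
have : measurable_fun setT (fubini_F leb f).
  exact: measurable_fun_fubini_tonelli_F.
move=> /(measurable_funS measurableT (@subsetT _ A)) H.
apply/measurable_EFinP; apply: eq_measurable_fun H => s Bs.
by rewrite /fubini_F inner_snd patchE Bs.
Qed.

End NonnegativeFunction.

Lemma int_fst_measurable F M :
  measurable_fun (setT : set plane) (F : plane -> R) -> (forall x, `|F x| <= M) ->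
  measurable_fun B (int_fst F).
Proof.
move=> mF FM.
have mF' : measurable_fun (setT : set plane) ((fun x => F x + M) : plane -> R).
  exact: measurable_funD.
have F'0 x : 0 <= F x + M by have := FM x; rewrite ler_norml => /andP[]; lra.
have F'M x : `|F x + M| <= M + M.
  rewrite (le_trans (ler_normD _ _))// lerD ?FM// ger0_norm//.
  by rewrite (le_trans _ (FM x)).
apply: (@eq_measurable_fun _ _ _ _ _ (fun s => int_fst (fun x => F x + M) s - M * ha)).
  move=> s _; rewrite /int_fst RintegralD//; last 2 first.
  - exact: slice_fst_intg FM s.
  - exact: intg_cst lA _.
  by rewrite (Int_cst mA lA) addrK.
by apply: measurable_funB => //; exact: int_fst_ge0_measurable F'M F'0.
Qed.

End RectangleTonelli.

(** * Poincare inequality on a rectangle *)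

Section RectanglePoincare.
Context {R : realType}.
Local Notation leb := (@lebesgue_measure R).
Local Notation pm := (@plane_measure R).
Local Notation plane := (@plane R).
Local Notation mR := (measurableTypeR R).

(** A form of the fundamental theorem of calculus that survives truncation: [F]
    may jump out of smoothness as long as [g] controls its increments. *)
Definition increments (F g : R -> R) :=
  forall x x', x <= x' -> `|F x - F x'| <= Rintegral leb `[x, x'] g.

Variables (F g1 g2 : R * R -> R) (M : R).
Hypothesis mF : measurable_fun (setT : set plane) (F : plane -> R).
Hypothesis mg1 : measurable_fun (setT : set plane) (g1 : plane -> R).
Hypothesis mg2 : measurable_fun (setT : set plane) (g2 : plane -> R).
Hypothesis FM : forall x, `|F x| <= M.
Hypothesis g1M : forall x, `|g1 x| <= M.
Hypothesis g2M : forall x, `|g2 x| <= M.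
Hypothesis g10 : forall x, 0 <= g1 x.
Hypothesis g20 : forall x, 0 <= g2 x.
Hypothesis F1 : forall s, increments (fun t => F (t, s)) (fun t => g1 (t, s)).
Hypothesis F2 : forall t, increments (fun s => F (t, s)) (fun s => g2 (t, s)).

Let increments_osc (f g : R -> R) (a b : R) x x' :
  increments f g -> leb.-integrable `[a, b[ (EFin \o g) -> (forall t, 0 <= g t) ->
  `[a, b[%classic x -> `[a, b[%classic x' ->
  `|f x - f x'| <= Rintegral leb `[a, b[ g.
Proof.
move=> fg ig g0; wlog xx' : x x' / x <= x'.
  by move=> H ax ax'; have [/H|/ltW/H] := leP x x'; [apply|rewrite distrC; apply].
rewrite /= !in_itv/= => /andP[ax xb] /andP[ax' x'b].
apply: le_trans (fg _ _ xx') _; apply: Int_subset => //.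
by move=> t /=; rewrite !in_itv/= => /andP[xt tx']; rewrite (le_trans ax xt) (le_lt_trans tx' x'b).
Qed.

Lemma lebesgue_itv_co (a h : R) : 0 < h -> leb `[a, a + h[ = h%:E.
Proof.
by move=> h0; rewrite lebesgue_measure_itv/= lte_fin ltrDl h0 -EFinB addrAC subrr add0r.
Qed.

Lemma sqr_bounded (f : R * R -> R) (N : R) : (forall x, `|f x| <= N) ->
  forall x, `|f x ^+ 2| <= N ^+ 2.
Proof.
move=> fN x; rewrite normrX lerXn2r ?nnegrE ?fN//.
by rewrite (le_trans _ (fN x)).
Qed.

Definition rect (a h1 c h2 : R) : set plane := `[a, a + h1[ `*` `[c, c + h2[.

Definition rect_mean (a h1 c h2 : R) (f : R * R -> R) :=
  Rintegral leb `[c, c + h2[ (int_fst `[a, a + h1[ f).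

(** The interval inequality is used twice: for the slices in the first variable,
    with [g1], then for the partial means, whose oscillation is bounded by the
    integral of [g2] over the rectangle. *)
Lemma rect_poincare a h1 c h2 : 0 < h1 -> 0 < h2 ->
  Rintegral pm (rect a h1 c h2) (fun x => F x ^+ 2) <=
  (h1 * h2)^-1 * (rect_mean a h1 c h2 F) ^+ 2 +
  h1 ^+ 2 * Rintegral pm (rect a h1 c h2) (fun x => g1 x ^+ 2) +
  h2 ^+ 2 * Rintegral pm (rect a h1 c h2) (fun x => g2 x ^+ 2).
Proof.
move=> h10 h20; set S := rect _ _ _ _.
set A : set mR := `[a, a + h1[%classic; set B : set mR := `[c, c + h2[%classic.
have mA : measurable A by exact: measurable_itv.
have mB : measurable B by exact: measurable_itv.
have lA : leb A = h1%:E by exact: lebesgue_itv_co.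
have lB : leb B = h2%:E by exact: lebesgue_itv_co.
pose G := int_fst A F.
have mG : measurable_fun B G by exact: (int_fst_measurable mA mB lA mF FM).
have GM s : `|G s| <= M * h1 by exact: (int_fst_bounded mA lA mF FM).
have sG : sqint leb B G by exact: (bounded_sqint mB lB mG (fun s _ => GM s)).
have iG : leb.-integrable B (EFin \o G) by exact: (bounded_intg mB lB mG (fun s _ => GM s)).
have sq_m f : measurable_fun (setT : set plane) (f : plane -> R) ->
    measurable_fun (setT : set plane) ((fun x => f x ^+ 2) : plane -> R).
  by move=> mf; exact: measurable_funX.
have sq0 (f : R * R -> R) x : 0 <= f x ^+ 2 by exact: sqr_ge0.
have T1 f : measurable_fun (setT : set plane) (f : plane -> R) -> (forall x, `|f x| <= M) ->
    Rintegral pm S (fun x => f x ^+ 2) =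
    Rintegral leb B (int_fst A (fun x => f x ^+ 2)).
  move=> mf fM; exact: (tonelli_fst mA mB lA (sq_m _ mf) (sqr_bounded fM) (sq0 _)).
have T2 f : measurable_fun (setT : set plane) (f : plane -> R) -> (forall x, `|f x| <= M) ->
    Rintegral pm S (fun x => f x ^+ 2) =
    Rintegral leb A (int_snd B (fun x => f x ^+ 2)).
  move=> mf fM; exact: (tonelli_snd mA mB lB (sq_m _ mf) (sqr_bounded fM) (sq0 _)).
have iI f : measurable_fun (setT : set plane) (f : plane -> R) -> (forall x, `|f x| <= M) ->
    leb.-integrable B (EFin \o int_fst A (fun x => f x ^+ 2)).
  move=> mf fM; have mf2 := sq_m _ mf; have fM2 := sqr_bounded fM.
  apply: (bounded_intg mB lB (M := M ^+ 2 * h1)).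
    exact: (int_fst_measurable mA mB lA mf2 fM2).
  by move=> s _; exact: (int_fst_bounded mA lA mf2 fM2).
have E1 : Rintegral pm S (fun x => F x ^+ 2) <=
    h1^-1 * Rintegral leb B (fun s => G s ^+ 2) +
    h1 ^+ 2 * Rintegral pm S (fun x => g1 x ^+ 2).
  rewrite !T1//.
  rewrite -RintegralZl//; last exact: sG.2.
  rewrite -RintegralZl//; last exact: (iI _ mg1 g1M).
  rewrite -RintegralD//; last 2 first.
  - exact: (intgZ mB _ sG.2).
  - exact: (intgZ mB _ (iI _ mg1 g1M)).
  apply: le_Rintegral => //; first exact: (iI _ mF FM).
    exact: (intgD mB (intgZ mB _ sG.2) (intgZ mB _ (iI _ mg1 g1M))).
  move=> s _.
  have sF := slice_fst_sqint mA lA mF FM s.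
  have iF := slice_fst_intg mA lA mF FM s.
  have sg := slice_fst_sqint mA lA mg1 g1M s.
  have ig := slice_fst_intg mA lA mg1 g1M s.
  have osc x y : A x -> A y -> `|F (x, s) - F (y, s)| <= int_fst A g1 s.
    by move=> Ax Ay; exact: (increments_osc (F1 s)).
  apply: le_trans (second_moment_oscillation mA h10 lA iF sF osc) _.
  rewrite lerD2l expr2 -mulrA ler_pM2l//.
  exact: (jensen_sq mA h10 lA ig sg).
have E2 : Rintegral leb B (fun s => G s ^+ 2) <=
    h2^-1 * (rect_mean a h1 c h2 F) ^+ 2 +
    h1 * h2 ^+ 2 * Rintegral pm S (fun x => g2 x ^+ 2).
  set D := Rintegral leb A (int_snd B g2).
  have mH : measurable_fun A (int_snd B g2).
    exact: (int_snd_ge0_measurable mA mB lB mg2 g2M g20).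
  have HM t : `|int_snd B g2 t| <= M * h2 by exact: (int_snd_bounded mB lB mg2 g2M).
  have iH : leb.-integrable A (EFin \o int_snd B g2).
    exact: (bounded_intg mA lA mH (fun t _ => HM t)).
  have sH : sqint leb A (int_snd B g2).
    exact: (bounded_sqint mA lA mH (fun t _ => HM t)).
  have osc s s' : B s -> B s' -> `|G s - G s'| <= D.
    move=> Bs Bs'; rewrite /G /int_fst.
    have i1 := slice_fst_intg mA lA mF FM s.
    have i2 := slice_fst_intg mA lA mF FM s'.
    rewrite -RintegralB//; apply: le_trans (le_normr_Rintegral mA _) _.
      exact: intgB.
    apply: le_Rintegral => //; first by apply: integrable_norm; exact: intgB.
    move=> t _; apply: (increments_osc (F2 t)) => //.
    exact: (slice_snd_intg mB lB mg2 g2M t).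
  apply: le_trans (second_moment_oscillation mB h20 lB iG sG osc) _.
  rewrite /rect_mean -/A -/B -/G lerD2l.
  have J : D ^+ 2 <= h1 * (h2 * Rintegral pm S (fun x => g2 x ^+ 2)).
    apply: le_trans (jensen_sq mA h10 lA iH sH) _.
    rewrite ler_pM2l// T2// -RintegralZl//; last first.
      apply: (bounded_intg mA lA (M := M ^+ 2 * h2)).
        by apply: (int_snd_ge0_measurable mA mB lB (sq_m _ mg2) (sqr_bounded g2M) (sq0 _)).
      by move=> t _; exact: (int_snd_bounded mB lB (sq_m _ mg2) (sqr_bounded g2M)).
    apply: le_Rintegral => //; first exact: sH.2.
      apply: intgZ => //; apply: (bounded_intg mA lA (M := M ^+ 2 * h2)).
        by apply: (int_snd_ge0_measurable mA mB lB (sq_m _ mg2) (sqr_bounded g2M) (sq0 _)).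
      by move=> t _; exact: (int_snd_bounded mB lB (sq_m _ mg2) (sqr_bounded g2M)).
    move=> t _; apply: (jensen_sq mB h20 lB).
      exact: (slice_snd_intg mB lB mg2 g2M t).
    exact: (slice_snd_sqint mB lB mg2 g2M t).
  apply: le_trans (ler_wpM2l (ltW h20) J) _.
  by rewrite le_eqVlt; apply/orP; left; apply/eqP; ring.
apply: le_trans E1 _.
have E3 := ler_wpM2l (ltW (eqbRL (invr_gt0 h1) h10)) E2.
have hh : h1^-1 * h1 = 1 by rewrite mulVf// gt_eqF.
have X : h1^-1 * (h2^-1 * rect_mean a h1 c h2 F ^+ 2 +
    h1 * h2 ^+ 2 * Rintegral pm S (fun x => g2 x ^+ 2)) =
  (h1 * h2)^-1 * rect_mean a h1 c h2 F ^+ 2 +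
  (h1^-1 * h1) * h2 ^+ 2 * Rintegral pm S (fun x => g2 x ^+ 2).
  by rewrite invfM; ring.
rewrite X hh mul1r in E3.
by rewrite addrAC lerD2r.
Qed.

End RectanglePoincare.

(** * Subdivision of a rectangle *)

Section Grid.
Context {R : realType}.
Local Notation leb := (@lebesgue_measure R).
Local Notation pm := (@plane_measure R).
Local Notation plane := (@plane R).
Local Notation mR := (measurableTypeR R).

Lemma rect_measurable (a h1 c h2 : R) : measurable (rect a h1 c h2).
Proof. by apply: measurableX; exact: measurable_itv. Qed.

Lemma rect_finite (a h1 c h2 : R) : exists2 m : R, 0 <= m & pm (rect a h1 c h2) = m%:E.
Proof.
rewrite /rect plane_measureX ?lebesgue_measure_itv/=; [|exact: measurable_itv..].
case: ifPn; rewrite ?mul0e; last by exists 0.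
case: ifPn; rewrite ?mule0; last by exists 0.
rewrite !lte_fin -!EFinB -EFinM => *; eexists; last reflexivity.
by rewrite mulr_ge0// subr_ge0 ltW.
Qed.

Lemma rect_bounded_intg (a h1 c h2 : R) (f : R * R -> R) (M : R) :
  measurable_fun (setT : set plane) (f : plane -> R) -> (forall x, `|f x| <= M) ->
  pm.-integrable (rect a h1 c h2) (EFin \o f).
Proof.
move=> mf fM; have [m _ mE] := rect_finite a h1 c h2.
by apply: (bounded_intg (@rect_measurable a h1 c h2) mE (M := M)) => //; exact: measurable_funTS.
Qed.

Lemma Int_rect_fst (a h1 c h2 : R) n (f : R * R -> R) : 0 <= h1 ->
  pm.-integrable (rect a (n%:R * h1) c h2) (EFin \o f) ->
  Rintegral pm (rect a (n%:R * h1) c h2) f =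
  \sum_(i < n) Rintegral pm (rect (a + i%:R * h1) h1 c h2) f.
Proof.
move=> h10; elim: n => [|n IH] fi.
  rewrite big_ord0 /rect mul0r addr0 set_itvco0 set0X; exact: Rintegral_set0.
have E : rect a (n.+1%:R * h1) c h2 =
    rect a (n%:R * h1) c h2 `|` rect (a + n%:R * h1) h1 c h2.
  have nh : 0 <= n%:R * h1 by rewrite mulr_ge0.
  rewrite /rect -natr1 mulrDl mul1r; apply/seteqP; split => -[x y] /=; rewrite !in_itv/=.
    move=> [/andP[x1 x2] y1]; have [?|?] := ltP x (a + n%:R * h1); [left|right]; split=> //.
      by rewrite x1.
    by rewrite -addrA x2.
  by move=> [|] [/andP[x1 x2] y1]; split => //; apply/andP; split; lra.
rewrite E Rintegral_setU//; first last.
- apply/disj_setPS => -[x y] [[/= + _] [/= + _]]; rewrite !in_itv/=.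
  by move=> /andP[_ x1] /andP[x2 _]; move: x1; rewrite ltNge x2.
- by rewrite -E.
- exact: rect_measurable.
- exact: rect_measurable.
rewrite big_ord_recr/= IH//; apply: integrableS fi.
- exact: rect_measurable.
- exact: rect_measurable.
- by rewrite E; exact: subsetUl.
Qed.

Lemma Int_rect_snd (a h1 c h2 : R) n (f : R * R -> R) : 0 <= h2 ->
  pm.-integrable (rect a h1 c (n%:R * h2)) (EFin \o f) ->
  Rintegral pm (rect a h1 c (n%:R * h2)) f =
  \sum_(i < n) Rintegral pm (rect a h1 (c + i%:R * h2) h2) f.
Proof.
move=> h10; elim: n => [|n IH] fi.
  rewrite big_ord0 /rect mul0r addr0 set_itvco0 setX0; exact: Rintegral_set0.
have E : rect a h1 c (n.+1%:R * h2) =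
    rect a h1 c (n%:R * h2) `|` rect a h1 (c + n%:R * h2) h2.
  have nh : 0 <= n%:R * h2 by rewrite mulr_ge0.
  rewrite /rect -natr1 mulrDl mul1r; apply/seteqP; split => -[x y] /=; rewrite !in_itv/=.
    move=> [x1 /andP[y1 y2]]; have [?|?] := ltP y (c + n%:R * h2); [left|right]; split=> //.
      by rewrite y1.
    by rewrite -addrA y2.
  by move=> [|] [x1 /andP[y1 y2]]; split => //; apply/andP; split; lra.
rewrite E Rintegral_setU//; first last.
- apply/disj_setPS => -[x y] [[/= _ +] [/= _ +]]; rewrite !in_itv/=.
  by move=> /andP[_ x1] /andP[x2 _]; move: x1; rewrite ltNge x2.
- by rewrite -E.
- exact: rect_measurable.
- exact: rect_measurable.
rewrite big_ord_recr/= IH//; apply: integrableS fi.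
- exact: rect_measurable.
- exact: rect_measurable.
- by rewrite E; exact: subsetUl.
Qed.

Lemma Int_grid (a h1 c h2 : R) n (f : R * R -> R) (M : R) : 0 <= h1 -> 0 <= h2 ->
  measurable_fun (setT : set plane) (f : plane -> R) -> (forall x, `|f x| <= M) ->
  Rintegral pm (rect a (n%:R * h1) c (n%:R * h2)) f =
  \sum_(i < n) \sum_(j < n) Rintegral pm (rect (a + i%:R * h1) h1 (c + j%:R * h2) h2) f.
Proof.
move=> h10 h20 mf fM; rewrite Int_rect_fst//; last exact: rect_bounded_intg fM.
apply: eq_bigr => i _; rewrite Int_rect_snd//; exact: rect_bounded_intg fM.
Qed.

Lemma rect_mean_sqr (a h1 c h2 M : R) (F : R * R -> R) : 0 < h1 -> 0 < h2 ->
  measurable_fun (setT : set plane) (F : plane -> R) -> (forall x, `|F x| <= M) ->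
  rect_mean a h1 c h2 F ^+ 2 <= h1 * h2 * Rintegral pm (rect a h1 c h2) (fun x => F x ^+ 2).
Proof.
move=> h10 h20 mF FM.
set A : set mR := `[a, a + h1[%classic; set B : set mR := `[c, c + h2[%classic.
have mA : measurable A by exact: measurable_itv.
have mB : measurable B by exact: measurable_itv.
have lA : leb A = h1%:E by exact: lebesgue_itv_co.
have lB : leb B = h2%:E by exact: lebesgue_itv_co.
have mF2 : measurable_fun (setT : set plane) ((fun x => F x ^+ 2) : plane -> R).
  exact: measurable_funX.
have FM2 := sqr_bounded FM.
have mG : measurable_fun B (int_fst A F) by exact: (int_fst_measurable mA mB lA mF FM).
have GM s : `|int_fst A F s| <= M * h1 by exact: (int_fst_bounded mA lA mF FM).
have sG := bounded_sqint mB lB mG (fun s _ => GM s).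
have iG := bounded_intg mB lB mG (fun s _ => GM s).
have iH : leb.-integrable B (EFin \o int_fst A (fun x => F x ^+ 2)).
  apply: (bounded_intg mB lB (M := M ^+ 2 * h1)).
    exact: (int_fst_measurable mA mB lA mF2 FM2).
  by move=> s _; exact: (int_fst_bounded mA lA mF2 FM2).
apply: le_trans (jensen_sq mB h20 lB iG sG) _.
rewrite (mulrC h1) -mulrA ler_pM2l//.
rewrite (tonelli_fst mA mB lA mF2 FM2 (fun x => sqr_ge0 _)) -RintegralZl//.
apply: le_Rintegral => //; first exact: sG.2.
  exact: (intgZ mB).
move=> s _; apply: (jensen_sq mA h10 lA).
  exact: (slice_fst_intg mA lA mF FM).
exact: (slice_fst_sqint mA lA mF FM).
Qed.

Lemma rect_meanB (a h1 c h2 M N : R) (F G : R * R -> R) : 0 < h1 -> 0 < h2 ->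
  measurable_fun (setT : set plane) (F : plane -> R) -> (forall x, `|F x| <= M) ->
  measurable_fun (setT : set plane) (G : plane -> R) -> (forall x, `|G x| <= N) ->
  rect_mean a h1 c h2 (fun x => F x - G x) = rect_mean a h1 c h2 F - rect_mean a h1 c h2 G.
Proof.
move=> h10 h20 mF FM mG GN.
set A : set mR := `[a, a + h1[%classic; set B : set mR := `[c, c + h2[%classic.
have mA : measurable A by exact: measurable_itv.
have mB : measurable B by exact: measurable_itv.
have lA : leb A = h1%:E by exact: lebesgue_itv_co.
have lB : leb B = h2%:E by exact: lebesgue_itv_co.
have ii f K : measurable_fun (setT : set plane) (f : plane -> R) -> (forall x, `|f x| <= K) ->
    leb.-integrable B (EFin \o int_fst A f).
  move=> mf fK; apply: (bounded_intg mB lB (M := K * h1)).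
    exact: (int_fst_measurable mA mB lA mf fK).
  by move=> s _; exact: (int_fst_bounded mA lA mf fK).
rewrite /rect_mean -RintegralB//; [|exact: ii FM|exact: ii GN].
apply: eq_Rintegral => s _; rewrite /int_fst RintegralB//.
  exact: (slice_fst_intg mA lA mF FM).
exact: (slice_fst_intg mA lA mG GN).
Qed.

End Grid.

(** * Compactness along an ultrafilter *)

Section UltrafilterCompactness.
Context {R : realType}.
Local Notation pm := (@plane_measure R).
Local Notation plane := (@plane R).

Lemma invr_sqr_mulrn2 (x : R) (n : nat) : n%:R = x -> x != 0 -> x ^- 2 *+ n *+ n = 1.
Proof. by move=> nx x0; rewrite -mulrnA -mulr_natr natrM nx -expr2 mulVf// expf_neq0. Qed.

Lemma ultra_bounded_cvg (U : set_system nat) (f : nat -> R) (C : R) :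
  UltraFilter U -> (forall n, `|f n| <= C) ->
  exists l, forall e, 0 < e -> U [set n | `|f n - l| < e].
Proof.
move=> UU fC.
have cK : compact `[- C, C]%classic by exact: segment_compact.
have FF : ProperFilter (f @ U) by exact: fmap_proper_filter.
have FK : (f @ U) `[- C, C]%classic.
  by rewrite nbhs_simpl /=; apply: (@filterS _ U _ setT); [move=> n _ /=; rewrite in_itv/= -ler_norml|exact: filterT].
have [l [_ cl]] := cK _ FF FK.
exists l => e e0; have [//|UC] := in_ultra_setVsetC [set n | `|f n - l| < e] UU.
have [] := cl (~` [set y | `|y - l| < e]) [set y | `|y - l| < e] UC.
  by apply/nbhs_ballP; exists e => //= y; rewrite /ball/= distrC.
by move=> y [].
Qed.

(** On a fine grid the finitely many means over the small rectangles converge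
    along the ultrafilter, and the Poincare inequality on each of them controls
    the remainder by the mesh size.  The ultrafilter replaces the extraction of
    subsequences, one for each mesh. *)
Lemma ultra_rellich (U : set_system nat) (a c L1 L2 C : R)
    (F : nat -> R * R -> R) (M : nat -> R) (g1 g2 : nat -> nat -> R * R -> R)
    (N : nat -> nat -> R) :
  UltraFilter U -> 0 < L1 -> 0 < L2 ->
  (forall k, measurable_fun (setT : set plane) (F k : plane -> R)) ->
  (forall k x, `|F k x| <= M k) ->
  (forall k, Rintegral pm (rect a L1 c L2) (fun x => F k x ^+ 2) <= C) ->
  (forall k l, measurable_fun (setT : set plane) (g1 k l : plane -> R)) ->
  (forall k l, measurable_fun (setT : set plane) (g2 k l : plane -> R)) ->
  (forall k l x, 0 <= g1 k l x <= N k l) ->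
  (forall k l x, 0 <= g2 k l x <= N k l) ->
  (forall k l, Rintegral pm (rect a L1 c L2) (fun x => g1 k l x ^+ 2) <= C) ->
  (forall k l, Rintegral pm (rect a L1 c L2) (fun x => g2 k l x ^+ 2) <= C) ->
  (forall k l s, increments (fun t => F k (t, s) - F l (t, s)) (fun t => g1 k l (t, s))) ->
  (forall k l t, increments (fun s => F k (t, s) - F l (t, s)) (fun s => g2 k l (t, s))) ->
  forall e, 0 < e -> exists2 A, U A & forall k l, A k -> A l ->
    Rintegral pm (rect a L1 c L2) (fun x => (F k x - F l x) ^+ 2) <= e.
Proof.
move=> UU L10 L20 mF FM FC mg1 mg2 g1N g2N g1C g2C i1 i2 e e0.
have C0 : 0 <= C by apply: le_trans (FC 0); apply: Rintegral_ge0 => x _; exact: sqr_ge0.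
(* the mesh is so fine that the gradient terms are at most [e / 2] *)
have [n n0 nE] : exists2 n : nat, (0 < n)%N & (L1 ^+ 2 + L2 ^+ 2) * C / n%:R ^+ 2 <= e / 2.
  have [n nL] : exists n : nat, (L1 ^+ 2 + L2 ^+ 2) * C / (e / 2) < n%:R.
    by exists (Num.bound ((L1 ^+ 2 + L2 ^+ 2) * C / (e / 2))); apply: archi_boundP;
      rewrite divr_ge0 ?mulr_ge0 ?addr_ge0 ?sqr_ge0// ltW// divr_gt0.
  have n0 : 0 < n%:R :> R.
    by apply: le_lt_trans nL; rewrite divr_ge0 ?mulr_ge0 ?addr_ge0 ?sqr_ge0// ltW// divr_gt0.
  exists n; first by rewrite -(ltr0n R).
  rewrite ler_pdivrMr ?exprn_gt0// -ler_pdivrMl ?divr_gt0// [leLHS]mulrC.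
  apply: le_trans (ltW nL) _; rewrite expr2 ler_peMl//.
  by rewrite ler1n -(ltr0n R).
have nR0 : 0 < n%:R :> R by rewrite ltr0n.
pose h1 := L1 / n%:R; pose h2 := L2 / n%:R.
have h10 : 0 < h1 by rewrite divr_gt0.
have h20 : 0 < h2 by rewrite divr_gt0.
have hh0 : 0 < h1 * h2 by exact: mulr_gt0.
have hL1 : n%:R * h1 = L1 by rewrite /h1 mulrC divfK// gt_eqF.
have hL2 : n%:R * h2 = L2 by rewrite /h2 mulrC divfK// gt_eqF.
pose ell k (i j : 'I_n) := rect_mean (a + i%:R * h1) h1 (c + j%:R * h2) h2 (F k).
have grid f K : measurable_fun (setT : set plane) (f : plane -> R) -> (forall x, `|f x| <= K) ->
    Rintegral pm (rect a L1 c L2) f = \sum_(i < n) \sum_(j < n)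
      Rintegral pm (rect (a + i%:R * h1) h1 (c + j%:R * h2) h2) f.
  by move=> mf fK; rewrite -hL1 -hL2; apply: (Int_grid a c _ (ltW h10) (ltW h20) mf fK).
have msq (f : R * R -> R) : measurable_fun (setT : set plane) (f : plane -> R) ->
    measurable_fun (setT : set plane) ((fun x => f x ^+ 2) : plane -> R).
  by move=> mf; exact: measurable_funX.
have ellC k i j : `|ell k i j| <= Num.sqrt (h1 * h2 * C).
  rewrite -ler_sqr ?nnegrE ?sqrtr_ge0// sqr_sqrtr; last by rewrite mulr_ge0// mulr_ge0// ltW.
  rewrite real_normK ?num_real//.
  apply: le_trans (rect_mean_sqr _ _ h10 h20 (mF k) (FM k)) _.
  rewrite ler_pM2l//;  apply: le_trans (FC k).
  rewrite (grid _ _ (msq _ (mF k)) (sqr_bounded (FM k))).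
  have r0 i' j' : 0 <= Rintegral pm (rect (a + i'%:R * h1) h1 (c + j'%:R * h2) h2) (fun x => F k x ^+ 2).
    by apply: Rintegral_ge0 => x _; exact: sqr_ge0.
  rewrite (bigD1 i)//= (bigD1 j)//= -addrA lerDl addr_ge0// sumr_ge0// => i' _.
  exact: sumr_ge0.
have [lim lP] : exists lim : 'I_n -> 'I_n -> R, forall i j d, 0 < d -> U [set k | `|ell k i j - lim i j| < d].
  have H i j : exists l, forall d, 0 < d -> U [set k | `|ell k i j - l| < d].
    by apply: ultra_bounded_cvg => k; exact: ellC.
  exists (fun i j => projT1 (cid (H i j))) => i j; exact: (projT2 (cid (H i j))).
pose q := e / 2 * (h1 * h2) / n%:R ^+ 2.
have q0 : 0 < q by rewrite /q mulr_gt0// ?invr_gt0 ?exprn_gt0// mulr_gt0// divr_gt0.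
pose d := Num.sqrt q / 2.
have d0 : 0 < d by rewrite divr_gt0// sqrtr_gt0.
pose A := [set k | forall i j, `|ell k i j - lim i j| < d].
have UA : U A.
  have U1 i : U [set k | forall j, `|ell k i j - lim i j| < d].
    by apply: filter_forall => j; exact: lP.
  exact: filter_forall.
exists A => // k l Ak Al.
have mFF : measurable_fun (setT : set plane) ((fun x => F k x - F l x) : plane -> R).
  exact: measurable_funB.
have FFM x : `|F k x - F l x| <= M k + M l + N k l.
  rewrite (le_trans (ler_normB _ _))// -[leLHS]addr0 !lerD ?FM//.
  by have /andP[? ?] := g1N k l x; exact: (le_trans (y := g1 k l x)).
have M0 : 0 <= M k + M l by rewrite addr_ge0// (le_trans _ (FM _ (0, 0))).
have g1M x : `|g1 k l x| <= M k + M l + N k l.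
  have /andP[g0 gN] := g1N k l x;
  by rewrite ger0_norm// (le_trans gN)// lerDr.
have g2M x : `|g2 k l x| <= M k + M l + N k l.
  have /andP[g0 gN] := g2N k l x; by rewrite ger0_norm// (le_trans gN)// lerDr.
rewrite (grid _ _ (msq _ mFF) (sqr_bounded FFM)).
have cell (i j : 'I_n) : Rintegral pm (rect (a + i%:R * h1) h1 (c + j%:R * h2) h2)
      (fun x => (F k x - F l x) ^+ 2) <=
    e / 2 / n%:R ^+ 2 +
    h1 ^+ 2 * Rintegral pm (rect (a + i%:R * h1) h1 (c + j%:R * h2) h2) (fun x => g1 k l x ^+ 2) +
    h2 ^+ 2 * Rintegral pm (rect (a + i%:R * h1) h1 (c + j%:R * h2) h2) (fun x => g2 k l x ^+ 2).
  apply: le_trans (rect_poincare mFF (mg1 k l) (mg2 k l) FFM g1M g2M _ _ (i1 k l) (i2 k l) _ _ h10 h20) _.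
  - by move=> x; have /andP[] := g1N k l x.
  - by move=> x; have /andP[] := g2N k l x.
  rewrite !lerD2r (rect_meanB _ _ h10 h20 (mF k) (FM k) (mF l) (FM l)) -/(ell k i j) -/(ell l i j).
  rewrite mulrC ler_pdivrMr//.
  have -> : e / 2 / n%:R ^+ 2 * (h1 * h2) = q by rewrite /q mulrAC.
  have : `|ell k i j - ell l i j| <= Num.sqrt q.
    have := ler_normB (ell k i j - lim i j) (ell l i j - lim i j).
    have := Ak i j; have := Al i j; rewrite opprB addrA subrK /d.
    move: (ell k i j) (ell l i j) (lim i j) (Num.sqrt q).
    by clear => *; lra.
  rewrite -ler_sqr ?nnegrE ?sqrtr_ge0// sqr_sqrtr; last exact: ltW.
  by rewrite real_normK ?num_real.
apply: (@le_trans _ _ (e / 2 + h1 ^+ 2 * C + h2 ^+ 2 * C)).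
  apply: le_trans (ler_sum _ (fun i _ => ler_sum _ (fun j _ => cell i j))) _.
  under eq_bigr do rewrite !big_split/= -!mulr_sumr.
  rewrite !big_split/= -!mulr_sumr !sumr_const !card_ord.
  rewrite -(grid _ _ (msq _ (mg1 k l)) (sqr_bounded g1M)).
  rewrite -(grid _ _ (msq _ (mg2 k l)) (sqr_bounded g2M)).
  have -> : n%:R ^- 2 *+ n *+ n = 1 :> R.
    by apply: invr_sqr_mulrn2 => //; exact: lt0r_neq0.
  rewrite mulr1.
  by rewrite !lerD// ler_wpM2l ?sqr_ge0.
have -> : h1 ^+ 2 * C = L1 ^+ 2 * C / n%:R ^+ 2 by rewrite /h1 expr_div_n mulrAC.
have -> : h2 ^+ 2 * C = L2 ^+ 2 * C / n%:R ^+ 2 by rewrite /h2 expr_div_n mulrAC.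
move: nE; rewrite mulrDl mulrDl; move: (L1 ^+ 2 * C / _) (L2 ^+ 2 * C / _).
by clear => *; lra.
Qed.

End UltrafilterCompactness.

(** * Real test functions *)

Section TestFunctions.
Context {R : realType}.
Local Notation P := (R * R)%type.
Implicit Types (f g : P -> R) (G : set P).

Definition rtest G f := [/\ smooth f, compact (closure [set x | f x != 0]) &
  forall x, G x -> f x = 0].

Definition pd (j : 'I_2) f (x : P) : R := 'D_(evec j) f x.

Lemma ord2P (j : 'I_2) : j = 0 \/ j = 1.
Proof. by case: j => -[|[|//]] i; [left|right]; exact: val_inj. Qed.

Lemma smooth_derivable f j x : smooth f -> derivable f x (evec j).
Proof. by move=> /(_ 1%N)[]. Qed.

Lemma smooth_continuous f : smooth f -> continuous f.
Proof. by move=> /(_ 0%N). Qed.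

Lemma smooth_pd f j : smooth f -> smooth (pd j f).
Proof. by move=> sf k; have [_ _] := sf k.+1; exact. Qed.

Lemma smooth_mul f g : smooth f -> smooth g -> smooth (fun x => f x * g x).
Proof. by move=> sf sg k; exact: Ck_mul. Qed.

Lemma smooth_add f g : smooth f -> smooth g -> smooth (fun x => f x + g x).
Proof. by move=> sf sg k; exact: Ck_add. Qed.

Lemma smooth_cst (a : R) : smooth (fun _ : P => a).
Proof. by move=> k; exact: Ck_cst. Qed.

Lemma pdM f g j x : smooth f -> smooth g ->
  pd j (fun y => f y * g y) x = f x * pd j g x + g x * pd j f x.
Proof. by move=> sf sg; rewrite /pd deriveM//; exact: smooth_derivable. Qed.

Lemma pdD f g j x : smooth f -> smooth g ->
  pd j (fun y => f y + g y) x = pd j f x + pd j g x.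
Proof. by move=> sf sg; rewrite /pd deriveD//; exact: smooth_derivable. Qed.

Lemma pd_cst (a : R) j x : pd j (fun=> a) x = 0.
Proof. by rewrite /pd derive_cst. Qed.

Lemma pdZ (a : R) f j x : smooth f -> pd j (fun y => a * f y) x = a * pd j f x.
Proof.
by move=> sf; rewrite pdM//; [rewrite pd_cst mulr0 addr0|exact: smooth_cst].
Qed.

Lemma compact_support_sub f g :
  (forall x, f x = 0 -> g x = 0) ->
  compact (closure [set x | f x != 0]) -> compact (closure [set x | g x != 0]).
Proof.
move=> fg cf; apply: (subclosed_compact _ cf); first exact: closed_closure.
by apply: closure_subset => x /=; apply: contra_neq => /fg.
Qed.

Lemma rtest_mul G f g : smooth f -> rtest G g -> rtest G (fun x => f x * g x).
Proof.
move=> sf [sg cg g0]; split; first exact: smooth_mul.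
  by apply: compact_support_sub cg => x ->; rewrite mulr0.
by move=> x /g0 ->; rewrite mulr0.
Qed.

Lemma rtest_scale G (a : R) g : rtest G g -> rtest G (fun x => a * g x).
Proof. exact: rtest_mul (smooth_cst a). Qed.

Lemma compact_supportU (h : P -> R) f g :
  (forall x, f x = 0 -> g x = 0 -> h x = 0) ->
  compact (closure [set x | f x != 0]) -> compact (closure [set x | g x != 0]) ->
  compact (closure [set x | h x != 0]).
Proof.
move=> fgh cf cg; apply: (subclosed_compact _ (compactU cf cg)); first exact: closed_closure.
rewrite -closureU; apply: closure_subset => x /= hx; apply: contrapT.
by move=> /not_orP[/negP/negPn/eqP fx /negP/negPn/eqP gx]; rewrite fgh ?eqxx in hx.
Qed.

Lemma rtest_add G f g : rtest G f -> rtest G g -> rtest G (fun x => f x + g x).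
Proof.
move=> [sf cf f0] [sg cg g0]; split; first exact: smooth_add.
  by apply: compact_supportU cf cg => x -> ->; rewrite addr0.
by move=> x Gx; rewrite f0// g0// addr0.
Qed.

Lemma rtest_sub G f g : rtest G f -> rtest G g -> rtest G (fun x => f x - g x).
Proof.
move=> tf tg; have := rtest_add tf (rtest_scale (-1) tg).
by under eq_fun do rewrite mulN1r.
Qed.

Lemma pdB f g j x : smooth f -> smooth g ->
  pd j (fun y => f y - g y) x = pd j f x - pd j g x.
Proof.
move=> sf sg; have := @pdD f (fun y => -1 * g y) j x sf (smooth_mul (smooth_cst _) sg).
rewrite pdZ// mulN1r => <-; congr pd.
by apply/funext => y; rewrite mulN1r.
Qed.

Lemma pd_out_support f j x : ~ closure [set y | f y != 0] x -> pd j f x = 0.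
Proof.
move=> nx.
have nf : \forall y \near x, f y = 0.
  have : nbhs x (~` closure [set y | f y != 0]).
    by apply: open_nbhs_nbhs; split => //; apply: closed_openC; exact: closed_closure.
  apply: filterS => y ny; apply/eqP/negPn/negP => fy.
  by apply: ny; exact: subset_closure.
rewrite /pd (@near_eq_derive _ _ _ f (fun=> 0)) ?derive_cst//.
Qed.

Lemma bounded_out (K : set P) f : compact K -> continuous f ->
  (forall x, ~ K x -> f x = 0) -> exists M, forall x, `|f x| <= M.
Proof.
move=> cK cf f0.
have /compact_bounded[M [_ HM]] : compact (f @` K).
  by apply: continuous_compact => //; exact: continuous_subspaceT.
exists (`|M| + 1) => x; have [Kx|nKx] := pselect (K x).
  by apply: HM; [rewrite ltr_pwDr// ler_norm|exists x].
by rewrite f0// normr0 addr_ge0.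
Qed.

Lemma rtest_bounded G f : rtest G f ->
  exists M, (forall x, `|f x| <= M) /\ forall j x, `|pd j f x| <= M.
Proof.
move=> [sf cf _].
have [M HM] : exists M, forall x, `|f x| <= M.
  apply: bounded_out cf (smooth_continuous sf) _ => x nx.
  by apply/eqP/negPn/negP => fx; apply: nx; exact: subset_closure.
have H j : exists M, forall x, `|pd j f x| <= M.
  apply: bounded_out cf (smooth_continuous (smooth_pd j sf)) _ => x nx.
  exact: pd_out_support.
have [M0 H0] := H 0; have [M1 H1] := H 1.
exists (Num.max M (Num.max M0 M1)); split=> [x|j x]; rewrite !le_max ?HM//.
case: (ord2P j) => ->.
- by rewrite H0 orbT.
- by rewrite H1 !orbT.
Qed.

(** Compactness of the support puts a test function on a set of finite measure,
    where continuous weights are bounded. *)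
Lemma rtest_in_square G f : rtest G f -> exists2 r : R, 0 < r &
  forall x : P, ~ (`|x.1| <= r /\ `|x.2| <= r) -> f x = 0 /\ forall j, pd j f x = 0.
Proof.
move=> [sf cf _]; have [M [_ HM]] := compact_bounded cf.
exists (`|M| + 1); first by rewrite ltr_wpDl.
move=> x nx.
have nK : ~ closure [set y | f y != 0] x.
  move=> Kx; apply: nx.
  have : `|x| <= `|M| + 1 by apply: HM => //; rewrite ltr_pwDr// ler_norm.
  have -> : `|x| = Num.max `|x.1| `|x.2| by [].
  by rewrite ge_max => /andP[].
split; last by move=> j; exact: pd_out_support.
by apply/eqP/negPn/negP => fx; apply: nK; exact: subset_closure.
Qed.

Lemma rtest_shift (G G' : set P) (a : P) f :
  (forall x, G x -> G' (x + a)) -> rtest G' f -> rtest G (fun x => f (x + a)).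
Proof.
move=> GG' [sf cf f0]; split; first by move=> k; exact: Ck_shift.
  set K := closure _ in cf.
  have cK : compact ((fun y : P => y - a) @` K).
    apply: continuous_compact => //; apply: continuous_subspaceT => x.
    by apply: cvgB; [exact: cvg_id|exact: cvg_cst].
  apply: (subclosed_compact _ cK); first exact: closed_closure.
  have clK : closed ((fun y : P => y - a) @` K).
    by apply: compact_closed => //; exact: norm_hausdorff.
  rewrite [X in _ `<=` X](closure_id _).1//.
  apply: closure_subset => x /= fx; exists (x + a); last by rewrite addrK.
  exact: subset_closure.
by move=> x /GG'/f0.
Qed.

Lemma pd_shift f (a : P) j x : smooth f -> pd j (fun y => f (y + a)) x = pd j f (x + a).
Proof. by move=> sf; rewrite /pd derive_shift2//; exact: smooth_derivable. Qed.

End TestFunctions.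

(** * Weighted energy spaces *)

Lemma Int_null d (T : measurableType d) (R : realType)
    (mu : {measure set T -> \bar R}) (A B : set T) (f : T -> R) :
  measurable A -> measurable B -> B `<=` A -> mu (A `\` B) = 0%E ->
  mu.-integrable A (EFin \o f) -> Rintegral mu A f = Rintegral mu B f.
Proof.
move=> mA mB BA AB0 fi.
have mAB : measurable (A `\` B) by exact: measurableD.
have fAB : mu.-integrable (A `\` B) (EFin \o f) by apply: integrableS fi => //; exact: subDsetl.
rewrite -[in LHS](setDUK BA) Rintegral_setU ?setDUK//.
  by rewrite [X in _ + X](_ : _ = 0) ?addr0// /Rintegral (null_set_integral mAB (measurable_int mu fAB) AB0).
by apply/disj_setPS => x [Bx [_ /(_ Bx)]].
Qed.

Lemma sq_close d (T : measurableType d) (R : realType)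
    (mu : {measure set T -> \bar R}) (D : set T) (f : T -> R) (e : R) :
  measurable D -> sqint mu D f -> 0 < e ->
  exists2 dl, 0 < dl & forall g, sqint mu D g ->
    Rintegral mu D (fun x => (g x - f x) ^+ 2) <= dl ->
    `|Rintegral mu D (fun x => g x ^+ 2) - Rintegral mu D (fun x => f x ^+ 2)| <= e.
Proof.
move=> mD sf e0; set N := Rintegral mu D (fun x => f x ^+ 2).
have N0 : 0 <= N by apply: Rintegral_ge0 => x _; exact: sqr_ge0.
have N1 : 0 < N + 1 by lra.
pose s := e / 2 / (N + 1).
have s0 : 0 < s by rewrite !divr_gt0.
have si0 : 0 < 1 + s^-1 by rewrite ltr_wpDr ?invr_ge0 ?ltW.
exists (e / 2 / (1 + s^-1)); first by rewrite !divr_gt0.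
move=> g sg gd; apply: le_trans (sq_perturb mD s0 sf sg) _.
rewrite -/N [leRHS](splitr e) lerD//.
  by rewrite /s mulrAC ler_pdivrMr// ler_wpM2l ?lerDl// divr_ge0// ltW.
by rewrite mulrC -ler_pdivlMr.
Qed.

Section Energy.
Context {R : realType}.
Local Notation P := (R * R)%type.
Local Notation pm := (@plane_measure R).
Local Notation plane := (@plane R).
Implicit Types (D G : set P) (w u v : P -> R) (p q : 'I_2 -> P -> R).

Definition dens w u p (x : P) : R :=
  (w x) ^+ 2 * (u x ^+ 2 + p 0 x ^+ 2 + p 1 x ^+ 2).

Definition energy D w u p : \bar R := (\int[pm]_(x in D) (dens w u p x)%:E)%E.

Definition mpair D u p :=
  measurable_fun (D : set plane) (u : plane -> R) /\
  forall j, measurable_fun (D : set plane) (p j : plane -> R).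

(** The real counterpart of the weighted completion: approximability within every
    [e] replaces the convergent sequence, which makes sums and products simple
    to treat. *)
Definition rW1 D w G u p := mpair D u p /\
  forall e : R, 0 < e -> exists2 f, rtest G f &
    (energy D w (fun x => (f x - u x)%R) (fun j x => (pd j f x - p j x)%R) <= e%:E)%E.

Lemma dens_ge0 w u p x : 0 <= dens w u p x.
Proof. by rewrite mulr_ge0 ?addr_ge0 ?sqr_ge0. Qed.

Lemma energy_ge0 D w u p : (0 <= energy D w u p)%E.
Proof. by apply: integral_ge0 => x _; rewrite lee_fin dens_ge0. Qed.

Lemma rtest_mpair D G f : rtest G f -> mpair D f (pd^~ f).
Proof.
move=> [sf _ _]; split=> [|j]; apply: continuous_plane_measurable.
  exact: smooth_continuous.
by apply: smooth_continuous; exact: smooth_pd.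
Qed.

Lemma mpairD D u v p q : mpair D u p -> mpair D v q ->
  mpair D (fun x => u x + v x) (fun j x => p j x + q j x).
Proof. by move=> [mu mp] [mv mq]; split=> [|j]; apply: measurable_funD. Qed.

Lemma mpairB D u v p q : mpair D u p -> mpair D v q ->
  mpair D (fun x => u x - v x) (fun j x => p j x - q j x).
Proof. by move=> [mu mp] [mv mq]; split=> [|j]; apply: measurable_funB. Qed.

Lemma mpairZ D (a : R) u p : mpair D u p ->
  mpair D (fun x => a * u x) (fun j x => a * p j x).
Proof. by move=> [mu mp]; split=> [|j]; apply: measurable_funM. Qed.

Lemma mpairM D a u p : smooth a -> mpair D u p ->
  mpair D (fun x => a x * u x) (fun j x => a x * p j x + pd j a x * u x).
Proof.
move=> sa [mu mp].
have ma : measurable_fun (D : set plane) (a : plane -> R).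
  by apply: continuous_plane_measurable; exact: smooth_continuous.
split=> [|j]; first exact: measurable_funM.
apply: measurable_funD; apply: measurable_funM => //.
by apply: continuous_plane_measurable; apply: smooth_continuous; exact: smooth_pd.
Qed.

Lemma measurable_dens D w u p : continuous w -> mpair D u p ->
  measurable_fun (D : set plane) (dens w u p : plane -> R).
Proof.
move=> cw [mu mp]; apply: measurable_funM.
  by apply: measurable_funX; exact: continuous_plane_measurable.
by apply: measurable_funD; [apply: measurable_funD|]; exact: measurable_funX.
Qed.

Section FixedDomain.
Variable D : set P.
Hypothesis mD : measurable (D : set plane).

Lemma energy_le w w' u v p q (C : R) : continuous w -> continuous w' ->
  mpair D u p -> mpair D v q -> 0 <= C ->
  (forall x, D x -> dens w u p x <= C * dens w' v q x) ->
  (energy D w u p <= C%:E * energy D w' v q)%E.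
Proof.
move=> cw cw' mup mvq C0 H.
rewrite /energy -ge0_integralZl_EFin//; last 2 first.
- by move=> x _; rewrite lee_fin dens_ge0.
- by apply/measurable_EFinP; exact: measurable_dens.
apply: ge0_le_integral => //.
- by move=> x _; rewrite lee_fin dens_ge0.
- by apply/measurable_EFinP; exact: measurable_dens.
- by apply: measurable_funeM; apply/measurable_EFinP; exact: measurable_dens.
Qed.

Lemma energyD w u v p q : continuous w -> mpair D u p -> mpair D v q ->
  (energy D w (fun x => (u x + v x)%R) (fun j x => (p j x + q j x)%R) <=
   2%:E * (energy D w u p + energy D w v q))%E.
Proof.
move=> cw mup mvq.
rewrite /energy -ge0_integralD//; last 4 first.
- by move=> x _; rewrite lee_fin dens_ge0.
- by apply/measurable_EFinP; exact: measurable_dens.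
- by move=> x _; rewrite lee_fin dens_ge0.
- by apply/measurable_EFinP; exact: measurable_dens.
rewrite -ge0_integralZl_EFin//; last 2 first.
- by move=> x _; rewrite lee_fin addr_ge0// dens_ge0.
- by apply: emeasurable_funD; apply/measurable_EFinP; exact: measurable_dens.
apply: ge0_le_integral => //.
- by move=> x _; rewrite lee_fin dens_ge0.
- by apply/measurable_EFinP; apply: measurable_dens => //; exact: mpairD.
- by apply: measurable_funeM; apply: emeasurable_funD; apply/measurable_EFinP; exact: measurable_dens.
move=> x _; rewrite -EFinD -EFinM lee_fin /dens -mulrDr mulrCA.
rewrite ler_wpM2l ?sqr_ge0//.
have := sqr_ge0 (u x - v x); have := sqr_ge0 (p 0 x - q 0 x); have := sqr_ge0 (p 1 x - q 1 x).
by nra.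
Qed.

Lemma energyN w u p : energy D w (fun x => (- u x)%R) (fun j x => (- p j x)%R) = energy D w u p.
Proof. by apply: eq_integral => x _; rewrite /dens !sqrrN. Qed.

Lemma energyB w u v p q : continuous w -> mpair D u p -> mpair D v q ->
  (energy D w (fun x => (u x - v x)%R) (fun j x => (p j x - q j x)%R) <=
   2%:E * (energy D w u p + energy D w v q))%E.
Proof.
move=> cw mup mvq; rewrite -[in leRHS](energyN w v q).
apply: energyD => //.
have := mpairZ (-1) mvq.
by under [X in mpair _ X _ -> _]eq_fun do rewrite mulN1r;
   under [X in mpair _ _ X -> _]eq_fun => j do under eq_fun do rewrite mulN1r.
Qed.

(** The gradient of the product contains the gradient of the factor times the
    function itself, so that both the factor and its derivatives have to be
    bounded by the quotient of the two weights. *)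
Lemma energyM w w' a u p (C : R) : continuous w -> continuous w' -> smooth a ->
  mpair D u p -> (forall x, D x -> `|a x * w' x| <= C * w x) ->
  (forall j x, D x -> `|pd j a x * w' x| <= C * w x) ->
  (energy D w' (fun x => (a x * u x)%R) (fun j x => (a x * p j x + pd j a x * u x)%R) <=
   (5 * C ^+ 2)%:E * energy D w u p)%E.
Proof.
move=> cw cw' sa mup aC paC.
apply: energy_le => //; first exact: mpairM.
  by rewrite mulr_ge0// sqr_ge0.
move=> x Dx; rewrite /dens.
have sq (y : R) : `|y| <= C * w x -> y ^+ 2 <= C ^+ 2 * w x ^+ 2.
  move=> yC; rewrite -exprMn -real_normK ?num_real//.
  by rewrite lerXn2r ?nnegrE// (le_trans _ yC).
have A := sq _ (aC x Dx); have B0 := sq _ (paC 0 x Dx); have B1 := sq _ (paC 1 x Dx).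
have K0 := sqr_ge0 C.
move: (a x) (pd 0 a x) (pd 1 a x) (u x) (p 0 x) (p 1 x) (w x) (w' x) (C ^+ 2) K0 A B0 B1.
clear => a b0 b1 u p0 p1 w w' K K0 A B0 B1.
have U := sqr_ge0 u; have P0 := sqr_ge0 p0; have P1 := sqr_ge0 p1.
have A' := ler_wpM2r U A; have A0 := ler_wpM2r P0 A; have A1 := ler_wpM2r P1 A.
have B0' := ler_wpM2r U B0; have B1' := ler_wpM2r U B1.
have K2 := sqr_ge0 (w' * (a * p0 - b0 * u)).
have K1 := sqr_ge0 (w' * (a * p1 - b1 * u)).
have W0 : 0 <= K * w ^+ 2 * p0 ^+ 2 by rewrite (mulr_ge0 _ P0)// mulr_ge0// sqr_ge0.
have W1 : 0 <= K * w ^+ 2 * p1 ^+ 2 by rewrite (mulr_ge0 _ P1)// mulr_ge0// sqr_ge0.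
lra.
Qed.

Lemma rW1_mul w w' G a u p (C : R) : continuous w -> continuous w' -> smooth a ->
  (forall x, D x -> `|a x * w' x| <= C * w x) ->
  (forall j x, D x -> `|pd j a x * w' x| <= C * w x) ->
  rW1 D w G u p ->
  rW1 D w' G (fun x => a x * u x) (fun j x => a x * p j x + pd j a x * u x).
Proof.
move=> cw cw' sa aC paC [mup H]; split; first exact: mpairM.
move=> e e0; have K0 : 0 < 5 * C ^+ 2 + 1 by have := sqr_ge0 C; lra.
have [f tf fe] := H (e / (5 * C ^+ 2 + 1)) (divr_gt0 e0 K0).
exists (fun x => a x * f x); first exact: rtest_mul.
have mf := rtest_mpair D tf; have sf : smooth f by case: tf.
apply: (@le_trans _ _ ((5 * C ^+ 2)%:E * energy D w
    (fun x => (f x - u x)%R) (fun j x => (pd j f x - p j x)%R))%E).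
  apply: le_trans (energyM cw cw' sa (mpairB mf mup) aC paC).
  rewrite le_eqVlt; apply/orP; left; apply/eqP; apply: eq_integral => x _.
  by rewrite /dens !pdM//; congr (_ * _)%:E; ring.
apply: le_trans (lee_wpmul2l _ fe) _.
  by rewrite lee_fin mulr_ge0// sqr_ge0.
rewrite -EFinM lee_fin mulrCA ler_piMr ?ltW// ltr_pdivrMr// mul1r; lra.
Qed.

Lemma energy_rtest_lty w G f : continuous w -> rtest G f ->
  (energy D w f (pd^~ f) < +oo)%E.
Proof.
move=> cw tf; have [r r0 out] := rtest_in_square tf; have mf := rtest_mpair setT tf.
pose S : set P := `[- r, r]%classic `*` `[- r, r]%classic.
have mS : measurable (S : set plane) by apply: measurableX; exact: measurable_itv.
have lI : @lebesgue_measure R `[- r, r] = (r - - r)%R%:E.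
  by rewrite lebesgue_measure_itv/= lte_fin ifT//; lra.
have muS : pm S = ((r - - r) * (r - - r))%R%:E.
  by rewrite plane_measureX ?lI//; exact: measurable_itv.
have md := measurable_dens cw mf.
have [M HM] : exists M, forall x, S x -> dens w f (pd^~ f) x <= M.
  have cS : compact S by apply: compact_setX; exact: segment_compact.
  have cd : continuous (dens w f (pd^~ f)).
    have [sf _ _] := tf.
    have c2 (h : P -> R) : continuous h -> continuous (fun x => h x ^+ 2).
      by move=> ch x; apply: cvgM; exact: ch.
    move=> x; apply: cvgM; first exact: c2.
    by apply: cvgD; [apply: cvgD|]; apply: c2; [exact: smooth_continuous|by apply: smooth_continuous; exact: smooth_pd..].
  have /compact_bounded[M [_ HM]] : compact (dens w f (pd^~ f) @` S).
    by apply: continuous_compact => //; exact: continuous_subspaceT.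
  exists (`|M| + 1) => x Sx; apply: le_trans (ler_norm _) _.
  by apply: HM; [rewrite ltr_pwDr// ler_norm|exists x].
have M0 : 0 <= M.
  apply: le_trans (HM (0, 0) _); first exact: dens_ge0.
  by split; rewrite /= in_itv/= oppr_le0 !ltW.
apply: (@le_lt_trans _ _ (\int[pm]_(x in S) M%:E)%E); last first.
  by rewrite integral_cst//= muS -EFinM ltry.
apply: (@le_trans _ _ (\int[pm]_(x in D `&` S) (dens w f (pd^~ f) x)%:E)%E).
  rewrite integral_mkcondr /energy le_eqVlt; apply/orP; left; apply/eqP.
  apply: eq_integral => x _; rewrite patchE; case: ifPn => // /negP nS.
  have [|f0 p0] := out x; last by rewrite /dens f0 !p0 !expr0n/= !addr0 mulr0.
  move=> [x1 x2]; apply: nS; rewrite inE; split; rewrite /= in_itv/=.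
    by rewrite -ler_norml.
  by rewrite -ler_norml.
have mDS : measurable (D `&` S : set plane) by exact: measurableI.
apply: (@le_trans _ _ (\int[pm]_(x in D `&` S) M%:E)%E).
  apply: ge0_le_integral => //.
  - by move=> x _; rewrite lee_fin dens_ge0.
  - by apply/measurable_EFinP; exact: measurable_funTS.
  - by move=> x [_ Sx]; rewrite lee_fin HM.
by apply: ge0_subset_integral.
Qed.

Lemma energy_rW1_lty w G u p : continuous w -> rW1 D w G u p ->
  (energy D w u p < +oo)%E.
Proof.
move=> cw [mup /(_ 1 ltr01)[f tf fe]].
have mf := rtest_mpair D tf.
have := energyB cw mf (mpairB mf mup).
have -> : energy D w (fun x => (f x - (f x - u x))%R)
    (fun j x => (pd j f x - (pd j f x - p j x))%R) = energy D w u p.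
  by apply: eq_integral => x _; rewrite /dens !subKr.
move=> /le_lt_trans; apply.
rewrite lte_mul_pinfty ?lee_fin//.
rewrite lte_add_pinfty//; first exact: energy_rtest_lty tf.
by rewrite (le_lt_trans fe)// ltry.
Qed.


End FixedDomain.
End Energy.

(** * The energy space without weight *)

Section RealW1.
Context {R : realType}.
Local Notation P := (R * R)%type.
Local Notation pm := (@plane_measure R).
Local Notation plane := (@plane R).
Implicit Types (D G : set P) (w u v : P -> R) (p q : 'I_2 -> P -> R).

Lemma rW1_addZ D w G u v p q (t : R) : measurable (D : set plane) -> continuous w ->
  rW1 D w G u p -> rW1 D w G v q ->
  rW1 D w G (fun x => u x + t * v x) (fun j x => p j x + t * q j x).
Proof.
move=> mD cw [mup Hu] [mvq Hv]; split; first by apply: mpairD => //; exact: mpairZ.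
move=> e e0; have t0 := sqr_ge0 t.
have K0 : 0 < 2 * (1 + t ^+ 2) by lra.
have [f tf fe] := Hu (e / (2 * (1 + t ^+ 2))) (divr_gt0 e0 K0).
have [g tg ge] := Hv (e / (2 * (1 + t ^+ 2))) (divr_gt0 e0 K0).
exists (fun x => f x + t * g x); first by apply: rtest_add => //; exact: rtest_scale.
have mf := rtest_mpair D tf; have mg := rtest_mpair D tg.
have sf : smooth f by case: tf. have sg : smooth g by case: tg.
have stg : smooth (fun x => t * g x) by apply: smooth_mul => //; exact: smooth_cst.
apply: le_trans (_ : (energy D w
   (fun x => (f x - u x) + t * (g x - v x))%R
   (fun j x => (pd j f x - p j x) + t * (pd j g x - q j x))%R <= _)%E).
  rewrite le_eqVlt; apply/orP; left; apply/eqP; apply: eq_integral => x _.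
  rewrite /dens !pdD// !pdZ//.
  have E (a b c d : R) : a + t * b - (c + t * d) = (a - c) + t * (b - d) by ring.
  by rewrite !E.
apply: le_trans (energyD mD cw (mpairB mf mup) (mpairZ t (mpairB mg mvq))) _.
have H : (energy D w (fun x => (t * (g x - v x))%R) (fun j x => (t * (pd j g x - q j x))%R)
    <= (t ^+ 2)%:E * energy D w (fun x => (g x - v x)%R) (fun j x => (pd j g x - q j x)%R))%E.
  apply: energy_le => //; [exact: mpairZ (mpairB mg mvq)|exact: mpairB|].
  by move=> x _; rewrite /dens !exprMn; lra.
apply: (@le_trans _ _ (2%:E * ((e / (2 * (1 + t ^+ 2)))%:E +
   (t ^+ 2)%:E * (e / (2 * (1 + t ^+ 2)))%:E))%E).
  apply: lee_wpmul2l => //; apply: leeD => //.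
  by apply: le_trans H _; apply: lee_wpmul2l.
rewrite -(EFinM (t ^+ 2)) -EFinD -EFinM lee_fin.
have -> : 2 * (e / (2 * (1 + t ^+ 2)) + t ^+ 2 * (e / (2 * (1 + t ^+ 2)))) =
   e * ((2 * (1 + t ^+ 2)) / (2 * (1 + t ^+ 2))) by ring.
by rewrite divff ?mulr1// gt_eqF.
Qed.

Definition one_weight : P -> R := fun=> 1.

Lemma one_weight_continuous : continuous one_weight.
Proof. exact: cst_continuous. Qed.

Lemma dens1 u p x : dens one_weight u p x = u x ^+ 2 + p 0 x ^+ 2 + p 1 x ^+ 2.
Proof. by rewrite /dens /one_weight expr1n mul1r. Qed.

Notation sq D f := (Rintegral pm D (fun x => f x ^+ 2)).

Lemma energy1E D u p : measurable (D : set plane) ->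
  sqint pm D u -> (forall j, sqint pm D (p j)) ->
  energy D one_weight u p = (sq D u + sq D (p 0) + sq D (p 1))%:E.
Proof.
move=> mD [_ iu] sp; have [_ i0] := sp 0; have [_ i1] := sp 1.
rewrite /energy -!RintegralD//; last first.
  by have := intgD mD iu i0.
rewrite -Int_ereal//; last by apply: (intgD mD _ i1); exact: intgD.
by apply: eq_integral => x _; rewrite dens1.
Qed.

Lemma energy1_sqint D u p : measurable (D : set plane) -> mpair D u p ->
  (energy D one_weight u p < +oo)%E -> sqint pm D u /\ forall j, sqint pm D (p j).
Proof.
move=> mD mup elt; have [mu mp] := mup.
have id : pm.-integrable D (EFin \o dens one_weight u p).
  apply: intg_ereal_lt => //; first exact: (measurable_dens one_weight_continuous mup).
  by move=> x _; exact: dens_ge0.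
have H (f : P -> R) : measurable_fun (D : set plane) (f : plane -> R) ->
    (forall x, f x ^+ 2 <= dens one_weight u p x) -> sqint pm D f.
  move=> mf fd; split=> //; apply: (intg_le mD _ id); first exact: measurable_funX.
  by move=> x _; rewrite ger0_norm ?sqr_ge0.
split=> [|j]; apply: H => // x; rewrite dens1.
  by rewrite -addrA lerDl addr_ge0 ?sqr_ge0.
case: (ord2P j) => ->.
- by rewrite addrAC lerDr addr_ge0 ?sqr_ge0.
- by rewrite lerDr addr_ge0 ?sqr_ge0.
Qed.

Lemma rW1_sqint D G u p : measurable (D : set plane) ->
  rW1 D one_weight G u p -> sqint pm D u /\ forall j, sqint pm D (p j).
Proof.
move=> mD H; apply: energy1_sqint => //; first by case: H.
exact: (energy_rW1_lty mD one_weight_continuous H).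
Qed.

Lemma rtest_rW1 D G f : rtest G f -> rW1 D one_weight G f (pd^~ f).
Proof.
move=> tf; split; first exact: rtest_mpair tf.
move=> e e0; exists f => //; apply: le_trans (_ : 0%E <= _)%E; last by rewrite lee_fin ltW.
rewrite /energy integral0_eq// => x _.
by rewrite dens1 !subrr expr0n/= !addr0.
Qed.

(** Both sides are continuous in the energy norm; [e / (L + 2)] shares the error
    among the three squared norms. *)
Lemma rW1_ineq D D' G (L : R) u p :
  measurable (D : set plane) -> measurable (D' : set plane) -> D' `<=` D -> 0 <= L ->
  (forall f, rtest G f -> L * sq D' f <= sq D (pd 0 f) + sq D (pd 1 f)) ->
  rW1 D one_weight G u p -> L * sq D' u <= sq D (p 0) + sq D (p 1).
Proof.
move=> mD mD' D'D L0 HL H; have [su sp] := rW1_sqint mD H; have [mup app] := H.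
have sS f : sqint pm D f -> sqint pm D' f.
  by move=> [mf fi]; split; [exact: measurable_funS mf|exact: integrableS fi].
have su' := sS _ su.
apply/ler_addgt0Pr => e e0.
have K0 : 0 < L + 2 by lra.
pose e' := e / (L + 2); have e'0 : 0 < e' by rewrite divr_gt0.
have [d0 d00 H0] := sq_close mD' su' e'0.
have [d1 d10 H1] := sq_close mD (sp 0) e'0.
have [d2 d20 H2] := sq_close mD (sp 1) e'0.
pose d := Num.min d0 (Num.min d1 d2).
have d_gt0 : 0 < d by rewrite !lt_min d00 d10.
have [f tf] := app d d_gt0.
have [sf spf] := rW1_sqint mD (rtest_rW1 D tf).
have sfu := sqintB mD sf su.
have sfp j := sqintB mD (spf j) (sp j).
rewrite energy1E// lee_fin => fd.
have q0 h A : 0 <= sq A h by apply: Rintegral_ge0 => x _; exact: sqr_ge0.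
have fd0 : sq D (fun x => f x - u x) <= d.
  by apply: le_trans fd; rewrite -addrA lerDl addr_ge0.
have fd1 : sq D (fun x => pd 0 f x - p 0 x) <= d.
  by apply: le_trans fd; rewrite addrAC lerDr addr_ge0.
have fd2 : sq D (fun x => pd 1 f x - p 1 x) <= d by apply: le_trans fd; rewrite lerDr addr_ge0.
have fd0' : sq D' (fun x => f x - u x) <= d0.
  apply: (@le_trans _ _ d); last by rewrite ge_min lexx.
  apply: le_trans fd0; apply: Int_subset => //; first exact: sfu.2.
  by move=> x _; exact: sqr_ge0.
have X0 := H0 _ (sS _ sf) fd0'.
have X1 := H1 _ (spf 0) (le_trans fd1 (ltac:(by rewrite /d !ge_min lexx orbT) : d <= d1)).
have X2 := H2 _ (spf 1) (le_trans fd2 (ltac:(by rewrite /d !ge_min lexx !orbT) : d <= d2)).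
have := HL f tf.
have eE : e = L * e' + e' + e' by rewrite /e'; field; rewrite gt_eqF.
move: X0 X1 X2; rewrite !ler_norml => /andP[X0 _] /andP[_ X1] /andP[_ X2].
have X0' := ler_wpM2l L0 X0.
move: X0' X1 X2; rewrite eE.
move: (sq D' f) (sq D' u) (sq D (pd 0 f)) (sq D (pd 1 f)) (sq D (p 0)) (sq D (p 1)).
by clear => *; lra.
Qed.

End RealW1.

(** * Attainment of the infimum of the Rayleigh quotient *)

(** The parallelogram identity: if two normalized functions are nearly minimizing
    and close to each other, their sum has nearly the least possible energy, so
    that their difference has little energy. *)
Lemma parallelogram_arith (R : realFieldType) (mu e X Y Z g0 g1 h0 h1 : R) : 0 <= mu -> 0 <= e ->
  mu * (1 + 2 * 1 * X + 1 ^+ 2 * 1) <=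
    (g0 + 2 * 1 * Y + 1 ^+ 2 * h0) + (g1 + 2 * 1 * Z + 1 ^+ 2 * h1) ->
  1 + 2 * (-1) * X + (-1) ^+ 2 * 1 <= e -> g0 + g1 <= mu + e -> h0 + h1 <= mu + e ->
  (g0 + 2 * (-1) * Y + (-1) ^+ 2 * h0) + (g1 + 2 * (-1) * Z + (-1) ^+ 2 * h1) <=
  (5 + mu) * e.
Proof.
move=> mu0 e0 low d1 gl gk; have d1' := ler_wpM2l mu0 d1.
lra.
Qed.

Lemma limit_arith (R : realFieldType) (mu e d p0 p1 q0 q1 : R) :
  p0 + p1 <= mu + e -> e <= d / 3 -> `|p0 - q0| <= d / 3 -> `|p1 - q1| <= d / 3 ->
  q0 + q1 <= mu + d.
Proof. by rewrite !ler_norml => ? ? /andP[? _] /andP[? _]; lra. Qed.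

(** The expansion of the quotient along [U + t V], as a polynomial in [t]. *)
Lemma variation_arith (R : realFieldType) (mu t X Y Z p0 p1 q0 q1 s : R) :
  mu * (1 + 2 * t * Z + t ^+ 2 * s) <=
    (p0 + 2 * t * X + t ^+ 2 * q0) + (p1 + 2 * t * Y + t ^+ 2 * q1) ->
  p0 + p1 <= mu ->
  0 <= 2 * t * ((X + Y) - mu * Z) + t ^+ 2 * ((q0 + q1) - mu * s).
Proof. lra. Qed.

Lemma energy_arith (R : realFieldType) (k e a b c : R) :
  24 * k <= e -> a <= 8 * k -> b <= 8 * k -> c <= 8 * k -> a + b + c <= e.
Proof. lra. Qed.

Lemma eighth_le_quarter (R : realFieldType) (k : nat) : 8^-1 ^+ k <= 4^-1 ^+ k :> R.
Proof. by rewrite lerXn2r// ?nnegrE; lra. Qed.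

Section Minimizer.
Context {R : realType}.
Local Notation P := (R * R)%type.
Local Notation pm := (@plane_measure R).
Local Notation plane := (@plane R).
Variables (D G : set P).
Hypothesis mD : measurable (D : set plane).

Notation Int f := (Rintegral pm D f).
Notation sq f := (Rintegral pm D (fun x => f x ^+ 2)).
Notation grad2 p := (sq (p 0) + sq (p 1)).

Hypothesis rellich : forall (F : set_system nat) (f : nat -> P -> R) (C : R),
  UltraFilter F -> (forall k, rtest G (f k)) -> (forall k, sq (f k) <= C) ->
  (forall j k, sq (pd j (f k)) <= C) ->
  forall e, 0 < e -> exists2 A, F A & forall k l, A k -> A l ->
    sq (fun x => f k x - f l x) <= e.

Lemma sq_ge0 (f : P -> R) : 0 <= sq f.
Proof. by apply: Rintegral_ge0 => x _; exact: sqr_ge0. Qed.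

Lemma sqZ (f : P -> R) a : sqint pm D f -> sq (fun x => a * f x) = a ^+ 2 * sq f.
Proof.
move=> [_ fi]; rewrite -RintegralZl//; apply: eq_Rintegral => x _.
by rewrite exprMn.
Qed.

Lemma sq_addZ (f g : P -> R) a : sqint pm D f -> sqint pm D g ->
  sq (fun x => f x + a * g x) = sq f + 2 * a * Int (fun x => f x * g x) + a ^+ 2 * sq g.
Proof.
move=> sf sg; have [_ fi] := sf; have [_ gi] := sg; have fg := sqint_mul mD sf sg.
rewrite -RintegralZl// -RintegralZl// -RintegralD//; last exact: intgZ.
rewrite -RintegralD//; first last.
- exact: intgZ.
- by apply: intgD => //; exact: intgZ.
by apply: eq_Rintegral => x _; ring.
Qed.

Lemma rtest_sqint f : rtest G f -> sqint pm D f /\ forall j, sqint pm D (pd j f).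
Proof. by move=> /(rtest_rW1 D)/(rW1_sqint mD). Qed.

Lemma small_power (c d : R) : 0 < d -> exists k : nat, c * 4^-1 ^+ k <= d.
Proof.
move=> d0; have [c0|c0] := leP c 0.
  by exists 0%N; rewrite expr0 mulr1 (le_trans c0)// ltW.
exists (Num.bound (c / d)); set k := Num.bound _.
have : c / d < k%:R by apply: archi_boundP; rewrite divr_ge0 ?ltW.
rewrite ltr_pdivrMr// => ck.
rewrite exprVn ler_pdivrMr ?exprn_gt0// mulrC.
apply: le_trans (ltW ck) _; rewrite ler_pM2r//.
by rewrite -natrX ler_nat ltnW// ltn_expl.
Qed.

Section Quotient.
Variables (mu : R) (f : nat -> P -> R).
Hypothesis mu0 : 0 <= mu.
Hypothesis mu_le : forall g, rtest G g -> mu * sq g <= grad2 (pd^~ g).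
Hypothesis tf : forall k, rtest G (f k).
Hypothesis f1 : forall k, sq (f k) = 1.
Hypothesis fmu : forall k, grad2 (pd^~ (f k)) <= mu + k.+1%:R^-1.

Let e (k : nat) : R := 8^-1 ^+ k / (mu + 5).

Let mu5 : 0 < mu + 5. Proof. by rewrite ltr_wpDl. Qed.

Let e0 k : 0 < e k. Proof. by rewrite divr_gt0// exprn_gt0// invr_gt0. Qed.

(** Along an ultrafilter the minimizing sequence is Cauchy in L^2 by compactness;
    the parallelogram identity upgrades this to the gradients.  The speed [e] is
    the one that [riesz_fischer] asks for, divided by the constant of
    [parallelogram_arith]. *)
Lemma fast_minimizing_sequence : exists s : nat -> nat,
  (forall k, grad2 (pd^~ (f (s k))) <= mu + e k) /\
  (forall k l, (k <= l)%N ->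
     sq (fun x => f (s l) x - f (s k) x) <= 8^-1 ^+ k /\
     forall j, sq (pd j (fun x => f (s l) x - f (s k) x)) <= 8^-1 ^+ k).
Proof.
have [F [UF subF]] := @ultraFilterLemma nat (\oo)%classic eventually_filter.
have fC k : grad2 (pd^~ (f k)) <= mu + 1.
  by apply: le_trans (fmu k) _; rewrite lerD2l invf_le1 ?ler1n ?ltr0n.
have pC j k : sq (pd j (f k)) <= mu + 1.
  apply: le_trans (fC k); case: (ord2P j) => ->.
  - by rewrite lerDl sq_ge0.
  - by rewrite lerDr sq_ge0.
have fC1 k : sq (f k) <= mu + 1 by rewrite f1 lerDr.
have H k : exists A, F A /\ forall m n, A m -> A n ->
    sq (fun x => f m x - f n x) <= e k /\ grad2 (pd^~ (f m)) <= mu + e k.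
  have [A FA HA] := rellich UF tf fC1 pC (e0 k).
  have FB : F [set m | m.+1%:R^-1 <= e k].
    apply: (subF [set m | m.+1%:R^-1 <= e k]); exists (Num.bound (e k)^-1) => // m /= bm.
    have eb : (e k)^-1 < (Num.bound (e k)^-1)%:R.
      by apply: archi_boundP; rewrite invr_ge0 ltW.
    rewrite -[e k]invrK lef_pV2 ?posrE ?invr_gt0 ?ltr0n//.
    by apply: le_trans (ltW eb) _; rewrite ler_nat (leq_trans bm).
  exists (A `&` [set m | m.+1%:R^-1 <= e k]).
  split; first exact: filterI.
  move=> m n [Am em] [An _]; split; first exact: HA.
  by apply: le_trans (fmu m) _; rewrite lerD2l.
pose A k := projT1 (cid (H k)).
have AP k : F (A k) /\ _ := projT2 (cid (H k)).
have FI k : F [set m | forall i : 'I_k.+1, A i m].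
  by apply: filter_forall => i; case: (AP i).
have Hs k : exists m, forall i : 'I_k.+1, A i m.
  by have [m] := filter_ex (FI k); exists m.
pose s k := projT1 (cid (Hs k)).
have sA k l : (k <= l)%N -> A k (s l).
  move=> kl; have kl1 : (k < l.+1)%N by [].
  exact: (projT2 (cid (Hs l)) (Ordinal kl1)).
exists s; split.
  by move=> k; have [_ /(_ (s k) (s k) (sA k k (leqnn k)) (sA k k (leqnn k)))[]] := AP k.
move=> k l kl.
have [_ HA] := AP k.
have [d1 gl] := HA _ _ (sA _ _ kl) (sA _ _ (leqnn k)).
have [_ gk] := HA _ _ (sA _ _ (leqnn k)) (sA _ _ kl).
have le8 : (5 + mu) * e k <= 8^-1 ^+ k.
  by rewrite /e mulrC (addrC 5) divfK// gt_eqF.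
have mue : 0 <= mu * e k by rewrite mulr_ge0// ltW.
have ek := ltW (e0 k).
split; first (apply: le_trans d1 _; apply: le_trans le8; by rewrite ler_peMl// (@le_trans _ _ 5)// ?ler1n ?lerDl).
set g := f (s l); set h := f (s k).
have tg : rtest G g by exact: tf. have th : rtest G h by exact: tf.
have [sg spg] := rtest_sqint tg; have [sh sph] := rtest_sqint th.
have smg : smooth g by case: tg. have smh : smooth h by case: th.
have tgh := rtest_add tg th.
have g1 : sq g = 1 by exact: f1. have h1 : sq h = 1 by exact: f1.
have pB j : sq (pd j (fun x => g x - h x)) = sq (pd j g) +
    2 * (-1) * Int (fun x => pd j g x * pd j h x) + (-1) ^+ 2 * sq (pd j h).
  by rewrite -sq_addZ//; apply: eq_Rintegral => x _; rewrite pdB// mulN1r.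
have pA j : sq (pd j (fun x => g x + h x)) = sq (pd j g) +
    2 * 1 * Int (fun x => pd j g x * pd j h x) + 1 ^+ 2 * sq (pd j h).
  by rewrite -sq_addZ//; apply: eq_Rintegral => x _; rewrite pdD// mul1r.
have E0 : sq (fun x => g x - h x) = 1 + 2 * (-1) * Int (fun x => g x * h x) + (-1) ^+ 2 * 1.
  by have := sq_addZ (-1) sg sh; rewrite g1 h1 => <-; apply: eq_Rintegral => x _; rewrite mulN1r.
have E1 : sq (fun x => g x + h x) = 1 + 2 * 1 * Int (fun x => g x * h x) + 1 ^+ 2 * 1.
  by have := sq_addZ 1 sg sh; rewrite g1 h1 => <-; apply: eq_Rintegral => x _; rewrite mul1r.
have low := mu_le tgh.
have sum : sq (pd 0 (fun x => g x - h x)) + sq (pd 1 (fun x => g x - h x)) <= (5 + mu) * e k.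
  rewrite (pB 0) (pB 1); rewrite E1 (pA 0) (pA 1) in low; rewrite E0 in d1.
  exact: (parallelogram_arith mu0 ek low d1 gl gk).
move=> j; apply: le_trans le8; apply: le_trans sum.
case: (ord2P j) => ->.
- by rewrite lerDl sq_ge0.
- by rewrite lerDr sq_ge0.
Qed.

Lemma fast_cauchy_limit (h : nat -> P -> R) :
  (forall k, sqint pm D (h k)) ->
  (forall k, sq (fun x => h k.+1 x - h k x) <= 8^-1 ^+ k) ->
  exists U, sqint pm D U /\ forall k, sq (fun x => h k x - U x) <= 8 * 4^-1 ^+ k.
Proof.
move=> sh dh; have mh k : measurable_fun (D : set plane) (h k : plane -> R) by case: (sh k).
have dh' k : (\int[pm]_(x in D) ((h k.+1 x - h k x) ^+ 2)%:E <= (8^-1 ^+ k)%:E)%E.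
  rewrite Int_ereal ?lee_fin//.
  by have [] := sqintB mD (sh k.+1) (sh k).
have [U [mU HU]] := riesz_fischer mD mh dh'.
have sUh k : sqint pm D (fun x => U x - h k x).
  apply: sqint_ereal => //; first exact: measurable_funB.
  by rewrite (le_lt_trans (HU k))// ltry.
have sU : sqint pm D U.
  by apply: (sqint_le mD mU (sqintD mD (sUh 0%N) (sh 0%N))) => x _; rewrite subrK.
exists U; split=> // k.
have -> : sq (fun x => h k x - U x) = sq (fun x => U x - h k x).
  by apply: eq_Rintegral => x _; rewrite -sqrrN opprB.
by rewrite -lee_fin -(Int_ereal mD (sUh k).2).
Qed.

(** The sequence and its two partial derivatives converge separately in L^2; the
    pair of limits belongs to the completion by construction. *)
Lemma minimizer_exists : exists U dU,
  [/\ rW1 D one_weight G U dU, sq U = 1 & grad2 dU <= mu].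
Proof.
have [s [smu sC]] := fast_minimizing_sequence.
pose h k := f (s k).
have th k : rtest G (h k) by exact: tf.
have sh k : sqint pm D (h k) by case: (rtest_sqint (th k)).
have sph j k : sqint pm D (pd j (h k)) by case: (rtest_sqint (th k)).
have smh k : smooth (h k) by case: (th k).
have [U [sU HU]] : exists U, sqint pm D U /\ forall k, sq (fun x => h k x - U x) <= 8 * 4^-1 ^+ k.
  by apply: fast_cauchy_limit => // k; case: (sC k k.+1 (leqnSn k)).
have HP j : exists q, sqint pm D q /\ forall k, sq (fun x => pd j (h k) x - q x) <= 8 * 4^-1 ^+ k.
  apply: (@fast_cauchy_limit (fun k => pd j (h k))) => k; first exact: sph.
  have [_ Hk] := sC k k.+1 (leqnSn k).
  apply: le_trans (Hk j); rewrite le_eqVlt; apply/orP; left; apply/eqP.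
  by apply: eq_Rintegral => x _; rewrite (pdB j x (smh k.+1) (smh k)).
pose dU j := projT1 (cid (HP j)).
have dUP j : sqint pm D (dU j) /\ forall k, sq (fun x => pd j (h k) x - dU j x) <= 8 * 4^-1 ^+ k.
  exact: (projT2 (cid (HP j))).
exists U, dU.
have lim (g : nat -> P -> R) (V : P -> R) : (forall k, sqint pm D (g k)) -> sqint pm D V ->
    (forall k, sq (fun x => g k x - V x) <= 8 * 4^-1 ^+ k) ->
    forall d, 0 < d -> exists k0, forall k, (k0 <= k)%N -> `|sq (g k) - sq V| <= d.
  move=> sg sV gV d d0; have [dl dl0 Hdl] := sq_close mD sV d0.
  have [k0 k0P] := small_power 8 dl0; exists k0 => k kk0; apply: Hdl => //.
  apply: le_trans (gV k) _; apply: le_trans k0P; rewrite ler_pM2l//.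
  by rewrite ler_wiXn2l// ?invr_ge0// invf_le1// ler1n.
split.
- split; first by split=> [|j]; [case: sU|case: (dUP j) => -[]].
  move=> d d0; have [k kP] := small_power 24 d0; exists (h k) => //.
  rewrite energy1E//; last 2 first.
    exact: sqintB.
    by move=> j; apply: sqintB => //; case: (dUP j).
  rewrite lee_fin; exact: (energy_arith kP (HU k) ((dUP 0).2 k) ((dUP 1).2 k)).
- apply/eqP; rewrite -subr_eq0 -normr_le0; apply/ler_addgt0Pr => d d0; rewrite add0r.
  have [k0 /(_ k0 (leqnn _))] := lim h U sh sU HU d d0.
  by rewrite /h f1 distrC.
- apply/ler_addgt0Pr => d d0; have d30 : 0 < d / 3 by rewrite divr_gt0.
  have [k0 H0] := lim _ _ (sph 0) (dUP 0).1 (dUP 0).2 _ d30.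
  have [k1 H1] := lim _ _ (sph 1) (dUP 1).1 (dUP 1).2 _ d30.
  have [k2 H2] := small_power 1 d30.
  pose k := maxn k0 (maxn k1 k2).
  have {}H0 := H0 k (leq_maxl _ _).
  have {}H1 := H1 k (leq_trans (leq_maxl k1 k2) (leq_maxr _ _)).
  have ek : e k <= d / 3.
    apply: le_trans H2; rewrite mul1r.
    apply: (@le_trans _ _ (4^-1 ^+ k)); last first.
      rewrite ler_wiXn2l// ?invr_ge0// ?invf_le1// ?ler1n//.
      by rewrite /k !leq_max leqnn !orbT.
    rewrite /e ler_pdivrMr//.
    apply: (@le_trans _ _ (4^-1 ^+ k)); first exact: eighth_le_quarter.
    by rewrite ler_peMr ?exprn_ge0 ?invr_ge0// (@le_trans _ _ 5)// ?ler1n ?lerDr.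
  have Hk := smu k; rewrite -/(h k) in Hk.
  exact: (limit_arith Hk ek H0 H1).
Qed.

(** A polynomial [2 b t + c t^2] that is nonnegative for all [t] has [b = 0]: this
    is the first variation of the Rayleigh quotient at its minimum. *)
Lemma minimizer_euler_lagrange U dU : rW1 D one_weight G U dU -> sq U = 1 ->
  grad2 dU <= mu -> forall V dV, rW1 D one_weight G V dV ->
  Int (fun x => dU 0 x * dV 0 x) + Int (fun x => dU 1 x * dV 1 x) =
  mu * Int (fun x => U x * V x).
Proof.
move=> HU U1 gU V dV HV.
have [sU sdU] := rW1_sqint mD HU; have [sV sdV] := rW1_sqint mD HV.
set B := Int _ + Int _; set B' := Int _.
have Q t : 0 <= 2 * t * (B - mu * B') + t ^+ 2 * (grad2 dV - mu * sq V).
  have := rW1_ineq mD mD (@subset_refl _ D) mu0 mu_le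
    (rW1_addZ t mD one_weight_continuous HU HV).
  by rewrite !sq_addZ// U1 -/B' => H; exact: (variation_arith H gU).
move: Q; set b := B - _; set c := _ - _ * sq V => Q.
apply/eqP; rewrite -subr_eq0 -/b.
have [c0|c0] := eqVneq c 0.
  have := Q 1; have := Q (-1); rewrite c0 !mulr0 !addr0 mulrN mulr1 mulNr oppr_ge0.
  by rewrite pmulr_rle0// pmulr_rge0// => H1 H2; rewrite eq_le H1.
have N : 0 < `|c| by rewrite normr_gt0.
have := Q (- b / `|c|).
have -> : 2 * (- b / `|c|) * b + (- b / `|c|) ^+ 2 * c =
  (b ^+ 2 / `|c| ^+ 2) * (c - 2 * `|c|) by field; rewrite normr_eq0.
have cn : c - 2 * `|c| < 0 by rewrite subr_lt0 (le_lt_trans (ler_norm c))// ltr_pMl// ltr1n.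
rewrite nmulr_lge0// pmulr_lle0; last by rewrite invr_gt0 exprn_gt0.
by rewrite le_eqVlt ltNge sqr_ge0 orbF sqrf_eq0.
Qed.

End Quotient.

(** The infimum over the normalized test functions is attained in the completion,
    where the minimizer is an eigenfunction.  Thus a single test function that
    violates the spectral inequality for [L] yields an eigenvalue below [L]. *)
Lemma rayleigh_infimum_attained (L : R) (g : P -> R) :
  rtest G g -> grad2 (pd^~ g) < L * sq g ->
  exists2 mu, mu < L & exists U dU,
  [/\ rW1 D one_weight G U dU, sq U = 1 &
   forall V dV, rW1 D one_weight G V dV ->
   Int (fun x => dU 0 x * dV 0 x) + Int (fun x => dU 1 x * dV 1 x) =
   mu * Int (fun x => U x * V x)].
Proof.
move=> tg gL.
have scale h a : rtest G h -> sq (fun x => a * h x) = a ^+ 2 * sq h /\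
    grad2 (pd^~ (fun x => a * h x)) = a ^+ 2 * grad2 (pd^~ h).
  move=> th; have [sh sph] := rtest_sqint th; have smh : smooth h by case: th.
  split; first exact: sqZ.
  have E j : sq (pd j (fun x => a * h x)) = a ^+ 2 * sq (pd j h).
    by rewrite -sqZ//; apply: eq_Rintegral => x _; rewrite pdZ.
  by rewrite !E mulrDr.
have normalize h : rtest G h -> sq h != 0 ->
    exists2 a, a ^+ 2 * sq h = 1 & rtest G (fun x => a * h x).
  move=> th h0; exists (Num.sqrt (sq h))^-1; last exact: rtest_scale.
  by rewrite exprVn sqr_sqrtr ?sq_ge0// mulVf.
pose E := [set y | exists h, [/\ rtest G h, sq h = 1 & y = grad2 (pd^~ h)]].
have E_lb : lbound E 0 by move=> _ [h [_ _ ->]]; rewrite addr_ge0 ?sq_ge0.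
have sg0 : sq g != 0.
  by apply: contraTneq gL => ->; rewrite mulr0 -leNgt addr_ge0 ?sq_ge0.
have [a a1 tag] := normalize g tg sg0.
have Eag : E (a ^+ 2 * grad2 (pd^~ g)).
  have [s1 s2] := scale g a tg.
  by exists (fun x => a * g x); split => //; rewrite s1.
have Ehi : has_inf E by split; [exists (a ^+ 2 * grad2 (pd^~ g))|exists 0].
pose mu := inf E.
have mu0 : 0 <= mu by apply: lb_le_inf => //; exists (a ^+ 2 * grad2 (pd^~ g)).
have mu_le h : rtest G h -> mu * sq h <= grad2 (pd^~ h).
  move=> th; have [->|h0] := eqVneq (sq h) 0; first by rewrite mulr0 addr_ge0 ?sq_ge0.
  have [b b1 tbh] := normalize h th h0; have [s1 s2] := scale h b th.
  have : mu <= b ^+ 2 * grad2 (pd^~ h).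
    by apply: ge_inf; [exists 0|exists (fun x => b * h x); split => //; rewrite s1].
  move=> /(ler_wpM2r (sq_ge0 h)); rewrite mulrAC b1 mul1r; apply: le_trans.
  by [].
have muL : mu < L.
  apply: (@le_lt_trans _ _ (a ^+ 2 * grad2 (pd^~ g))).
    by apply: ge_inf => //; exists 0.
  have a20 : 0 < a ^+ 2.
    rewrite lt_neqAle sqr_ge0 andbT eq_sym; apply: contra_eq_neq a1 => ->.
    by rewrite mul0r eq_sym oner_neq0.
  by rewrite -(ltr_pM2l a20) in gL; rewrite (lt_le_trans gL)// mulrCA a1 mulr1.
have [f fP] : exists f : nat -> P -> R, forall k, [/\ rtest G (f k), sq (f k) = 1 &
    grad2 (pd^~ (f k)) <= mu + k.+1%:R^-1].
  have H k : exists h, [/\ rtest G h, sq h = 1 & grad2 (pd^~ h) <= mu + k.+1%:R^-1].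
    have k0 : 0 < k.+1%:R^-1 :> R by rewrite invr_gt0 ltr0n.
    have [_ [h [th h1 ->]] hlt] := inf_adherent k0 Ehi.
    by exists h; split => //; exact: ltW.
  exists (fun k => projT1 (cid (H k))) => k; exact: (projT2 (cid (H k))).
have tf k : rtest G (f k) by case: (fP k).
have f1 k : sq (f k) = 1 by case: (fP k).
have fmu k : grad2 (pd^~ (f k)) <= mu + k.+1%:R^-1 by case: (fP k).
exists mu => //.
have [U [dU [HU U1 gU]]] := minimizer_exists mu0 mu_le tf f1 fmu.
exists U, dU; split => // V dV HV.
exact: (minimizer_euler_lagrange mu0 mu_le HU U1 gU HV).
Qed.

End Minimizer.

(** * Compactness on the perforated cell *)

Lemma sqrB_le (R : realFieldType) (a b : R) : (a - b) ^+ 2 <= 2 * a ^+ 2 + 2 * b ^+ 2.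
Proof. by have := sqr_ge0 (a + b); nra. Qed.

Lemma trunc_increment_is_derive (R : realType) (f f' : R -> R) (K W : set R) :
  (forall t, is_derive t (1 : R) f (f' t)) -> continuous f' ->
  closed K -> open W -> W `<=` K -> (forall t, K t -> ~ W t -> f t = 0) ->
  increments (fun t => f t * \1_(~` K) t) (fun t => `|f' t| * \1_(~` K) t).
Proof.
move=> df; have <- : 'D_1 f = f' by apply/funext => t; case: (df t).
move=> cf clK opW WK f0 x x' xx'; apply: (trunc_increment _ cf clK opW WK f0 xx').
by move=> t; case: (df t).
Qed.

Lemma sq_sub_le d (T : measurableType d) (R : realType) (mu : {measure set T -> \bar R})
    (D : set T) (f g : T -> R) : measurable D -> sqint mu D f -> sqint mu D g ->
  Rintegral mu D (fun x => (f x - g x) ^+ 2) <=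
  2 * Rintegral mu D (fun x => f x ^+ 2) + 2 * Rintegral mu D (fun x => g x ^+ 2).
Proof.
move=> mD sf sg; have [_ fi] := sf; have [_ gi] := sg.
rewrite -RintegralZl// -RintegralZl// -RintegralD//; [|exact: intgZ|exact: intgZ].
apply: le_Rintegral => //; first by have [] := sqintB mD sf sg.
  by apply: intgD => //; exact: intgZ.
by move=> x _; exact: sqrB_le.
Qed.

Section PerforatedCell.
Context {R : realType}.
Local Notation P := (R * R)%type.
Local Notation leb := (@lebesgue_measure R).
Local Notation pm := (@plane_measure R).
Local Notation plane := (@plane R).

Section Truncation.
Variables (omega : set P).
Hypothesis oo : open omega.
Local Notation K := (closure omega).

Definition slice (j : 'I_2) (s t : R) : P := if j == 0 then (t, s) else (s, t).

(** The traces of the hole on a line are a closed and an open set, and the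
    function vanishes on their difference, which lies over the boundary. *)
Lemma trunc_increments (f : P -> R) j s : smooth f ->
  (forall x, boundary omega x -> f x = 0) ->
  increments (fun t => f (slice j s t) * \1_(~` K) (slice j s t))
             (fun t => `|pd j f (slice j s t)| * \1_(~` K) (slice j s t)).
Proof.
move=> sf f0.
have E : slice j s = fun t => t *: evec j + slice j s 0.
  apply/funext => t; rewrite /slice /evec; case: (ord2P j) => -> /=.
    by congr pair; rewrite /= /GRing.scale/= ?mulr1 ?mulr0 ?addr0 ?add0r.
  by congr pair; rewrite /= /GRing.scale/= ?mulr1 ?mulr0 ?addr0 ?add0r.
have ci : continuous (slice j s) by rewrite E; exact: continuous_along.
have df t : is_derive t (1 : R) (fun r => f (slice j s r)) (pd j f (slice j s t)).
  by rewrite E; apply: is_derive_along; exact: smooth_derivable.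
apply: (@trunc_increment_is_derive R _ _ (slice j s @^-1` K) (slice j s @^-1` omega) df) => //.
- move=> t; apply: (@continuous_comp _ _ _ (slice j s) (pd j f)); first exact: ci.
  by apply: smooth_continuous; exact: smooth_pd.
- by apply: closed_comp; [move=> t _; exact: ci|exact: closed_closure].
- by apply: open_comp => [t _|]; [exact: ci|].
- by move=> t /= ot; exact: subset_closure.
- by move=> t Kt nt; apply: f0; split=> //; rewrite (interior_id omega).1.
Qed.

End Truncation.

Variables (l2 : R) (omega : set P).
Hypothesis l20 : 0 < l2.
Hypothesis oo : open omega.
Local Notation K := (closure omega).
Local Notation D := (perforated_cell l2 omega).
Local Notation Q := (cellQ l2).
Local Notation S := (rect (- 2^-1) 1 (- l2) (2 * l2)).

Lemma cellQ_open : open Q.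
Proof.
have -> : Q = ((fun x : P => `|x.1|) @^-1` [set y | y < l1]) `&`
   ((fun x : P => `|x.2|) @^-1` [set y | y < l2]) by [].
apply: openI; apply: open_comp; try exact: open_lt.
  move=> x _; apply: (@continuous_comp _ _ _ (fun x : P => x.1) (@Num.norm R R)).
    exact: cvg_fst.
  exact: norm_continuous.
move=> x _; apply: (@continuous_comp _ _ _ (fun x : P => x.2) (@Num.norm R R)).
  exact: cvg_snd.
exact: norm_continuous.
Qed.

Lemma cellQ_measurable : measurable (Q : set plane).
Proof. by apply: open_plane_measurable; exact: cellQ_open. Qed.

Lemma cell_measurable : measurable (D : set plane).
Proof.
apply: measurableD; first exact: cellQ_measurable.
by apply: closed_plane_measurable; exact: closed_closure.
Qed.

Lemma cellQ_sub_rect : Q `<=` S.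
Proof.
move=> [x y] [/=]; rewrite /l1 !ltr_norml => /andP[x1 x2] /andP[y1 y2].
by split; rewrite /= in_itv/=; apply/andP; split; lra.
Qed.

Lemma rect_cellQ_null : pm (S `\` Q) = 0%E.
Proof.
have mS : measurable (S `\` Q : set plane).
  by apply: measurableD; [exact: rect_measurable|exact: cellQ_measurable].
pose V : set plane := [set - 2^-1] `*` setT; pose H : set plane := setT `*` [set - l2].
have mV : measurable V by exact: measurableX.
have mH : measurable H by exact: measurableX.
have V0 : pm V = 0%E by exact: vline_null.
have H0 : pm H = 0%E by exact: hline_null.
apply/eqP; rewrite -measure_le0.
apply: (@le_trans _ _ (pm (V `|` H))).
  apply: le_measure; rewrite ?inE//; first exact: measurableU.
  move=> [x y] [[/=]]; rewrite !in_itv/= => /andP[x1 x2] /andP[y1 y2].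
  rewrite /cellQ/= /l1 !ltr_norml => nQ.
  have [xe|xn] := eqVneq x (- 2^-1); first by left.
  have [ye|yn] := eqVneq y (- l2); first by right.
  exfalso; apply: nQ; split; apply/andP; split; rewrite ?lt_neqAle.
  - by rewrite eq_sym xn.
  - by rewrite -lt_neqAle; lra.
  - by rewrite eq_sym yn.
  - by rewrite -lt_neqAle; lra.
by have -> : pm (V `|` H) = 0%E by rewrite -V0; exact: measureU0.
Qed.

(** The rectangle exceeds the cell by two edges and the hole, where the truncated
    function vanishes. *)
Lemma cell_sq (f : P -> R) M : measurable_fun (setT : set plane) (f : plane -> R) ->
  (forall x, `|f x| <= M) ->
  Rintegral pm S (fun x => (f x * \1_(~` K) x) ^+ 2) = Rintegral pm D (fun x => f x ^+ 2).
Proof.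
move=> mf fM.
have mK : measurable (~` K : set plane).
  by apply: measurableC; apply: closed_plane_measurable; exact: closed_closure.
have mh : measurable_fun (setT : set plane) ((fun x => (f x * \1_(~` K) x)) : plane -> R).
  by apply: measurable_funM => //; exact: measurable_indic.
have hM x : `|f x * \1_(~` K) x| <= M.
  rewrite indicE; case: (_ \in _); rewrite ?mulr1 ?mulr0 ?normr0//.
  by rewrite (le_trans _ (fM x)).
transitivity (Rintegral pm Q (fun x => (f x * \1_(~` K) x) ^+ 2)).
  apply: Int_null.
  - exact: rect_measurable.
  - exact: cellQ_measurable.
  - exact: cellQ_sub_rect.
  - exact: rect_cellQ_null.
  - by apply: rect_bounded_intg (sqr_bounded hM); exact: measurable_funX.
rewrite /perforated_cell setDE [RHS]Rintegral_mkcondr; apply: eq_Rintegral => x _.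
rewrite patchE indicE; case: ifPn => _; first by rewrite mulr1.
by rewrite mulr0 expr0n.
Qed.

(** The extension by zero across the hole turns test functions on the perforated
    cell into functions on a full rectangle, to which [ultra_rellich] applies. *)
Lemma cell_rellich (F : set_system nat) (f : nat -> P -> R) (C : R) :
  UltraFilter F -> (forall k, rtest (boundary omega) (f k)) ->
  (forall k, Rintegral pm D (fun x => f k x ^+ 2) <= C) ->
  (forall j k, Rintegral pm D (fun x => pd j (f k) x ^+ 2) <= C) ->
  forall e, 0 < e -> exists2 A, F A & forall k l, A k -> A l ->
    Rintegral pm D (fun x => (f k x - f l x) ^+ 2) <= e.
Proof.
move=> UF tf fC pC e e0.
have C0 : 0 <= C by apply: le_trans (fC 0%N); apply: Rintegral_ge0 => x _; exact: sqr_ge0.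
have mK : measurable (~` K : set plane).
  by apply: measurableC; apply: closed_plane_measurable; exact: closed_closure.
have mi : measurable_fun (setT : set plane) (\1_(~` K) : plane -> R) by exact: measurable_indic.
have mt h : rtest (boundary omega) h -> measurable_fun (setT : set plane) (h : plane -> R).
  by move=> [sh _ _]; apply: continuous_plane_measurable; exact: smooth_continuous.
have mp j h : rtest (boundary omega) h -> measurable_fun (setT : set plane) (pd j h : plane -> R).
  move=> [sh _ _]; apply: continuous_plane_measurable; apply: smooth_continuous; exact: smooth_pd.
pose M h : R := if pselect (rtest (boundary omega) h) is left th
  then projT1 (cid (rtest_bounded th)) else 0.
have MP h : rtest (boundary omega) h -> (forall x, `|h x| <= M h) /\ forall j x, `|pd j h x| <= M h.
  by move=> th; rewrite /M; case: pselect => // th'; exact: (projT2 (cid (rtest_bounded th'))).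
have tB k l : rtest (boundary omega) (fun x => f k x - f l x) by exact: rtest_sub.
have smf k : smooth (f k) by case: (tf k).
have ind1 (x : P) : 0 <= (\1_(~` K) x : R) <= 1 by rewrite indicE ler0n lern1 leq_b1.
pose g j k l (x : P) : R := `|pd j (fun x => f k x - f l x) x| * \1_(~` K) x.
have mg j k l : measurable_fun (setT : set plane) (g j k l : plane -> R).
  apply: measurable_funM => //; apply: (measurableT_comp (@normr_measurable R setT)).
  exact: mp.
have gN j k l x : 0 <= g j k l x <= M (fun x => f k x - f l x).
  have /andP[i0 i1] := ind1 x; rewrite mulr_ge0//=.
  by apply: le_trans (ler_piMr _ i1) _ => //; exact: (MP _ (tB k l)).2.
have gC j k l : Rintegral pm S (fun x => g j k l x ^+ 2) <= 4 * C.
  have mpn : measurable_fun (setT : set plane) ((fun x => `|pd j (fun x => f k x - f l x) x|) : plane -> R).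
    by apply: (measurableT_comp (@normr_measurable R setT)); exact: mp.
  rewrite (@cell_sq _ (M (fun x => f k x - f l x)) mpn); last first.
    by move=> x; rewrite normr_id; exact: (MP _ (tB k l)).2.
  have [_ spk] := rW1_sqint cell_measurable (rtest_rW1 D (tf k)).
  have [_ spl] := rW1_sqint cell_measurable (rtest_rW1 D (tf l)).
  have -> : Rintegral pm D (fun x => `|pd j (fun x => f k x - f l x) x| ^+ 2) =
      Rintegral pm D (fun x => (pd j (f k) x - pd j (f l) x) ^+ 2).
    by apply: eq_Rintegral => x _; rewrite real_normK ?num_real// pdB.
  apply: le_trans (sq_sub_le cell_measurable (spk j) (spl j)) _.
  have -> : 4 * C = 2 * C + 2 * C by rewrite -mulrDl; congr (_ * _); ring.
  by rewrite lerD// ler_pM2l.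
have FC k : Rintegral pm S (fun x => (f k x * \1_(~` K) x) ^+ 2) <= 4 * C.
  rewrite (@cell_sq _ (M (f k)) (mt _ (tf k)) (MP _ (tf k)).1).
  by apply: le_trans (fC k) _; rewrite ler_peMl// ler1n.
have trunc k l x : f k x * \1_(~` K) x - f l x * \1_(~` K) x =
    (f k x - f l x) * \1_(~` K) x by rewrite mulrBl.
have f0 k l x : boundary omega x -> f k x - f l x = 0 by case: (tB k l) => _ _; apply.
have smB k l : smooth (fun x => f k x - f l x) by case: (tB k l).
have [A FA HA] : exists2 A, F A & forall k l, A k -> A l ->
    Rintegral pm S (fun x => (f k x * \1_(~` K) x - f l x * \1_(~` K) x) ^+ 2) <= e.
  apply: (@ultra_rellich R F (- 2^-1) (- l2) 1 (2 * l2) (4 * C) _ (fun k => M (f k))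
    (g 0) (g 1) (fun k l => M (fun x => f k x - f l x))) => //.
  - by rewrite mulr_gt0.
  - by move=> k; apply: measurable_funM => //; exact: mt.
  - move=> k x; have /andP[i0 i1] := ind1 x; rewrite normrM (ger0_norm i0).
    by apply: le_trans (ler_piMr _ i1) _ => //; exact: (MP _ (tf k)).1.
  - move=> k l s x x' xx'; rewrite !trunc.
    exact: (trunc_increments oo 0 s (smB k l) (f0 k l)).
  - move=> k l s x x' xx'; rewrite !trunc.
    exact: (trunc_increments oo 1 s (smB k l) (f0 k l)).
exists A => // k l Ak Al; apply: le_trans (HA k l Ak Al).
rewrite -(@cell_sq _ (M (fun x => f k x - f l x)) (mt _ (tB k l)) (MP _ (tB k l)).1).
rewrite le_eqVlt; apply/orP; left; apply/eqP; apply: eq_Rintegral => x _.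
by rewrite trunc.
Qed.

End PerforatedCell.

(** * Real and imaginary parts *)

Section ComplexLink.
Context {R : realType}.
Local Notation P := (R * R)%type.
Local Notation C := (R[i]).
Local Notation pm := (@plane_measure R).
Local Notation plane := (@plane R).
Implicit Types (D G : set P) (w : P -> R) (u : P -> C) (p : 'I_2 -> P -> C).

Definition re u (x : P) : R := complex.Re (u x).
Definition im u (x : P) : R := complex.Im (u x).
Definition re2 p (j : 'I_2) : P -> R := re (p j).
Definition im2 p (j : 'I_2) : P -> R := im (p j).

Lemma normc_sqr (z : C) : Normc.normc z ^+ 2 = complex.Re z ^+ 2 + complex.Im z ^+ 2.
Proof. by case: z => a b /=; rewrite sqr_sqrtr// addr_ge0 ?sqr_ge0. Qed.

Definition cmpair D u p := measurable_cfun D u /\ forall j, measurable_cfun D (p j).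

Lemma cmpair_re D u p : cmpair D u p -> mpair D (re u) (re2 p).
Proof. by move=> [[mr _] mp]; split=> // j; case: (mp j). Qed.

Lemma cmpair_im D u p : cmpair D u p -> mpair D (im u) (im2 p).
Proof. by move=> [[_ mi] mp]; split=> // j; case: (mp j). Qed.

Lemma L2sqE D w u : measurable (D : set plane) -> continuous w -> measurable_cfun D u ->
  L2sq D w u = (\int[pm]_(x in D) (w x ^+ 2 * re u x ^+ 2 + w x ^+ 2 * im u x ^+ 2)%:E)%E.
Proof.
by move=> mD cw [mr mi]; apply: eq_integral => x _; rewrite exprMn normc_sqr mulrDr.
Qed.

Lemma W1norm_energy D w u p : measurable (D : set plane) -> continuous w -> cmpair D u p ->
  W1norm D w u p = sqrte (energy D w (re u) (re2 p) + energy D w (im u) (im2 p))%E.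
Proof.
move=> mD cw mup; have [mu mp] := mup.
rewrite /W1norm; congr sqrte.
have mw : measurable_fun (D : set plane) (w : plane -> R) by exact: continuous_plane_measurable.
pose d f := fun x : P => w x ^+ 2 * re f x ^+ 2 + w x ^+ 2 * im f x ^+ 2.
have md f : measurable_cfun D f -> measurable_fun (D : set plane) (d f : plane -> R).
  by move=> [mr mi]; apply: measurable_funD; apply: measurable_funM; exact: measurable_funX.
have d0 f x : 0 <= d f x by rewrite addr_ge0// mulr_ge0 ?sqr_ge0.
rewrite /energy -ge0_integralD//; last 4 first.
- by move=> x _; rewrite lee_fin dens_ge0.
- by apply/measurable_EFinP; apply: measurable_dens => //; exact: cmpair_re.
- by move=> x _; rewrite lee_fin dens_ge0.
- by apply/measurable_EFinP; apply: measurable_dens => //; exact: cmpair_im.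
rewrite !big_ord_recr big_ord0/= add0e !L2sqE// -!/(d _).
rewrite -!ge0_integralD//; try by [move=> x _; rewrite lee_fin d0|apply/measurable_EFinP; exact: md].
- apply: eq_integral => x _; rewrite -!EFinD; congr EFin; rewrite /d /dens /re2 /im2.
  have -> : widen_ord (leqnSn 1) ord_max = 0 :> 'I_2 by exact: val_inj.
  have -> : ord_max = 1 :> 'I_2 by exact: val_inj.
  by ring.
- by move=> x _; rewrite adde_ge0// lee_fin d0.
- by apply: emeasurable_funD; apply/measurable_EFinP; exact: md.
Qed.

Lemma sqrte_lt (X : \bar R) (d : R) : (0 <= X)%E -> 0 < d ->
  (sqrte X < d%:E)%E -> (X <= (d ^+ 2)%:E)%E.
Proof.
case: X => [r| |]//=; rewrite !lee_fin !lte_fin => r0 d0 h.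
rewrite -(sqr_sqrtr r0) lerXn2r// ?nnegrE ?sqrtr_ge0 ?ltW//.
Qed.

Lemma sqrte_le (X : \bar R) (d : R) : (0 <= X)%E -> 0 <= d ->
  (X <= (d ^+ 2)%:E)%E -> (sqrte X <= d%:E)%E.
Proof.
case: X => [r| |]//=; rewrite !lee_fin => r0 d0 h.
by rewrite -(ger0_norm d0) -sqrtr_sqr ler_sqrt// sqr_ge0.
Qed.

Lemma test_fun_rtest G (f : P -> C) : test_fun G f -> rtest G (re f) /\ rtest G (im f).
Proof.
move=> [[sr si] cf f0].
have sub (g : P -> R) : (forall x, f x = 0 -> g x = 0) -> compact (closure [set x | g x != 0]).
  move=> fg; apply: (subclosed_compact _ cf); first exact: closed_closure.
  by apply: closure_subset => x /=; apply: contra_neq => /fg.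
split; split => //.
- by apply: sub => x; rewrite /re => ->.
- by move=> x /f0; rewrite /re => ->.
- by apply: sub => x; rewrite /im => ->.
- by move=> x /f0; rewrite /im => ->.
Qed.

Lemma rtest_test_fun G (f g : P -> R) : rtest G f -> rtest G g ->
  test_fun G (fun x => f x +i* g x).
Proof.
move=> [sf cf f0] [sg cg g0]; split; first by [].
  apply: (subclosed_compact _ (compactU cf cg)); first exact: closed_closure.
  rewrite -closureU; apply: closure_subset => x /=.
  by apply: contraPP => /not_orP[/negP/negPn/eqP -> /negP/negPn/eqP ->]; rewrite eqxx.
by move=> x Gx; rewrite f0// g0.
Qed.

Lemma test_fun_cmpair D G f : test_fun G f -> cmpair D f (cgrad f).
Proof.
move=> tf; have [tr ti] := test_fun_rtest tf.
have [mr mpr] := rtest_mpair D tr; have [mi mpi] := rtest_mpair D ti.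
by split; [|move=> j; split; [exact: (mpr j)|exact: (mpi j)]].
Qed.

Lemma cmpairB D u p v q : cmpair D u p -> cmpair D v q ->
  cmpair D (fun x => u x - v x) (fun j x => p j x - q j x).
Proof.
have H (a b : P -> C) : measurable_cfun D a -> measurable_cfun D b -> measurable_cfun D (fun x => a x - b x).
  move=> [ar ai] [br bi]; split.
    apply: (eq_measurable_fun (fun x => re a x - re b x)); last exact: measurable_funB.
    by move=> x _; rewrite /re; case: (a x) (b x) => ? ? [? ?].
  apply: (eq_measurable_fun (fun x => im a x - im b x)); last exact: measurable_funB.
  by move=> x _; rewrite /im; case: (a x) (b x) => ? ? [? ?].
by move=> [mu mp] [mv mq]; split=> [|j]; exact: H.
Qed.

Lemma W1normB_energy D w G u p f : measurable (D : set plane) -> continuous w ->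
  cmpair D u p -> test_fun G f ->
  W1norm D w (fun x => f x - u x) (fun j x => cgrad f j x - p j x) =
  sqrte (energy D w (fun x => re f x - re u x)%R (fun j x => pd j (re f) x - re2 p j x)%R +
         energy D w (fun x => im f x - im u x)%R (fun j x => pd j (im f) x - im2 p j x)%R)%E.
Proof.
move=> mD cw mup tf.
rewrite W1norm_energy//; last by apply: cmpairB => //; exact: test_fun_cmpair tf.
congr (sqrte (_ + _)%E); apply: eq_integral => x _; congr EFin; rewrite /dens /re2 /im2 /re /im /=.
- by case: (f x) (u x) (p 0 x) (p 1 x) => ? ? [? ?] [? ?] [? ?].
- by case: (f x) (u x) (p 0 x) (p 1 x) => ? ? [? ?] [? ?] [? ?].
Qed.

Lemma W1_rW1 D w G u p : measurable (D : set plane) -> continuous w ->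
  W1 D w G u p -> rW1 D w G (re u) (re2 p) /\ rW1 D w G (im u) (im2 p).
Proof.
move=> mD cw [mu mp [phi [tphi cphi]]].
have mup : cmpair D u p by [].
have H e : 0 < e -> exists n,
   (energy D w (fun x => re (phi n) x - re u x)%R (fun j x => pd j (re (phi n)) x - re2 p j x)%R +
    energy D w (fun x => im (phi n) x - im u x)%R (fun j x => pd j (im (phi n)) x - im2 p j x)%R <= e%:E)%E.
  move=> e0; have d0 : 0 < Num.sqrt e by rewrite sqrtr_gt0.
  have nb : nbhs (0%E : \bar R) [set y | (y < (Num.sqrt e)%:E)%E].
    by apply: open_nbhs_nbhs; split; [exact: open_ereal_lt_ereal|rewrite /= lte_fin].
  have /(@filter_ex nat)[n /=] : \forall n \near \oo, (W1norm D w (fun x => phi n x - u x)%R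
      (fun j x => cgrad (phi n) j x - p j x)%R < (Num.sqrt e)%:E)%E by exact: cphi _ nb.
  rewrite (W1normB_energy mD cw mup (tphi n)) => Hn; exists n.
  rewrite -[e](sqr_sqrtr (ltW e0)); apply: sqrte_lt => //.
  by rewrite adde_ge0// energy_ge0.
split; (split; [by [exact: cmpair_re|exact: cmpair_im]|]) => e e0; have [n Hn] := H e e0.
  exists (re (phi n)); first by case: (test_fun_rtest (tphi n)).
  by apply: le_trans Hn; rewrite leeDl// energy_ge0.
exists (im (phi n)); first by case: (test_fun_rtest (tphi n)).
by apply: le_trans Hn; rewrite leeDr// energy_ge0.
Qed.

Lemma rW1_W1 D w G u p : measurable (D : set plane) -> continuous w ->
  rW1 D w G (re u) (re2 p) -> rW1 D w G (im u) (im2 p) -> W1 D w G u p.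
Proof.
move=> mD cw [mr Hr] [mi Hi].
have mup : cmpair D u p.
  by case: mr mi => mr mpr [mi mpi]; split=> [|j]; split=> //; [exact: (mpr j)|exact: (mpi j)].
have [mu mp] := mup; split => //.
pose e (n : nat) : R := (n.+1%:R^-1) ^+ 2 / 2.
have e0 n : 0 < e n by rewrite divr_gt0// exprn_gt0// invr_gt0 ltr0n.
have X n : exists f, test_fun G f /\
   (W1norm D w (fun x => f x - u x)%R (fun j x => cgrad f j x - p j x)%R <= (n.+1%:R^-1)%:E)%E.
  have [f tf fe] := Hr _ (e0 n); have [g tg ge] := Hi _ (e0 n).
  have tfg := rtest_test_fun tf tg.
  exists (fun x => f x +i* g x); split => //.
  rewrite (W1normB_energy mD cw mup tfg); apply: sqrte_le.
  - by rewrite adde_ge0// energy_ge0.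
  - by rewrite invr_ge0.
  - rewrite [_ ^+ 2]splitr EFinD; exact: leeD.
exists (fun n => projT1 (cid (X n))); split.
  by move=> n; case: (projT2 (cid (X n))).
apply: (@squeeze_cvge _ _ _ _ (cst 0%E) _ (fun n => (n.+1%:R^-1)%:E)).
- near=> n; apply/andP; split; last by case: (projT2 (cid (X n))).
  by rewrite /W1norm; case: (_ + _)%E => //= r; rewrite lee_fin sqrtr_ge0.
- exact: cvg_cst.
- apply: cvg_EFin; first exact: nearW.
  exact: cvg_harmonic.
Unshelve. all: by end_near. Qed.

End ComplexLink.

(** * The spectral inequality on the cell *)

Section CellInequality.
Context {R : realType}.
Local Notation P := (R * R)%type.
Local Notation C := (R[i]).
Local Notation pm := (@plane_measure R).
Local Notation plane := (@plane R).
Notation sq D f := (Rintegral pm D (fun x => f x ^+ 2)).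

Lemma IntN (D : set P) (f : P -> R) : measurable (D : set plane) ->
  pm.-integrable D (EFin \o f) -> Rintegral pm D (fun x => - f x) = - Rintegral pm D f.
Proof.
move=> mD fi; rewrite -mulN1r -(RintegralZl (-1) mD fi).
by apply: eq_Rintegral => x _; rewrite mulN1r.
Qed.

Lemma scal_realE (D : set P) (f : P -> R) (g : P -> C) : measurable (D : set plane) ->
  sqint pm D f -> sqint pm D (re g) -> sqint pm D (im g) ->
  scal D (fun x => f x +i* 0) g =
  (Rintegral pm D (fun x => f x * re g x)) +i* (- Rintegral pm D (fun x => f x * im g x)).
Proof.
move=> mD sf sr si; rewrite /scal /cintegral; congr (_ +i* _).
  by apply: eq_Rintegral => x _; rewrite /re; case: (g x) => a b /=; ring.
rewrite -IntN//; last exact: (sqint_mul mD sf si).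
by apply: eq_Rintegral => x _; rewrite /im; case: (g x) => a b /=; ring.
Qed.

Lemma gscal_realE (D : set P) (f : 'I_2 -> P -> R) (g : 'I_2 -> P -> C) : measurable (D : set plane) ->
  (forall j, sqint pm D (f j)) -> (forall j, sqint pm D (re2 g j)) -> (forall j, sqint pm D (im2 g j)) ->
  gscal D (fun j x => f j x +i* 0) g =
  (Rintegral pm D (fun x => f 0 x * re2 g 0 x) + Rintegral pm D (fun x => f 1 x * re2 g 1 x)) +i*
  (- (Rintegral pm D (fun x => f 0 x * im2 g 0 x) + Rintegral pm D (fun x => f 1 x * im2 g 1 x))).
Proof.
move=> mD sf sr si; rewrite /gscal !big_ord_recr big_ord0/= add0r.
have -> : widen_ord (leqnSn 1) ord_max = 0 :> 'I_2 by exact: val_inj.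
have -> : ord_max = 1 :> 'I_2 by exact: val_inj.
rewrite (scal_realE mD (sf 0) (sr 0) (si 0)) (scal_realE mD (sf 1) (sr 1) (si 1)).
by rewrite opprD.
Qed.

(** If the inequality failed for one test function, the attained infimum of the
    Rayleigh quotient would be an eigenvalue smaller than the smallest one.  The
    real minimizer is an eigenfunction against complex test functions because
    the equation splits into real and imaginary parts. *)
Lemma cell_inequality (l2 : R) (omega : set P) (Lambda : R) (f : P -> R) :
  0 < l2 -> open omega -> smallest_mixed_eigenvalue l2 omega Lambda ->
  rtest (boundary omega) f ->
  Lambda * sq (perforated_cell l2 omega) f <=
  sq (perforated_cell l2 omega) (pd 0 f) + sq (perforated_cell l2 omega) (pd 1 f).
Proof.
move=> l20 oo [_ least] tf; set D := perforated_cell l2 omega.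
have mD : measurable (D : set plane) by exact: cell_measurable.
rewrite leNgt; apply/negP => lt.
have [mu muL [U [dU [HU U1 EL]]]] := rayleigh_infimum_attained mD
  (cell_rellich l20 oo) tf lt.
have : Lambda <= mu; last by rewrite leNgt muL.
apply: least; have [sU sdU] := rW1_sqint mD HU.
exists (fun x => U x +i* 0), (fun j x => dU j x +i* 0); split.
- apply: rW1_W1 => //; first exact: cst_continuous.
  have t0 : rtest (boundary omega) (fun x => 0 * f x) by exact: rtest_scale.
  have := rtest_rW1 D t0; congr rW1.
    by apply/funext => x; rewrite mul0r.
  by apply/funext => j; apply/funext => x; rewrite pdZ ?mul0r//; case: tf.
- rewrite /L2norm L2sqE//; first last.
  + by split; [case: sU|exact: measurable_cst].
  + exact: cst_continuous.
  have -> : (\int[pm]_(x in D) (1 ^+ 2 * re (fun x => U x +i* 0) x ^+ 2 +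
      1 ^+ 2 * im (fun x => U x +i* 0) x ^+ 2)%:E = 1%:E)%E.
    rewrite -[in RHS]U1 -(Int_ereal mD sU.2).
    by apply: eq_integral => x _; rewrite /re /im expr1n !mul1r expr0n addr0.
  by rewrite /= sqrtr1 eqe oner_eq0.
move=> V dV HV.
have [HVr HVi] := W1_rW1 mD one_weight_continuous HV.
have [sVr sdVr] := rW1_sqint mD HVr; have [sVi sdVi] := rW1_sqint mD HVi.
rewrite gscal_realE// scal_realE// (EL _ _ HVr) (EL _ _ HVi).
by apply/eqP; rewrite eq_complex/= !mul0r subr0 addr0 mulrN !eqxx.
Qed.

End CellInequality.

(** * The spectral inequality on the domain *)

Section Geometry.
Context {R : realType}.
Local Notation P := (R * R)%type.
Local Notation leb := (@lebesgue_measure R).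
Local Notation pm := (@plane_measure R).
Local Notation plane := (@plane R).
Notation sq D f := (Rintegral pm D (fun x => f x ^+ 2)).

Lemma closure_shift (A : set P) (a : P) (x : P) :
  closure [set y | A (y - a)] x <-> closure A (x - a).
Proof.
have sub (B : set P) (b : P) : closure [set y | B (y + b)] `<=` [set y | closure B (y + b)].
  have cl : closed [set y | closure B (y + b)].
    apply: (@closed_comp _ _ (fun y : P => y + b) (closure B)); last exact: closed_closure.
    by move=> y _; apply: cvgD; [exact: cvg_id|exact: cvg_cst].
  rewrite [X in _ `<=` X](closure_id _).1//.
  by apply: closure_subset => y /=; exact: subset_closure.
split; first exact: (sub A (- a)).
have E : A = [set z | [set y | A (y - a)] (z + a)].
  by apply/seteqP; split => z /=; rewrite addrK.
by move=> H; rewrite E in H; have := sub _ _ _ H; rewrite /= subrK.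
Qed.

(** If the closure filled a neighbourhood of a boundary point, the defining
    function would have a local maximum there, against its nonzero gradient.  So
    every boundary point of a hole is a limit of points off the closed hole. *)
Lemma smooth_boundary_exterior (A : set P) (x : P) (B : set P) :
  open A -> smooth_boundary A -> closure A x -> ~ A x -> nbhs x B ->
  exists2 y, B y & ~ closure A y.
Proof.
move=> oA sA clx nAx Bx.
have bx : boundary A x by split=> // /interior_subset.
have [rho [srho [j dj] near_rho]] := sA x bx.
apply: contrapT => noy.
have inB y : B y -> closure A y.
  by move=> By; apply: contrapT => nK; apply: noy; exists y.
have crho : continuous rho by exact: smooth_continuous.
pose N := [set y | A y <-> rho y < 0].
have NBx : nbhs x (N `&` B) by exact: filterI.
have : nbhs x ((N `&` B)^°) by exact: nbhs_interior.
set V := (N `&` B)^° => Vx.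
have rho_le y : V y -> rho y <= 0.
  move=> Vy; rewrite leNgt; apply/negP => ry.
  have Ny : nbhs y (V `&` [set z | 0 < rho z]).
    apply: filterI; first by apply: open_nbhs_nbhs; split=> //; exact: open_interior.
    have nr : nbhs (rho y) [set r : R | 0 < r].
      by apply: open_nbhs_nbhs; split => //; exact: open_gt.
    exact: (crho y _ nr).
  have Vy' : (N `&` B) y by exact: interior_subset.
  have [z [Az [Vz rz]]] := inB y Vy'.2 _ Ny.
  have [Nz _] : (N `&` B) z by exact: interior_subset.
  by have := Nz.1 Az; rewrite ltNge (ltW rz).
have rx : 0 <= rho x.
  have [Nx _] : (N `&` B) x by exact: nbhs_singleton.
  by rewrite leNgt; apply/negP => /Nx.2.
pose g (h : R) := rho (h *: evec j + x).
have cl : continuous (fun h : R => h *: evec j + x : P) by exact: continuous_along.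
have Vg : nbhs (0 : R) [set h | V (h *: evec j + x)].
  have nV : nbhs ((0 : R) *: evec j + x) V by rewrite scale0r add0r.
  exact: (cl 0 _ nV).
have [e /= e0 eV] := (nbhs_ballP _ _).1 Vg.
have dg h : is_derive h (1 : R) g (pd j rho (h *: evec j + x)).
  by apply: is_derive_along; exact: smooth_derivable.
have gmax : is_derive (0 : R) 1 g 0.
  apply: (@derive1_at_max _ g (- e) e 0).
  - by rewrite (@le_trans _ _ 0)// ?oppr_le0 ltW.
  - by move=> t _; case: (dg t).
  - by rewrite in_itv/= oppr_lt0 e0.
  - move=> t; rewrite in_itv/= => /andP[t1 t2].
    apply: (@le_trans _ _ 0); last by rewrite /g scale0r add0r.
    by apply: rho_le; apply: eV; rewrite /ball/= sub0r normrN ltr_norml t1 t2.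
have [_ D0] := gmax.
have [_] := dg 0; rewrite D0 scale0r add0r => rho0.
by move: dj; rewrite -[X in X != 0]rho0 eqxx.
Qed.

Variables (l2 : R) (omega : set P) (J : nat).
Hypothesis l20 : 0 < l2.
Hypothesis oo : open omega.
Hypothesis sb : smooth_boundary omega.
Hypothesis clQ : closure omega `<=` cellQ l2.

Local Notation D := (perforated_cell l2 omega).
Local Notation Q := (cellQ l2).
Local Notation Omega := (Omega_bullet l2 omega J).

Definition center (alpha : int * int) : P :=
  (2 * alpha.1%:~R * l1, 2 * alpha.2%:~R * l2).

Definition in_strip (alpha : int * int) : bool :=
  [&& 0 < alpha.1, 0 < alpha.2 & alpha.2 <= J%:Z].

(** The cells off the half-strip, numbered by integers for the sake of countable
    additivity. *)
Definition outer_cell (k : nat) : set P :=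
  if @pickle_inv (int * int)%type k is Some alpha then
    if in_strip alpha then set0 else [set x | D (x - center alpha)]
  else set0.

Definition outer_cells : set P := \bigcup_k outer_cell k.

Lemma intr_close (m n : int) : `|m%:~R - n%:~R : R| < 1 -> m = n.
Proof.
rewrite -intrB -intr_norm -[1]/(1%:~R) ltr_int => h.
by apply/eqP; rewrite -subr_eq0 -normr_le0 -ltzD1 add0r.
Qed.

Lemma cell_unique (x : P) (al be : int * int) :
  Q (x - center al) -> Q (x - center be) -> al = be.
Proof.
case: al be => a1 a2 [b1 b2] [/= A1 A2] [/= B1 B2]; rewrite /l1 in A1 B1.
congr pair; apply: intr_close.
  move: A1 B1; rewrite !ltr_norml => /andP[? ?] /andP[? ?]; apply/andP; split; lra.
have : `|(a2%:~R - b2%:~R) * (2 * l2)| < 2 * l2.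
  move: A2 B2; rewrite !ltr_norml => /andP[? ?] /andP[? ?]; apply/andP; split; lra.
have l22 : 0 < 2 * l2 by rewrite mulr_gt0.
by rewrite normrM (gtr0_norm l22) gtr_pMl.
Qed.

Lemma cell_in_Omega_circ (x : P) (al : int * int) :
  D (x - center al) -> Omega_circ l2 omega x.
Proof.
move=> [Qx nK] [be _ Hbe]; have Kbe : closure omega (x - center be).
  exact: (closure_shift omega (center be) x).1.
by apply: nK; rewrite (cell_unique Qx (clQ Kbe)).
Qed.

Lemma outer_cellP k x : outer_cell k x -> exists al,
  [/\ pickle al = k, ~~ in_strip al & D (x - center al)].
Proof.
rewrite /outer_cell; have := @pickle_invK (int * int)%type k.
case: (pickle_inv _) => [al /= E|//].
by case: ifPn => // st Dx; exists al.
Qed.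

Lemma outer_cell_pickle al : outer_cell (pickle al) =
  if in_strip al then set0 else [set x | D (x - center al)].
Proof. by rewrite /outer_cell pickleK_inv. Qed.

Lemma outer_cells_sub : outer_cells `<=` Omega.
Proof.
move=> x [k _ /outer_cellP[al [_ _ Dx]]]; left; exact: (cell_in_Omega_circ Dx).
Qed.

Lemma outer_cell_triv : trivIset setT outer_cell.
Proof.
move=> k l _ _ [x [/outer_cellP[al [Ek _ [Qa _]]] /outer_cellP[be [El _ [Qb _]]]]].
by rewrite -Ek -El (cell_unique Qa Qb).
Qed.

Lemma center_floor (x : P) : exists al : int * int,
  (al.1%:~R - 2^-1 <= x.1 < al.1%:~R + 2^-1) /\
  ((2 * al.2%:~R - 1) * l2 <= x.2 < (2 * al.2%:~R + 1) * l2).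
Proof.
pose a := Num.floor (x.1 + 2^-1); pose b := Num.floor ((x.2 / l2 + 1) / 2).
exists (a, b); split => /=.
  have /andP[] := floor_itv (x.1 + 2^-1); rewrite -/a intrD => h1 h2.
  by apply/andP; split; lra.
have /andP[] := floor_itv ((x.2 / l2 + 1) / 2); rewrite -/b intrD => h1 h2.
rewrite -ler_pdivlMr// -ltr_pdivrMr//.
by apply/andP; split; lra.
Qed.

Definition grid : set P :=
  (range (fun n : int => n%:~R - 2^-1 : R) `*` setT) `|`
  (setT `*` range (fun n : int => (2 * n%:~R - 1) * l2 : R)).

Lemma range_int_countable (f : int -> R) : countable (range f).
Proof. exact: card_le_trans (card_image_le _ _) (countableP _). Qed.

Lemma range_int_measurable (f : int -> R) : measurable (range f : set (measurableTypeR R)).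
Proof.
by apply: countable_measurable; [move=> t; exact: measurable_set1|exact: range_int_countable].
Qed.

Lemma grid_measurable : measurable (grid : set plane).
Proof.
by apply: measurableU; apply: measurableX => //; exact: range_int_measurable.
Qed.

Lemma grid_null : pm grid = 0%E.
Proof.
have N0 (f : int -> R) : leb (range f) = 0%E.
  by apply: countable_lebesgue_measure0; exact: range_int_countable.
have mN := range_int_measurable.
have V0 : pm (range (fun n : int => n%:~R - 2^-1 : R) `*` setT) = 0%E.
  by rewrite plane_measureX// N0 mul0e.
have H0 : pm (setT `*` range (fun n : int => (2 * n%:~R - 1) * l2 : R)) = 0%E.
  by rewrite plane_measureX// N0 mule0.
by rewrite -V0 /grid; apply: measureU0 => //; apply: measurableX.
Qed.

(** A point off the grid lies in exactly one cell, and the half-strip is the union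
    of its cells up to the grid. *)
Lemma Omega_sub : Omega `<=` outer_cells `|` (Xi_plus l2 J `|` grid).
Proof.
move=> x Ox; have [Xx|nX] := pselect (Xi_plus l2 J x); first by right; left.
have [gx|ng] := pselect (grid x); first by right; right.
left; have {Ox} Cx : Omega_circ l2 omega x by case: Ox.
have [[a b] [/= /andP[a1 a2] /andP[b1 b2]]] := center_floor x.
have a1' : a%:~R - 2^-1 < x.1.
  rewrite lt_neqAle a1 andbT; apply/eqP => e; apply: ng; left; split => //.
  by exists a.
have b1' : (2 * b%:~R - 1) * l2 < x.2.
  rewrite lt_neqAle b1 andbT; apply/eqP => e; apply: ng; right; split => //.
  by exists b.
have Qx : Q (x - center (a, b)).
  rewrite /cellQ /= /l1 !ltr_norml; split; apply/andP; split; lra.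
exists (pickle (a, b)); first exact: I.
rewrite outer_cell_pickle ifN.
  split=> // Kx; apply: Cx; exists (a, b) => //.
  exact: (closure_shift omega (center (a, b)) x).2.
apply/negP => /and3P[/= a0 b0 bJ]; apply: nX; rewrite /Xi_plus /= /l1.
have a1R : 1 <= a%:~R :> R by rewrite -[1]/(1%:~R) ler_int.
have b1R : 1 <= b%:~R :> R by rewrite -[1]/(1%:~R) ler_int.
have bJR : b%:~R <= J%:R :> R by rewrite -[J%:R]/(J%:Z%:~R) ler_int.
split; first by lra.
apply/andP; split.
  apply: le_lt_trans b1'; rewrite -[leLHS]mul1r ler_pM2r//; lra.
apply: (lt_le_trans b2); rewrite ler_pM2r// natrD natrM; lra.
Qed.

Lemma Xi_measurable : measurable (Xi_plus l2 J : set plane).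
Proof.
have -> : Xi_plus l2 J = `]l1, +oo[%classic `*` `]l2, (2 * J + 1)%:R * l2[%classic.
  by apply/seteqP; split => -[x y] [/=]; rewrite !in_itv/= ?andbT.
by apply: measurableX; exact: measurable_itv.
Qed.

Lemma Omega_measurable : measurable (Omega : set plane).
Proof.
apply: measurableU; last exact: Xi_measurable.
apply: measurableC; apply: countable_bigcupT_measurable; first exact: countableP.
by move=> al; apply: closed_plane_measurable; exact: closed_closure.
Qed.

Lemma outer_cell_measurable k : measurable (outer_cell k : set plane).
Proof.
rewrite /outer_cell; case: (pickle_inv _) => // al; case: ifP => // _.
have := @measurable_shift2 R (- center al) measurableT _ (cell_measurable l2 omega).
by rewrite setTI.
Qed.

Lemma outer_cells_measurable : measurable (outer_cells : set plane).
Proof. by apply: bigcupT_measurable => k; exact: outer_cell_measurable. Qed.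

(** The boundary of a hole outside the strip belongs to the boundary of the
    whole domain, so that test functions restrict to test functions of a cell. *)
Lemma rtest_cell al f : ~~ in_strip al -> rtest (boundary Omega) f ->
  rtest (boundary omega) (fun x => f (x + center al)).
Proof.
move=> nst; apply: rtest_shift => x [Kx nox].
have nwx : ~ omega x by rewrite (interior_id omega).1 in nox.
have Qx : Q x by exact: clQ.
split.
  move=> B Bx.
  have nB : nbhs x ([set y | B (y + center al)] `&` Q).
    apply: filterI; last by apply: open_nbhs_nbhs; split => //; exact: cellQ_open.
    have ct : {for x, continuous (fun y : P => y + center al)}.
      by apply: cvgD; [exact: cvg_id|exact: cvg_cst].
    exact: (ct _ Bx).
  have [y [By Qy] nKy] := smooth_boundary_exterior oo sb Kx nwx nB.
  exists (y + center al); split => //; left.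
  by apply: (@cell_in_Omega_circ _ al); rewrite addrK; split.
move=> /interior_subset[Cx|[/= X1 /andP[X2 X3]]].
  apply: Cx; exists al => //; apply/(closure_shift omega (center al)).
  by rewrite addrK.
move: nst => /negP; apply; case: al X1 X2 X3 => a b /=; rewrite /l1 => X1 X2 X3.
move: Qx; rewrite /cellQ /= /l1 !ltr_norml => -[/andP[q1 q2] /andP[q3 q4]].
have a0 : 0 < a%:~R :> R by lra.
have b0 : 0 < b%:~R * l2 by lra.
rewrite pmulr_lgt0// in b0.
have bJ : b%:~R * l2 < (J%:R + 1) * l2 by rewrite natrD natrM in X3; lra.
rewrite ltr_pM2r// in bJ.
rewrite /in_strip /=; apply/and3P; split.
- by rewrite -(ltr0z R).
- by rewrite -(ltr0z R).
- by rewrite -ltzD1 -(ltr_int R) intrD.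
Qed.

(** The spectral inequality of one cell, summed over the cells outside the
    strip; inside the strip the gradient is merely nonnegative. *)
Lemma domain_inequality (Lambda : R) f : 0 <= Lambda ->
  smallest_mixed_eigenvalue l2 omega Lambda -> rtest (boundary Omega) f ->
  Lambda * sq outer_cells f <= sq Omega (pd 0 f) + sq Omega (pd 1 f).
Proof.
move=> L0 HL tf; have mO := Omega_measurable; have mC := outer_cells_measurable.
have [[mf fi] sp] := rW1_sqint mO (rtest_rW1 Omega tf).
have [mf0 fi0] := sp 0; have [mf1 fi1] := sp 1.
have fC : pm.-integrable outer_cells (EFin \o (fun x => f x ^+ 2)).
  exact: (integrableS mO mC outer_cells_sub fi).
have gO := intgD mO fi0 fi1.
have gC := integrableS mO mC outer_cells_sub gO.
rewrite -(RintegralD mO fi0 fi1) -lee_fin EFinM -(Int_ereal mC fC) -(Int_ereal mO gO).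
have sm : smooth f by case: tf.
have mT (h : P -> R) (A : set P) : smooth h -> measurable_fun (A : set plane) ((fun x => h x ^+ 2) : plane -> R).
  by move=> sh; apply: measurable_funX; apply: continuous_plane_measurable; exact: smooth_continuous.
apply: (@le_trans _ _ (\int[pm]_(x in outer_cells) (pd 0 f x ^+ 2 + pd 1 f x ^+ 2)%:E)%E); last first.
  apply: ge0_subset_integral => //; last exact: outer_cells_sub.
  - by apply/measurable_EFinP; apply: measurable_funD; apply: mT; exact: smooth_pd.
  - by move=> x _; rewrite lee_fin addr_ge0 ?sqr_ge0.
rewrite /outer_cells ge0_integral_bigcup//; first last.
- exact: outer_cell_triv.
- by move=> x _; rewrite lee_fin sqr_ge0.
- by apply/measurable_EFinP; exact: mT.
- exact: outer_cell_measurable.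
rewrite ge0_integral_bigcup//; first last.
- exact: outer_cell_triv.
- by move=> x _; rewrite lee_fin addr_ge0 ?sqr_ge0.
- by apply/measurable_EFinP; apply: measurable_funD; apply: mT; exact: smooth_pd.
- exact: outer_cell_measurable.
rewrite -nneseriesZl//; last first.
  by move=> k _; apply: integral_ge0 => x _; rewrite lee_fin sqr_ge0.
apply: lee_nneseries => [k _ _|k _].
  by rewrite mule_ge0//; apply: integral_ge0 => x _; rewrite lee_fin sqr_ge0.
rewrite /outer_cell; case: (pickle_inv _) => [al|]; last by rewrite !integral_set0 mule0.
case: ifPn => [_|nst]; first by rewrite !integral_set0 mule0.
have mD := cell_measurable l2 omega.
have mDs : measurable ([set x | D (x - center al)] : set plane).
  have := @measurable_shift2 R (- center al) measurableT _ mD.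
  by rewrite setTI.
have E : [set x : P | D (x + center al - center al)] = D.
  by apply/seteqP; split => x /=; rewrite addrK.
rewrite (plane_shift (center al))//; last 2 first.
- by apply/measurable_EFinP; exact: mT.
- by move=> x; rewrite lee_fin sqr_ge0.
rewrite [leRHS](plane_shift (center al))//; last 2 first.
- by apply/measurable_EFinP; apply: measurable_funD; apply: mT; exact: smooth_pd.
- by move=> x; rewrite lee_fin addr_ge0 ?sqr_ge0.
rewrite /= E.
have tc := rtest_cell nst tf.
have [[_ ci] cp] := rW1_sqint mD (rtest_rW1 D tc).
have [_ c0] := cp 0; have [_ c1] := cp 1.
have := cell_inequality l20 oo HL tc.
rewrite -(RintegralD mD c0 c1) -lee_fin EFinM -(Int_ereal mD ci) -(Int_ereal mD (intgD mD c0 c1)).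
move=> /le_trans; apply; rewrite le_eqVlt; apply/orP; left; apply/eqP.
by apply: eq_integral => x _; rewrite !pd_shift.
Qed.

End Geometry.

(** * Regularized weights *)

Section Weights.
Context {R : realType}.
Local Notation P := (R * R)%type.
Implicit Types x : P.

Lemma smooth_inv (f : P -> R) : (forall x, f x != 0) -> smooth f -> smooth (fun x => (f x)^-1).
Proof. by move=> f0 sf k; exact: Ck_inv. Qed.

Lemma pdV (f : P -> R) j x : (forall y, f y != 0) -> smooth f ->
  pd j (fun y => (f y)^-1) x = - (f x ^- 2 * pd j f x).
Proof.
move=> f0 sf; rewrite /pd deriveV; [by rewrite scaleNr|exact: f0|exact: smooth_derivable].
Qed.

Definition explin (a b : R) x : R := expR (a * x.1 + b * x.2).

Lemma smooth_explin a b : smooth (explin a b).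
Proof. by move=> k; exact: Ck_explin. Qed.

Lemma pd_explin a b j x : pd j (explin a b) x = comp2 a b j * explin a b x.
Proof. by have [_] := is_derive_explin a b x j. Qed.

Lemma explin_gt0 a b x : 0 < explin a b x. Proof. exact: expR_gt0. Qed.

Variables (beta gamma eps : R).
Hypothesis beta0 : 0 < beta.
Hypothesis gamma0 : 0 < gamma.

(** [cosh2] is a smooth substitute for the exponential of [beta * |x_2|], and
    [wlim] for the weight of the conclusion.  The cutoff has the form
    [1 / ((1 + eps s^2) (1 + eps t^2))] with [s] and [t] the two factors of
    [wlim]: it makes [wreg] bounded by the decaying weight while each factor
    [t / (1 + eps t^2)] keeps a logarithmic derivative at most that of [t]. *)
Definition cosh2 x : R := explin 0 beta x + explin 0 (- beta) x.
Definition wlim x : R := explin (- gamma) 0 x * cosh2 x.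
Definition k1 x : R := 1 + eps * explin (- (2 * gamma)) 0 x.
Definition k2 x : R := 1 + eps * (cosh2 x * cosh2 x).
Definition cutoff x : R := (k1 x * k2 x)^-1.
Definition wreg x : R := wlim x * cutoff x.
Definition rate (j : 'I_2) : R := comp2 gamma beta j.

Hypothesis eps0 : 0 < eps.

Lemma cosh2_gt0 x : 0 < cosh2 x. Proof. by rewrite addr_gt0// explin_gt0. Qed.
Lemma wlim_gt0 x : 0 < wlim x. Proof. by rewrite mulr_gt0 ?explin_gt0 ?cosh2_gt0. Qed.
Lemma k1_ge1 x : 1 <= k1 x. Proof. by rewrite lerDl mulr_ge0// ltW// explin_gt0. Qed.
Lemma k2_ge1 x : 1 <= k2 x.
Proof. by rewrite lerDl mulr_ge0 ?mulr_ge0// ltW// cosh2_gt0. Qed.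
Lemma k1_gt0 x : 0 < k1 x. Proof. exact: lt_le_trans (k1_ge1 x). Qed.
Lemma k2_gt0 x : 0 < k2 x. Proof. exact: lt_le_trans (k2_ge1 x). Qed.
Lemma cutoff_gt0 x : 0 < cutoff x.
Proof. by rewrite invr_gt0 mulr_gt0 ?k1_gt0 ?k2_gt0. Qed.
Lemma wreg_gt0 x : 0 < wreg x.
Proof. by rewrite mulr_gt0 ?wlim_gt0 ?cutoff_gt0. Qed.

Lemma cutoffE x : cutoff x = (k1 x)^-1 * (k2 x)^-1.
Proof. by rewrite /cutoff invfM. Qed.

Lemma k1V_le1 x : (k1 x)^-1 <= 1. Proof. by rewrite invf_le1 ?k1_gt0 ?k1_ge1. Qed.
Lemma k2V_le1 x : (k2 x)^-1 <= 1. Proof. by rewrite invf_le1 ?k2_gt0 ?k2_ge1. Qed.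

Lemma cutoff_le1 x : cutoff x <= 1.
Proof.
by rewrite cutoffE mulr_ile1 ?k1V_le1 ?k2V_le1// invr_ge0 ltW ?k1_gt0 ?k2_gt0.
Qed.

Lemma cutoff_le_k1 x : cutoff x <= (k1 x)^-1.
Proof. by rewrite cutoffE ler_piMr ?k2V_le1// invr_ge0 ltW ?k1_gt0. Qed.

Lemma cutoff_le_k2 x : cutoff x <= (k2 x)^-1.
Proof. by rewrite cutoffE ler_piMl ?k1V_le1// invr_ge0 ltW ?k2_gt0. Qed.

Lemma smooth_cosh2 : smooth cosh2.
Proof. by apply: smooth_add; exact: smooth_explin. Qed.

Lemma smooth_wlim : smooth wlim.
Proof. by apply: smooth_mul; [exact: smooth_explin|exact: smooth_cosh2]. Qed.

Lemma smooth_k1 : smooth k1.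
Proof.
apply: smooth_add; first exact: smooth_cst.
by apply: smooth_mul; [exact: smooth_cst|exact: smooth_explin].
Qed.

Lemma smooth_k2 : smooth k2.
Proof.
apply: smooth_add; first exact: smooth_cst.
apply: smooth_mul; first exact: smooth_cst.
by apply: smooth_mul; exact: smooth_cosh2.
Qed.

Lemma smooth_cutoff : smooth cutoff.
Proof.
apply: smooth_inv; last by apply: smooth_mul; [exact: smooth_k1|exact: smooth_k2].
by move=> x; rewrite gt_eqF// mulr_gt0 ?k1_gt0 ?k2_gt0.
Qed.

Lemma smooth_wreg : smooth wreg.
Proof. by apply: smooth_mul; [exact: smooth_wlim|exact: smooth_cutoff]. Qed.

Definition sinh2 x : R := explin 0 beta x - explin 0 (- beta) x.

Lemma sinh2_le x : `|sinh2 x| <= cosh2 x.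
Proof.
rewrite ler_norml /sinh2 /cosh2.
have := explin_gt0 0 beta x; have := explin_gt0 0 (- beta) x.
by move: (explin _ _ _) (explin _ _ _) => a b a0 b0; apply/andP; split; lra.
Qed.

Lemma pd_cosh2 j x : pd j cosh2 x = comp2 0 beta j * sinh2 x.
Proof.
rewrite /cosh2 pdD; [|exact: smooth_explin..]; rewrite !pd_explin /comp2 /sinh2.
by case: ifP => _; ring.
Qed.

Lemma pd_wlim j x : pd j wlim x =
  comp2 (- gamma) 0 j * wlim x + explin (- gamma) 0 x * (comp2 0 beta j * sinh2 x).
Proof.
rewrite /wlim pdM; [|exact: smooth_explin|exact: smooth_cosh2].
by rewrite pd_explin pd_cosh2; ring.
Qed.

Lemma pd_k1 j x : pd j k1 x = comp2 (- (2 * gamma)) 0 j * (k1 x - 1).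
Proof.
rewrite /k1 pdD; [|exact: smooth_cst|].
  rewrite pd_cst pdZ; last exact: smooth_explin.
  by rewrite pd_explin; ring.
by apply: smooth_mul; [exact: smooth_cst|exact: smooth_explin].
Qed.

Lemma pd_k2 j x : pd j k2 x = 2 * comp2 0 beta j * (eps * (cosh2 x * sinh2 x)).
Proof.
have s2 : smooth (fun x => cosh2 x * cosh2 x) by apply: smooth_mul; exact: smooth_cosh2.
rewrite /k2 pdD; [|exact: smooth_cst|].
  rewrite pd_cst pdZ// pdM; [|exact: smooth_cosh2..].
  by rewrite pd_cosh2; ring.
by apply: smooth_mul => //; exact: smooth_cst.
Qed.

Lemma pd_cutoff j x : pd j cutoff x =
  - (cutoff x * (pd j k1 x * (k1 x)^-1 + pd j k2 x * (k2 x)^-1)).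
Proof.
rewrite /cutoff pdV; first last.
- by apply: smooth_mul; [exact: smooth_k1|exact: smooth_k2].
- by move=> y; rewrite gt_eqF// mulr_gt0 ?k1_gt0 ?k2_gt0.
rewrite pdM; [|exact: smooth_k1|exact: smooth_k2].
have := k1_gt0 x; have := k2_gt0 x.
move: (k1 x) (k2 x) (pd j k1 x) (pd j k2 x) => a b a' b' a0 b0.
by congr (- _); field; rewrite !gt_eqF.
Qed.

Lemma k2_sinh2 x : `|eps * (cosh2 x * sinh2 x)| <= k2 x - 1.
Proof.
rewrite /k2 addrAC subrr add0r normrM (gtr0_norm eps0) ler_pM2l//.
rewrite normrM (gtr0_norm (cosh2_gt0 x)) ler_pM2l ?cosh2_gt0//.
exact: sinh2_le.
Qed.

(** The factor [1 - cutoff] is what makes the gradient of the cutoff disappear in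
    the limit. *)
Lemma pd_cutoff_le j x : `|pd j cutoff x| <= 2 * rate j * (cutoff x * (1 - cutoff x)).
Proof.
have c0 := cutoff_gt0 x; have a0 := k1_gt0 x; have b0 := k2_gt0 x.
have ca := cutoff_le_k1 x; have cb := cutoff_le_k2 x.
rewrite pd_cutoff normrN normrM (gtr0_norm c0) mulrCA ler_pM2l//.
rewrite pd_k1 pd_k2; case: (ord2P j) => ->; rewrite /rate /comp2 /=.
  rewrite mulr0 !mul0r addr0.
  have -> : - (2 * gamma) * (k1 x - 1) * (k1 x)^-1 = - (2 * gamma * (1 - (k1 x)^-1)).
    by field; rewrite gt_eqF.
  rewrite normrN ger0_norm; last first.
    by rewrite mulr_ge0 ?subr_ge0 ?k1V_le1// mulr_ge0// ltW.
  by rewrite ler_pM2l ?mulr_gt0// lerB.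
rewrite !mul0r add0r -mulrA normrM ger0_norm; last by rewrite mulr_ge0// ltW.
rewrite ler_pM2l ?mulr_gt0//.
rewrite normrM (ger0_norm (_ : 0 <= (k2 x)^-1)); last by rewrite invr_ge0 ltW.
apply: (@le_trans _ _ ((k2 x - 1) * (k2 x)^-1)).
  by rewrite ler_pM2r ?invr_gt0// k2_sinh2.
by rewrite mulrBl divff ?gt_eqF// mul1r lerB.
Qed.

(** The logarithmic derivative of [t / (1 + eps t^2)] is that of [t] times
    [2 / (1 + eps t^2) - 1], a number between -1 and 1: the rates do not depend
    on [eps]. *)
Lemma pd_wreg_le j x : `|pd j wreg x| <= rate j * wreg x.
Proof.
have c0 := cutoff_gt0 x; have a0 := k1_gt0 x; have b0 := k2_gt0 x.
have e0 := explin_gt0 (- gamma) 0 x; have ch0 := cosh2_gt0 x.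
rewrite /wreg pdM; [|exact: smooth_wlim|exact: smooth_cutoff].
rewrite pd_cutoff pd_wlim pd_k1 pd_k2; case: (ord2P j) => ->; rewrite /rate /comp2 /=.
  rewrite !mulr0 !mul0r mulr0 !addr0.
  have -> : wlim x * - (cutoff x * (- (2 * gamma) * (k1 x - 1) * (k1 x)^-1)) +
     cutoff x * (- gamma * wlim x) = gamma * (wlim x * cutoff x) * (1 - 2 * (k1 x)^-1).
    by field; rewrite gt_eqF.
  rewrite normrM gtr0_norm; last by rewrite !mulr_gt0// wlim_gt0.
  rewrite ler_piMr//; first by rewrite !mulr_ge0// ltW// wlim_gt0.
  have := k1V_le1 x; have : 0 < (k1 x)^-1 by rewrite invr_gt0.
  by move: (k1 x)^-1 => i i0 i1; rewrite ler_norml; apply/andP; split; lra.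
rewrite !mul0r !add0r.
have -> : wlim x * - (cutoff x * (2 * beta * (eps * (cosh2 x * sinh2 x)) * (k2 x)^-1)) +
    cutoff x * (explin (- gamma) 0 x * (beta * sinh2 x)) =
  (beta * explin (- gamma) 0 x * cutoff x) * (sinh2 x * (2 * (k2 x)^-1 - 1)).
  rewrite /wlim; have k2E : eps * (cosh2 x * cosh2 x) = k2 x - 1 by rewrite /k2 addrAC subrr add0r.
  have -> : explin (- gamma) 0 x * cosh2 x *
    - (cutoff x * (2 * beta * (eps * (cosh2 x * sinh2 x)) * (k2 x)^-1)) =
    - (2 * beta * explin (- gamma) 0 x * cutoff x * sinh2 x * (k2 x)^-1 * (eps * (cosh2 x * cosh2 x))) by ring.
  by rewrite k2E; field; rewrite gt_eqF.
rewrite normrM gtr0_norm; last by rewrite !mulr_gt0.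
have -> : beta * (wlim x * cutoff x) = (beta * explin (- gamma) 0 x * cutoff x) * cosh2 x.
  by rewrite /wlim; ring.
rewrite ler_pM2l ?mulr_gt0// normrM -[leRHS]mulr1.
apply: ler_pM => //; first exact: sinh2_le.
have := k2V_le1 x; have : 0 < (k2 x)^-1 by rewrite invr_gt0.
by move: (k2 x)^-1 => i i0 i1; rewrite ler_norml; apply/andP; split; lra.
Qed.

Local Notation wp := (weight_plus beta gamma).
Local Notation wn := (weight_plus (- beta) (- gamma)).
Local Notation wm := (weight_minus beta (- gamma)).

Lemma weight_gt0 x : [/\ 0 < wp x, 0 < wn x & 0 < wm x].
Proof. by split; exact: expR_gt0. Qed.

Lemma wn_wp x : wn x * wp x = 1.
Proof. by rewrite /weight_plus -expRD -expR0; congr expR; ring. Qed.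

Let eb x := expR (beta * `|x.2|).

Lemma cosh2_ge x : eb x <= cosh2 x.
Proof.
rewrite /cosh2 /explin /eb !mul0r !add0r; have [h|h] := leP 0 x.2.
  by rewrite ger0_norm// lerDl expR_ge0.
by rewrite ltr0_norm// mulrN mulNr lerDr expR_ge0.
Qed.

Lemma cosh2_le x : cosh2 x <= 2 * eb x.
Proof.
rewrite /cosh2 /explin /eb !mul0r !add0r mulr_natl mulr2n lerD// ler_expR.
  by rewrite ler_pM2l// ler_norm.
by rewrite mulNr -mulrN ler_pM2l// -normrN ler_norm.
Qed.

Lemma wmE x : wm x = explin (- gamma) 0 x * eb x.
Proof. by rewrite /weight_minus /explin /eb -expRD; congr expR; ring. Qed.

Lemma wm_le_wlim x : wm x <= wlim x.
Proof. by rewrite wmE /wlim ler_pM2l ?explin_gt0// cosh2_ge. Qed.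

Lemma wlim_le_wm x : wlim x <= 2 * wm x.
Proof. by rewrite wmE /wlim mulrCA ler_pM2l ?explin_gt0// cosh2_le. Qed.

Lemma wm_le_wp x : wm x <= wp x.
Proof.
rewrite /weight_minus /weight_plus ler_expR lerD2l mulNr -mulrN ler_pM2l//.
by rewrite -normrN ler_norm.
Qed.

Lemma wreg_le_wlim x : wreg x <= wlim x.
Proof. by rewrite /wreg ler_piMr ?cutoff_le1// ltW// wlim_gt0. Qed.

Lemma wreg_le_wp x : wreg x <= 2 * wp x.
Proof.
apply: le_trans (wreg_le_wlim x) _; apply: le_trans (wlim_le_wm x) _.
by rewrite ler_pM2l// wm_le_wp.
Qed.

(** For fixed [eps] the regularized weight decays, so that [wreg^2 u] may serve as a
    test function. *)
Lemma wreg_le_wn x : eps <= 1 -> wreg x <= eps ^- 2 * wn x.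
Proof.
move=> eps1; have [p0 n0 m0] := weight_gt0 x.
have a0 := k1_gt0 x; have b0 := k2_gt0 x.
rewrite -(ler_pM2r p0) -[leRHS]mulrA wn_wp mulr1.
have A : explin (- gamma) 0 x * expR (gamma * `|x.1|) * (k1 x)^-1 <= eps^-1.
  rewrite ler_pdivrMr// ler_pdivlMl// /explin mul0r addr0 -expRD.
  have [h|h] := leP 0 x.1.
    rewrite ger0_norm// mulNr addNr expR0 mulr1; apply: le_trans eps1 _; exact: k1_ge1.
  rewrite ltr0_norm// /k1 /explin mul0r addr0.
  have -> : - gamma * x.1 + gamma * - x.1 = - (2 * gamma) * x.1 by ring.
  by rewrite lerDr.
have B : cosh2 x * eb x * (k2 x)^-1 <= eps^-1.
  rewrite ler_pdivrMr// ler_pdivlMl// /k2.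
  apply: (@le_trans _ _ (eps * (cosh2 x * cosh2 x))); last by rewrite lerDr.
  by rewrite ler_pM2l// ler_pM2l ?cosh2_gt0// cosh2_ge.
have -> : wreg x * wp x = (explin (- gamma) 0 x * expR (gamma * `|x.1|) * (k1 x)^-1) *
    (cosh2 x * eb x * (k2 x)^-1).
  have -> : wp x = eb x * expR (gamma * `|x.1|) by rewrite /weight_plus expRD.
  by rewrite /wreg /wlim cutoffE; ring.
rewrite expr2 invfM; apply: ler_pM => //.
- by rewrite !mulr_ge0 ?expR_ge0// ?invr_ge0 ltW// explin_gt0.
- by rewrite !mulr_ge0 ?expR_ge0// ?invr_ge0 ltW// cosh2_gt0.
Qed.

(** Where [x_1 >= 0] and [x_2] is bounded, the two weights of the problem are
    comparable, uniformly in [eps]: this is how the half-strip, on which no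
    spectral inequality is available, is controlled. *)
Lemma wreg_strip (x : P) (b : R) : 0 <= x.1 -> `|x.2| <= b ->
  wreg x <= 2 * expR (2 * beta * b) * wn x.
Proof.
move=> x1 x2; apply: le_trans (wreg_le_wlim x) _; apply: le_trans (wlim_le_wm x) _.
rewrite -mulrA ler_pM2l// /weight_minus /weight_plus -expRD ler_expR (ger0_norm x1).
have : beta * `|x.2| <= beta * b by rewrite ler_pM2l.
by move: `|x.2| => t H; lra.
Qed.

Lemma continuous_weight_plus (a b : R) : continuous (weight_plus a b).
Proof.
move=> x; apply: (@continuous_comp _ _ _ (fun x : P => a * `|x.2| + b * `|x.1|) expR).
  apply: cvgD; (apply: cvgM; first exact: cvg_cst).
    by apply: cvg_norm; exact: cvg_snd.
  by apply: cvg_norm; exact: cvg_fst.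
exact: continuous_expR.
Qed.

Lemma continuous_weight_minus (a b : R) : continuous (weight_minus a b).
Proof.
move=> x; apply: (@continuous_comp _ _ _ (fun x : P => a * `|x.2| + b * x.1) expR).
  apply: cvgD; (apply: cvgM; first exact: cvg_cst).
    by apply: cvg_norm; exact: cvg_snd.
  exact: cvg_fst.
exact: continuous_expR.
Qed.

End Weights.

(** * The estimate with a regularized weight *)

Section WeightedEstimate.
Context {R : realType}.
Local Notation P := (R * R)%type.
Local Notation pm := (@plane_measure R).
Local Notation plane := (@plane R).
Notation sq D f := (Rintegral pm D (fun x => f x ^+ 2)).

Lemma energy_weight (D : set P) (w u : P -> R) (p : 'I_2 -> P -> R) :
  energy D w u p = energy D one_weight (fun x => w x * u x) (fun j x => w x * p j x).
Proof. by apply: eq_integral => x _; rewrite dens1 /dens; congr EFin; ring. Qed.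

Lemma rW1_weighted_sqint (D G : set P) (w u : P -> R) (p : 'I_2 -> P -> R) :
  measurable (D : set plane) -> continuous w -> rW1 D w G u p ->
  sqint pm D (fun x => w x * u x) /\ forall j, sqint pm D (fun x => w x * p j x).
Proof.
move=> mD cw H; have elt := energy_rW1_lty mD cw H; have [[mu mp] _] := H.
have mw : measurable_fun (D : set plane) (w : plane -> R) by exact: continuous_plane_measurable.
rewrite energy_weight in elt; apply: (energy1_sqint mD _ elt).
by split=> [|j]; apply: measurable_funM.
Qed.

(** The constant that comes out of [absorb]. *)
Definition estimate_cst (Lambda K : R) : R :=
  let eta := (Lambda - K) / 2 in
  (Lambda + 1) * (Lambda / eta + 1) + (Lambda + 1) / eta ^+ 2 + 1 / eta.

Lemma estimate_cst_ge0 (Lambda K : R) : 0 <= K -> K < Lambda -> 0 <= estimate_cst Lambda K.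
Proof.
move=> K0 KL; rewrite /estimate_cst; set eta := _ / 2.
have e0 : 0 <= eta by rewrite /eta; lra.
have L0 : 0 <= Lambda by lra.
have L1 : 0 <= Lambda + 1 by lra.
apply: addr_ge0; last exact: divr_ge0.
apply: addr_ge0; last by apply: divr_ge0 => //; exact: exprn_ge0.
by apply: mulr_ge0 => //; apply: addr_ge0 => //; exact: divr_ge0.
Qed.

(** Here [a] is the energy of the gradient, [b] and [x] are the squared norms on
    the cells and on the half-strip.  Half of the spectral gap absorbs [b], the
    other half was spent on the right-hand side. *)
Lemma absorb (Lambda K a b x F : R) : 0 <= K -> K < Lambda -> 0 <= b -> 0 <= x -> 0 <= F ->
  Lambda * b <= a ->
  a <= (K + (Lambda - K) / 2) * (b + x) + F / ((Lambda - K) / 2) ->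
  a + (b + x) <= estimate_cst Lambda K * (F + x).
Proof.
move=> K0 KL b0 x0 F0 ba.
rewrite /estimate_cst; set eta := (Lambda - K) / 2.
have e0 : 0 < eta by rewrite /eta; lra.
have -> : K + eta = Lambda - eta by rewrite /eta; lra.
have L0 : 0 < Lambda by lra.
move: eta e0 => eta e0 H.
have i0 : 0 < eta^-1 by rewrite invr_gt0.
have ie : eta^-1 * eta = 1 by rewrite mulVf// gt_eqF.
have -> : eta ^- 2 = eta^-1 * eta^-1 by rewrite expr2 invfM.
rewrite !mul1r; move: eta^-1 i0 ie H => i i0 ie H.
have H1 : eta * b <= Lambda * x + F * i.
  have := mulr_ge0 (ltW e0) x0; lra.
have H2 : b <= Lambda * i * x + i * i * F.
  have := ler_wpM2l (ltW i0) H1; rewrite mulrA ie mul1r => /le_trans; apply; lra.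
have H3 : a <= Lambda * (b + x) + F * i.
  have X0 := mulr_ge0 (ltW e0) x0.
  by have := mulr_ge0 (ltW e0) b0; lra.
have H4 := ler_wpM2l (ltW L0) H2.
have xi : 0 <= i * x by rewrite mulr_ge0// ltW.
have iF : 0 <= i * F by rewrite mulr_ge0// ltW.
have Lxi : 0 <= Lambda * (i * F) by rewrite mulr_ge0// ltW.
have LF := mulr_ge0 (ltW L0) F0.
have iix : 0 <= i * (i * x) by rewrite mulr_ge0// ltW.
have Liix : 0 <= Lambda * (i * (i * x)) by rewrite mulr_ge0// ltW.
have LLF : 0 <= Lambda * (Lambda * (i * F)) by rewrite mulr_ge0// ltW.
lra.
Qed.

Section OneWeight.
Variables (D D' S Z G : set P) (w wn wp : P -> R) (k : 'I_2 -> R) (Cn C1 : R).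
Hypothesis mD : measurable (D : set plane).
Hypothesis cwn : continuous wn.
Hypothesis cwp : continuous wp.
Hypothesis sw : smooth w.
Hypothesis w0 : forall x, 0 < w x.
Hypothesis wn0 : forall x, 0 < wn x.
Hypothesis wnp : forall x, wn x * wp x = 1.
Hypothesis k0 : forall j, 0 <= k j.
Hypothesis Cn0 : 0 <= Cn.
Hypothesis w_wn : forall x, w x <= Cn * wn x.
Hypothesis w_wp : forall x, w x <= 2 * wp x.
Hypothesis pd_w : forall j x, `|pd j w x| <= k j * w x.
Variables (u : P -> R) (p : 'I_2 -> P -> R).
Hypothesis rWu : rW1 D wn G u p.

Local Notation U := (fun x => w x * u x).
Local Notation V := (fun j x => w x * p j x + pd j w x * u x).
Local Notation kk := (k 0 ^+ 2 + k 1 ^+ 2).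

Lemma rW1_weight : rW1 D one_weight G U V.
Proof.
have K0 j : 0 <= k j * Cn by rewrite mulr_ge0.
have wn' x : 0 <= wn x by exact: ltW.
apply: (rW1_mul mD cwn one_weight_continuous sw (C := Cn + k 0 * Cn + k 1 * Cn)) => //.
  move=> x _; rewrite /one_weight mulr1 gtr0_norm// (le_trans (w_wn x))// ler_wpM2r//.
  by rewrite -addrA lerDl addr_ge0.
move=> j x _; rewrite /one_weight mulr1 (le_trans (pd_w j x))//.
apply: (@le_trans _ _ (k j * (Cn * wn x))); first by rewrite ler_wpM2l.
rewrite mulrA ler_wpM2r//; case: (ord2P j) => ->.
  by rewrite addrAC lerDr addr_ge0.
by rewrite lerDr addr_ge0.
Qed.

(** Squaring the weight trades the decaying weight of the solution for the growing
    weight of the test space. *)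
Lemma rW1_weight_sq : rW1 D wp G (fun x => w x * w x * u x)
  (fun j x => w x * w x * p j x + pd j (fun y => w y * w y) x * u x).
Proof.
have K0 j : 0 <= 2 * k j * Cn ^+ 2 by rewrite !mulr_ge0 ?sqr_ge0.
have wn' x : 0 <= wn x by exact: ltW.
have wp' x : 0 < wp x by rewrite -(pmulr_rgt0 _ (wn0 x)) wnp.
have sww : smooth (fun x => w x * w x) by exact: smooth_mul.
have H x : w x * w x * wp x <= Cn ^+ 2 * wn x.
  have -> : Cn ^+ 2 * wn x = Cn * wn x * (Cn * wn x) * wp x.
    by rewrite -[LHS]mulr1 -(wnp x); ring.
  by rewrite ler_pM2r//; apply: ler_pM => //; exact: ltW.
have C2 := sqr_ge0 Cn.
apply: (rW1_mul mD cwn cwp sww (C := Cn ^+ 2 + 2 * k 0 * Cn ^+ 2 + 2 * k 1 * Cn ^+ 2)) => //.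
  move=> x _; rewrite ger0_norm; last by rewrite !mulr_ge0// ltW.
  rewrite (le_trans (H x))// ler_wpM2r// -addrA lerDl addr_ge0//.
move=> j x _; rewrite pdM//.
have -> : (w x * pd j w x + w x * pd j w x) * wp x = 2 * (w x * pd j w x) * wp x by ring.
rewrite normrM (gtr0_norm (wp' x)) normrM normr_nat normrM (gtr0_norm (w0 x)).
apply: (@le_trans _ _ (2 * k j * (w x * w x * wp x))).
  have -> : 2 * k j * (w x * w x * wp x) = 2 * (w x * (k j * w x)) * wp x by ring.
  by rewrite ler_pM2r// ler_pM2l// ler_pM2l.
apply: (@le_trans _ _ (2 * k j * (Cn ^+ 2 * wn x))).
  by rewrite ler_wpM2l// mulr_ge0.
rewrite mulrA ler_wpM2r//; case: (ord2P j) => ->.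
  by rewrite addrAC lerDr addr_ge0.
by rewrite lerDr addr_ge0.
Qed.

Variables (Lambda lambda : R) (f : P -> R).
Hypothesis mf : measurable_fun (D : set plane) (f : plane -> R).
Hypothesis sf : sqint pm D (fun x => wp x * f x).
Hypothesis weak : forall v q, rW1 D wp G v q ->
  Rintegral pm D (fun x => p 0 x * q 0 x) + Rintegral pm D (fun x => p 1 x * q 1 x)
    - lambda * Rintegral pm D (fun x => u x * v x) = Rintegral pm D (fun x => f x * v x).

(** The commutator identity
    [grad u . grad (w^2 u) = |grad (w u)|^2 - |grad w|^2 u^2], with the gradient
    of the weight bounded by its rates and the product with [f] split by Young's
    inequality. *)
Lemma weak_pointwise (eta u0 f0 p0 p1 a a0 a1 b K : R) : 0 < eta ->
  a0 ^+ 2 <= k 0 ^+ 2 * a ^+ 2 -> a1 ^+ 2 <= k 1 ^+ 2 * a ^+ 2 -> 0 < a -> a <= 2 * b ->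
  lambda + kk <= K ->
  (a * p0 + a0 * u0) ^+ 2 + (a * p1 + a1 * u0) ^+ 2 <=
  p0 * (a * a * p0 + (a * a0 + a * a0) * u0) + p1 * (a * a * p1 + (a * a1 + a * a1) * u0)
  - lambda * (u0 * (a * a * u0)) - f0 * (a * a * u0)
  + ((K + eta) * (a * u0) ^+ 2 + eta^-1 * (b * f0) ^+ 2).
Proof.
move=> e0 A0 A1 a_gt0 ab lK.
have i0 : 0 < eta^-1 by rewrite invr_gt0.
have ie : eta^-1 * eta = 1 by rewrite mulVf// gt_eqF.
have U0 := sqr_ge0 u0; have A0' := ler_wpM2r U0 A0; have A1' := ler_wpM2r U0 A1.
have L' := ler_wpM2r (sqr_ge0 (a * u0)) lK.
have Y : f0 * (a * a * u0) <= eta * (a * u0) ^+ 2 + eta^-1 * (b * f0) ^+ 2.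
  have H1 : 4 * (f0 * (a * a * u0)) <= 4 * (eta * (a * u0) ^+ 2) + eta^-1 * (a * f0) ^+ 2.
    have := mulr_ge0 (ltW i0) (sqr_ge0 (a * f0 - 2 * eta * (a * u0))).
    have -> : eta^-1 * (a * f0 - 2 * eta * (a * u0)) ^+ 2 =
      eta^-1 * (a * f0) ^+ 2 - 4 * (eta^-1 * eta) * (f0 * (a * a * u0))
        + 4 * (eta^-1 * eta) * (eta * (a * u0) ^+ 2) by ring.
    by rewrite ie; lra.
  have H2 : eta^-1 * (a * f0) ^+ 2 <= 4 * (eta^-1 * (b * f0) ^+ 2).
    rewrite [leRHS]mulrCA ler_pM2l// !exprMn mulrA ler_wpM2r ?sqr_ge0//.
    have -> : 4 * b ^+ 2 = (2 * b) ^+ 2 by ring.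
    by rewrite lerXn2r ?nnegrE//; lra.
  by lra.
lra.
Qed.

Lemma weak_estimate (K eta : R) : 0 < eta -> lambda + kk <= K ->
  sq D (V 0) + sq D (V 1) <= (K + eta) * sq D U + sq D (fun x => wp x * f x) / eta.
Proof.
move=> e0 lK.
have [sU sV] := rW1_sqint mD rW1_weight.
have [su sp] := rW1_weighted_sqint mD cwn rWu.
have [sv sq'] := rW1_weighted_sqint mD cwp rW1_weight_sq.
have cancel (a b : P -> R) : sqint pm D (fun x => wn x * a x) ->
    sqint pm D (fun x => wp x * b x) -> pm.-integrable D (EFin \o (fun x => a x * b x)).
  move=> sa sb; have := sqint_mul mD sa sb; congr (pm.-integrable D (EFin \o _)).
  by apply/funext => x; rewrite mulrACA wnp mul1r.
pose v x := w x * w x * u x.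
pose q j x := w x * w x * p j x + pd j (fun y => w y * w y) x * u x.
have i0 := cancel (p 0) (q 0) (sp 0) (sq' 0).
have i1 := cancel (p 1) (q 1) (sp 1) (sq' 1).
have iu := cancel u v su sv.
have ifv : pm.-integrable D (EFin \o (fun x => f x * v x)).
  have wU : sqint pm D (fun x => w x * f x).
    apply: (sqint_le mD _ (sqintZ mD 2 sf)).
      apply: measurable_funM => //; apply: continuous_plane_measurable.
      exact: smooth_continuous.
    move=> x _; rewrite normrM gtr0_norm// mulrA normrM ler_wpM2r// ger0_norm ?w_wp//.
    exact: le_trans (ltW (w0 x)) (w_wp x).
  have := sqint_mul mD wU sU; congr (pm.-integrable D (EFin \o _)).
  by apply/funext => x; rewrite /v; ring.
have E := weak rW1_weight_sq.
have [_ iU] := sU; have [_ iV0] := sV 0; have [_ iV1] := sV 1; have [_ iF] := sf.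
have iA := intgD mD i0 i1.
have iB := intgB mD iA (intgZ mD lambda iu).
have iC := intgB mD iB ifv.
have iG := intgD mD (intgZ mD (K + eta) iU) (intgZ mD eta^-1 iF).
have iL := intgD mD iV0 iV1.
have iR := intgD mD iC iG.
have Z0 : Rintegral pm D (fun x => p 0 x * q 0 x + p 1 x * q 1 x - lambda * (u x * v x) - f x * v x) = 0.
  rewrite (RintegralB mD iB ifv) (RintegralB mD iA (intgZ mD lambda iu)).
  rewrite (RintegralD mD i0 i1) (RintegralZl lambda mD iu).
  by apply/eqP; rewrite subr_eq0; apply/eqP; exact: E.
rewrite -(RintegralD mD iV0 iV1).
have -> : (K + eta) * sq D U + sq D (fun x => wp x * f x) / eta =
  Rintegral pm D (fun x => (p 0 x * q 0 x + p 1 x * q 1 x - lambda * (u x * v x) - f x * v x)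
     + ((K + eta) * (w x * u x) ^+ 2 + eta^-1 * (wp x * f x) ^+ 2)).
  rewrite (RintegralD mD iC iG) Z0 add0r.
  rewrite (RintegralD mD (intgZ mD (K + eta) iU) (intgZ mD eta^-1 iF)).
  by rewrite (RintegralZl (K + eta) mD iU) (RintegralZl eta^-1 mD iF) [in LHS](mulrC _ eta^-1).
apply: (le_Rintegral mD iL iR) => x _.
rewrite /q /v !pdM//.
have pk j : pd j w x ^+ 2 <= k j ^+ 2 * w x ^+ 2.
  rewrite -exprMn -real_normK ?num_real// lerXn2r ?nnegrE//.
  by rewrite mulr_ge0// ltW.
exact: weak_pointwise.
Qed.

Hypothesis mD' : measurable (D' : set plane).
Hypothesis mZ : measurable (Z : set plane).
Hypothesis D'D : D' `<=` D.
Hypothesis DD' : D `<=` D' `|` (S `|` Z).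
Hypothesis Z0 : pm Z = 0%E.
Hypothesis w_S : forall x, S x -> w x <= C1 * wn x.
Hypothesis spectral : forall g, rtest G g ->
  Lambda * sq D' g <= sq D (pd 0 g) + sq D (pd 1 g).

Lemma sq_outside : sq (D `\` D') U <= C1 ^+ 2 * sq D (fun x => wn x * u x).
Proof.
have [[mU iU] _] := rW1_sqint mD rW1_weight.
have [[mu iu] _] := rW1_weighted_sqint mD cwn rWu.
have mA : measurable (D `\` D' : set plane) by exact: measurableD.
have mB : measurable ((D `\` D') `\` Z : set plane) by exact: measurableD.
have AD : D `\` D' `<=` D by exact: subDsetl.
have BA : (D `\` D') `\` Z `<=` D `\` D' by exact: subDsetl.
have iA := integrableS mD mA AD iU.
have null : pm ((D `\` D') `\` ((D `\` D') `\` Z)) = 0%E.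
  apply: (subset_measure0 _ mZ _ Z0); first exact: measurableD.
  by move=> x [Ax nB]; apply: contrapT => nZ; apply: nB.
rewrite (Int_null mA mB BA null iA).
have iB := integrableS mD mB (subset_trans BA AD) iU.
have iu' := integrableS mD mB (subset_trans BA AD) iu.
rewrite -(RintegralZl (C1 ^+ 2) mD iu).
have iC := intgZ mD (C1 ^+ 2) iu.
apply: (@le_trans _ _ (Rintegral pm ((D `\` D') `\` Z) (fun x => C1 ^+ 2 * (wn x * u x) ^+ 2))).
  apply: (le_Rintegral mB iB (intgZ mB (C1 ^+ 2) iu')) => x [[Dx nD'] nZ].
  have Sx : S x by have [//|[]] := DD' Dx.
  have CS : 0 <= C1 * wn x by rewrite (le_trans _ (w_S Sx))// ltW.
  have -> : C1 ^+ 2 * (wn x * u x) ^+ 2 = (C1 * wn x) ^+ 2 * u x ^+ 2 by ring.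
  rewrite exprMn ler_wpM2r ?sqr_ge0// lerXn2r ?nnegrE ?w_S//.
  exact: ltW.
apply: (Int_subset mB mD (subset_trans BA AD) iC) => x _.
by rewrite mulr_ge0// sqr_ge0.
Qed.

(** Recovers the weighted gradient from the gradient of the weighted function. *)
Lemma gradient_bound (a b c u0 p0 p1 : R) : b ^+ 2 <= k 0 ^+ 2 * a ^+ 2 ->
  c ^+ 2 <= k 1 ^+ 2 * a ^+ 2 ->
  a ^+ 2 * (u0 ^+ 2 + p0 ^+ 2 + p1 ^+ 2) <=
  (2 + 2 * kk) * ((a * p0 + b * u0) ^+ 2 + (a * p1 + c * u0) ^+ 2 + (a * u0) ^+ 2).
Proof.
move=> B C; have U0 := sqr_ge0 u0; have B' := ler_wpM2r U0 B; have C' := ler_wpM2r U0 C.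
have X := sqr_ge0 (a * p0 + 2 * (b * u0)); have Y := sqr_ge0 (a * p1 + 2 * (c * u0)).
have K0 := sqr_ge0 (k 0); have K1 := sqr_ge0 (k 1).
have N0 := mulr_ge0 K0 (sqr_ge0 (a * p0 + b * u0)).
have N1 := mulr_ge0 K0 (sqr_ge0 (a * p1 + c * u0)).
have N2 := mulr_ge0 K1 (sqr_ge0 (a * p0 + b * u0)).
have N3 := mulr_ge0 K1 (sqr_ge0 (a * p1 + c * u0)).
have A0 := sqr_ge0 (a * u0).
have -> : a ^+ 2 * (u0 ^+ 2 + p0 ^+ 2 + p1 ^+ 2) =
  (a * u0) ^+ 2 + ((a * p0 + b * u0) - b * u0) ^+ 2 + ((a * p1 + c * u0) - c * u0) ^+ 2 by ring.
have Sq (y z : R) : (y - z) ^+ 2 <= 2 * y ^+ 2 + 2 * z ^+ 2 by have := sqr_ge0 (y + z); lra.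
have S0 := Sq (a * p0 + b * u0) (b * u0); have S1 := Sq (a * p1 + c * u0) (c * u0).
lra.
Qed.

(** The bound of [weak_estimate] is combined with the spectral inequality for
    [w u].  The constant involves [w] only through its rates and [C1]; the
    constant [Cn], which makes [w^2 u] admissible, has disappeared. *)
Lemma a_priori (K : R) : 0 <= K -> lambda + kk <= K -> K < Lambda ->
  (energy D w u p <= ((2 + 2 * kk) * (estimate_cst Lambda K *
    (sq D (fun x => wp x * f x) + C1 ^+ 2 * sq D (fun x => wn x * u x))))%R%:E)%E.
Proof.
move=> K0 lK KL.
have e0 : 0 < (Lambda - K) / 2 by rewrite divr_gt0 ?subr_gt0.
have [sU sV] := rW1_sqint mD rW1_weight.
have [_ iU] := sU; have [_ iV0] := sV 0; have [_ iV1] := sV 1.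
have iV := intgD mD iV0 iV1; have iT := intgD mD iV iU.
have kk0 : 0 <= 2 + 2 * kk by rewrite addr_ge0// mulr_ge0// addr_ge0 ?sqr_ge0.
have cw : continuous w by exact: smooth_continuous.
have [mup _] := rWu.
have L0 : 0 <= Lambda by exact: le_trans K0 (ltW KL).
have sq0 (A : set P) (h : P -> R) : 0 <= sq A h by apply: Rintegral_ge0 => x _; exact: sqr_ge0.
have split_sq : sq D U = sq D' U + sq (D `\` D') U.
  have mA : measurable (D `\` D' : set plane) by exact: measurableD.
  have iU' : pm.-integrable (D' `|` (D `\` D')) (EFin \o (fun x => (w x * u x) ^+ 2)).
    by rewrite setDUK.
  have dj : [disjoint D' & D `\` D'] by apply/disj_setPS => x [D'x [_ /(_ D'x)]].
  by rewrite -(Rintegral_setU mD' mA iU' dj) setDUK.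
have spec := rW1_ineq mD mD' D'D L0 spectral rW1_weight.
have weakE := weak_estimate e0 lK.
have H := absorb K0 KL (sq0 D' U) (sq0 (D `\` D') U) (sq0 D (fun x => wp x * f x)) spec.
have {}H := H (eq_ind _ (fun y => _ <= _ * y + _) weakE _ split_sq).
apply: (@le_trans _ _ ((2 + 2 * kk) * (sq D (V 0) + sq D (V 1) + sq D U))%:E).
  rewrite -(RintegralD mD iV0 iV1) -(RintegralD mD iV iU) -(RintegralZl (2 + 2 * kk) mD iT).
  rewrite -(Int_ereal mD (intgZ mD (2 + 2 * kk) iT)).
  apply: ge0_le_integral => //.
  - by move=> x _; rewrite lee_fin dens_ge0.
  - by apply/measurable_EFinP; exact: measurable_dens.
  - by have /measurable_int := intgZ mD (2 + 2 * kk) iT.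
  - move=> x _; rewrite lee_fin.
    have pk j : pd j w x ^+ 2 <= k j ^+ 2 * w x ^+ 2.
      rewrite -exprMn -real_normK ?num_real// lerXn2r ?nnegrE//.
      by rewrite mulr_ge0// ltW.
    exact: (gradient_bound _ _ _ (pk 0) (pk 1)).
rewrite lee_fin ler_wpM2l// split_sq; apply: (le_trans H).
by rewrite ler_wpM2l ?estimate_cst_ge0// lerD2l sq_outside.
Qed.

End OneWeight.
End WeightedEstimate.

(** * Removal of the regularization *)

Section RemovingCutoff.
Context {R : realType}.
Local Notation P := (R * R)%type.
Local Notation pm := (@plane_measure R).
Local Notation plane := (@plane R).
Variables (beta gamma : R).
Hypothesis beta0 : 0 < beta.
Hypothesis gamma0 : 0 < gamma.
Local Notation wn := (weight_plus (- beta) (- gamma)).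
Local Notation wm := (weight_minus beta (- gamma)).
Local Notation eps := (@harmonic R).
Local Notation eta n := (cutoff beta gamma (eps n)).
Local Notation w n := (wreg beta gamma (eps n)).

Lemma eps_gt0 n : 0 < eps n. Proof. by rewrite invr_gt0. Qed.

Lemma eps_le1 n : eps n <= 1. Proof. by rewrite invf_le1// ler1n. Qed.

Lemma cutoff_cvg x : eta n x @[n --> \oo] --> (1 : R).
Proof.
pose E := explin (- (2 * gamma)) 0 x; pose c := cosh2 beta x * cosh2 beta x.
have k_cvg (a : R) : 1 + eps n * a @[n --> \oo] --> (1 : R).
  rewrite -[X in _ --> X]addr0 -[X in _ --> _ + X](mul0r a).
  by apply: cvgD; [exact: cvg_cst|apply: cvgM; [exact: cvg_harmonic|exact: cvg_cst]].
have H : (1 + eps n * E) * (1 + eps n * c) @[n --> \oo] --> (1 * 1 : R) by apply: cvgM; exact: k_cvg.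
by have := cvgV (_ : (1 * 1 : R) != 0) H; rewrite mulr1 invr1 oner_neq0; apply.
Qed.

Lemma rate_ge0 j : 0 <= rate beta gamma j.
Proof. by case: (ord2P j) => ->; exact: ltW. Qed.

Variables (D G : set P) (u : P -> R) (p : 'I_2 -> P -> R) (B : R).
Hypothesis mD : measurable (D : set plane).
Hypothesis rWu : rW1 D wn G u p.
Hypothesis bound : forall n, (energy D (w n) u p <= B%:E)%E.

Lemma dens_cvg (a : nat -> P -> R) (b : P -> R) x : a n x @[n --> \oo] --> b x ->
  dens (a n) u p x @[n --> \oo] --> dens b u p x.
Proof. by move=> ab; apply: cvgM; [apply: cvgM|exact: cvg_cst]. Qed.

(** Fatou's lemma, along [eps = 1 / (n + 1)]. *)
Lemma energy_wlim : (energy D (wlim beta gamma) u p <= B%:E)%E.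
Proof.
have [mup _] := rWu.
have md n : measurable_fun (D : set plane) ((fun x => (dens (w n) u p x)%:E) : plane -> \bar R).
  apply/measurable_EFinP; apply: measurable_dens => //.
  by apply: smooth_continuous; apply: smooth_wreg; exact: eps_gt0.
have d0 n x : D x -> (0%R <= (dens (w n) u p x)%:E)%E by rewrite lee_fin dens_ge0.
have F := fatou pm mD md d0.
apply: (@le_trans _ _ (\int[pm]_(x in D) limn_einf (fun n => (dens (w n) u p x)%:E))%E).
  rewrite le_eqVlt; apply/orP; left; apply/eqP; apply: eq_integral => x _; symmetry.
  apply: (cvg_limn_einf_sup _).1; apply: cvg_EFin; first exact: nearW.
  apply: dens_cvg; rewrite -[X in _ --> X]mulr1.
  by apply: cvgM; [exact: cvg_cst|exact: cutoff_cvg].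
apply: le_trans F _; apply: le_trans (limn_einf_sup _) _.
have : (0 <= limn_esup (fun n => energy D (w n) u p) <= B%:E)%E.
  by apply: (@limn_esup_between _ _ 0%N) => n _; rewrite energy_ge0 bound.
by case/andP.
Qed.

Lemma energy_wm : (energy D wm u p <= B%:E)%E.
Proof.
apply: le_trans energy_wlim; have [mup _] := rWu.
rewrite -[leRHS]mul1e; apply: (energy_le mD _ _ mup mup) => //.
- exact: continuous_weight_minus.
- by apply: smooth_continuous; exact: smooth_wlim.
move=> x _; rewrite mul1r /dens ler_wpM2r ?addr_ge0 ?sqr_ge0//.
have [_ _ m0] := weight_gt0 beta gamma x.
by rewrite lerXn2r ?nnegrE ?wm_le_wlim// ltW// wlim_gt0.
Qed.

Lemma rW1_cutoff n : rW1 D wm G (fun x => eta n x * u x)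
  (fun j x => eta n x * p j x + pd j (eta n) x * u x).
Proof.
have e0 := eps_gt0 n; have C0 : 0 <= eps n ^- 2 by rewrite invr_ge0 exprn_ge0// ltW.
have r0 := rate_ge0.
have H x : eta n x * wm x <= eps n ^- 2 * wn x.
  apply: le_trans (wreg_le_wn beta gamma e0 x (eps_le1 n)).
  by rewrite /wreg mulrC ler_wpM2r ?wm_le_wlim// ltW// cutoff_gt0.
pose r := 1 + 2 * rate beta gamma 0 + 2 * rate beta gamma 1.
have wn0 x : 0 <= wn x by exact: expR_ge0.
have wm0 x : 0 < wm x by exact: expR_gt0.
have rg : forall j, 2 * rate beta gamma j <= r.
  by move=> j; rewrite /r; have := r0 0; have := r0 1; case: (ord2P j) => ->; lra.
apply: (rW1_mul mD (C := r * eps n ^- 2) _ _ _ _ _ rWu).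
- exact: continuous_weight_plus.
- exact: continuous_weight_minus.
- exact: smooth_cutoff.
- move=> x _; rewrite gtr0_norm ?mulr_gt0 ?cutoff_gt0//.
  apply: le_trans (H x) _; rewrite -mulrA ler_peMl ?mulr_ge0//.
  by rewrite /r -addrA lerDl addr_ge0// mulr_ge0.
move=> j x _; rewrite normrM (gtr0_norm (wm0 x)).
apply: (@le_trans _ _ (2 * rate beta gamma j * (eta n x * wm x))).
  rewrite mulrA ler_pM2r//; apply: le_trans (pd_cutoff_le beta0 gamma0 e0 j x) _.
  have c0 := ltW (cutoff_gt0 beta gamma e0 x).
  apply: ler_wpM2l; first exact: mulr_ge0.
  by apply: ler_piMr => //; rewrite gerBl.
rewrite -[leRHS]mulrA; apply: ler_pM => //; first exact: mulr_ge0.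
by apply: mulr_ge0; apply: ltW => //; exact: cutoff_gt0.
Qed.

Local Notation rr := (2 + 8 * (gamma ^+ 2 + beta ^+ 2)).

Lemma cutoff_dens (s a0 a1 u0 p0 p1 W : R) :
  a0 ^+ 2 <= (2 * gamma * s) ^+ 2 -> a1 ^+ 2 <= (2 * beta * s) ^+ 2 ->
  W ^+ 2 * (((1 - s) * u0 - u0) ^+ 2 + ((1 - s) * p0 + a0 * u0 - p0) ^+ 2
     + ((1 - s) * p1 + a1 * u0 - p1) ^+ 2) <=
  rr * ((s * W) ^+ 2 * (u0 ^+ 2 + p0 ^+ 2 + p1 ^+ 2)).
Proof.
move=> A0 A1.
have -> : (1 - s) * u0 - u0 = - (s * u0) by ring.
have -> : (1 - s) * p0 + a0 * u0 - p0 = a0 * u0 - s * p0 by ring.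
have -> : (1 - s) * p1 + a1 * u0 - p1 = a1 * u0 - s * p1 by ring.
have -> : rr * ((s * W) ^+ 2 * (u0 ^+ 2 + p0 ^+ 2 + p1 ^+ 2)) =
   W ^+ 2 * (rr * (s ^+ 2 * (u0 ^+ 2 + p0 ^+ 2 + p1 ^+ 2))) by ring.
rewrite ler_wpM2l ?sqr_ge0//.
have U0 := sqr_ge0 u0; have A0' := ler_wpM2r U0 A0; have A1' := ler_wpM2r U0 A1.
have X := sqr_ge0 (a0 * u0 + s * p0); have Y := sqr_ge0 (a1 * u0 + s * p1).
have S0 := sqr_ge0 (s * u0).
have N (g z : R) : 0 <= g ^+ 2 * (s * z) ^+ 2 by rewrite mulr_ge0 ?sqr_ge0.
have N0 := N gamma p0; have N1 := N gamma p1; have N2 := N beta p0; have N3 := N beta p1.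
lra.
Qed.

(** The distance between [u] and its cutoff carries the factor [1 - cutoff], in the
    gradient as well by [pd_cutoff_le]. *)
Lemma energy_cutoff_sub n :
  (energy D wm (fun x => (eta n x * u x - u x)%R)
     (fun j x => (eta n x * p j x + pd j (eta n) x * u x - p j x)%R) <=
   rr%:E * energy D (fun x => ((1 - eta n x) * wm x)%R) u p)%E.
Proof.
have e0 := eps_gt0 n; have [mup _] := rWu.
have se := smooth_cutoff beta gamma e0.
have cm := @continuous_weight_minus R beta (- gamma).
apply: (energy_le mD) => //.
- move=> x; apply: cvgM; last exact: cm.
  by apply: cvgB; [exact: cvg_cst|exact: smooth_continuous].
- by apply: mpairB => //; exact: mpairM.
- by rewrite addr_ge0// mulr_ge0// addr_ge0// sqr_ge0.
move=> x _; rewrite /dens.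
have c1 : 0 <= 1 - eta n x by rewrite subr_ge0 cutoff_le1.
have pk j : pd j (eta n) x ^+ 2 <= (2 * rate beta gamma j * (1 - eta n x)) ^+ 2.
  rewrite -real_normK ?num_real// lerXn2r ?nnegrE//.
    by rewrite mulr_ge0// mulr_ge0// rate_ge0.
  apply: le_trans (pd_cutoff_le beta0 gamma0 e0 j x) _.
  by rewrite ler_wpM2l ?mulr_ge0 ?rate_ge0// ler_piMl// cutoff_le1.
have := cutoff_dens (u x) (p 0 x) (p 1 x) (wm x) (pk 0) (pk 1).
by rewrite (subKr 1 (eta n x)).
Qed.

(** Dominated convergence; the dominating function is integrable by [energy_wm]. *)
Lemma energy_cutoff_cvg :
  energy D (fun x => ((1 - eta n x) * wm x)%R) u p @[n --> \oo] --> 0%E.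
Proof.
have [mup _] := rWu.
have cm := @continuous_weight_minus R beta (- gamma).
have cw n : continuous (fun x => (1 - eta n x) * wm x).
  move=> x; apply: cvgM; last exact: cm.
  apply: cvgB; first exact: cvg_cst.
  by apply: smooth_continuous; apply: smooth_cutoff; exact: eps_gt0.
pose F n (x : plane) := (dens (fun x => (1 - eta n x) * wm x) u p x)%:E.
have mF n : measurable_fun (D : set plane) (F n).
  by apply/measurable_EFinP; exact: measurable_dens.
have Fcvg : {ae pm, forall x, D x -> F n x @[n --> \oo] --> (0%E : \bar R)}.
  apply: nearW => x _; rewrite (_ : 0%E = (dens (fun=> 0 : R) u p x)%:E).
    apply: cvg_EFin; first exact: nearW.
    apply: (@dens_cvg (fun n y => (1 - eta n y) * wm y) (fun=> 0)).
    have : (1 - eta n x) * wm x @[n --> \oo] --> ((1 - 1) * wm x : R).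
      by apply: cvgM; [apply: cvgB; [exact: cvg_cst|exact: cutoff_cvg]|exact: cvg_cst].
    by rewrite subrr mul0r.
  by rewrite /dens expr0n/= mul0r.
have ig : pm.-integrable D (EFin \o dens wm u p).
  apply: intg_ereal_lt => //; first exact: (measurable_dens cm mup).
    by move=> x _; exact: dens_ge0.
  by apply: le_lt_trans energy_wm _; rewrite ltry.
have Fle : {ae pm, forall x, forall n, D x -> (`|F n x| <= (EFin \o dens wm u p) x)%E}.
  apply: nearW => x n _; rewrite /F /= lee_fin ger0_norm ?dens_ge0// /dens.
  rewrite ler_wpM2r ?addr_ge0 ?sqr_ge0// exprMn ler_piMl ?sqr_ge0//.
  have e0 := eps_gt0 n.
  rewrite expr_le1// ?subr_ge0 ?cutoff_le1//.
  by rewrite gerBl ltW// cutoff_gt0.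
have [_ _] := dominated_convergence mD mF (measurable_cst _) Fcvg ig Fle.
by rewrite integral0.
Qed.

(** A finite energy is not enough to belong to the completion: [u] is approximated
    by its cutoffs, and these by test functions. *)
Lemma rW1_wm : rW1 D wm G u p.
Proof.
have [mup _] := rWu; split=> // e e0.
have cm := @continuous_weight_minus R beta (- gamma).
have r0 : 0 < rr.
  by have := sqr_ge0 gamma; have := sqr_ge0 beta; move: (gamma ^+ 2) (beta ^+ 2) => a b; lra.
have d0 : 0 < e / 4 / rr by rewrite !divr_gt0.
have nb : nbhs (0%E : \bar R) [set y | (y < (e / 4 / rr)%:E)%E].
  by apply: open_nbhs_nbhs; split; [exact: open_ereal_lt_ereal|rewrite /= lte_fin].
have /(@filter_ex nat)[n /= Hn] : \forall n \near \oo,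
    (energy D (fun x => ((1 - eta n x) * wm x)%R) u p < (e / 4 / rr)%:E)%E by exact: energy_cutoff_cvg nb.
have [mcut app] := rW1_cutoff n.
have e4 : 0 < e / 4 by rewrite divr_gt0.
have [f tf fe] := app _ e4; exists f => //.
have mf := rtest_mpair D tf.
have := energyD mD cm (mpairB mf mcut) (mpairB mcut mup).
have -> : energy D wm
   (fun x => (f x - eta n x * u x + (eta n x * u x - u x))%R)
   (fun j x => (pd j f x - (eta n x * p j x + pd j (eta n) x * u x) +
       (eta n x * p j x + pd j (eta n) x * u x - p j x))%R) =
   energy D wm (fun x => (f x - u x)%R) (fun j x => (pd j f x - p j x)%R).
  have E (a b c : R) : a - b + (b - c) = a - c by ring.
  apply: eq_integral => x _; congr EFin; rewrite /dens.
  congr (_ * (_ ^+ 2 + _ ^+ 2 + _ ^+ 2)); exact: E.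
move=> /le_trans; apply.
have -> : e%:E = (2%:E * ((e / 4)%:E + (e / 4)%:E))%E.
  by rewrite -EFinD -EFinM; congr EFin; lra.
apply: lee_wpmul2l => //; apply: leeD => //.
apply: le_trans (energy_cutoff_sub n) _.
have -> : e / 4 = rr * (e / 4 / rr) by rewrite [RHS]mulrC divfK// gt_eqF.
by rewrite EFinM; apply: lee_wpmul2l; [rewrite lee_fin ltW|exact: ltW].
Qed.

End RemovingCutoff.

(** * The estimate for real functions *)

Section Assembly.
Context {R : realType}.
Local Notation P := (R * R)%type.
Local Notation C := (R[i]).
Local Notation pm := (@plane_measure R).
Local Notation plane := (@plane R).
Notation sq D f := (Rintegral pm D (fun x => f x ^+ 2)).

Lemma rW1_real_energy (D G : set P) (w u : P -> R) (p : 'I_2 -> P -> R) :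
  measurable (D : set plane) -> continuous w -> rW1 D w G u p ->
  exists2 E, energy D w u p = E%:E & 0 <= sq D (fun x => w x * u x) <= E.
Proof.
move=> mD cw H; have [su sp] := rW1_weighted_sqint mD cw H.
have q0 (h : P -> R) : 0 <= sq D h by apply: Rintegral_ge0 => x _; exact: sqr_ge0.
rewrite energy_weight (energy1E mD su sp); eexists; first by [].
by rewrite q0 -addrA lerDl addr_ge0// q0.
Qed.

Lemma rW1_0 (D G : set P) (w : P -> R) : rW1 D w G (fun=> 0) (fun _ _ => 0).
Proof.
split; first by split=> [|j]; exact: measurable_cst.
move=> e e0; exists (fun=> 0).
  split => //; first exact: smooth_cst.
  rewrite (_ : [set x | _] = set0) ?closure0; first exact: compact0.
  by apply/seteqP; split => x //=; rewrite eqxx.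
rewrite /energy integral0_eq ?lee_fin ?ltW// => x _.
by rewrite /dens !pd_cst !subrr expr0n/= !addr0 mulr0.
Qed.

Section Real.
Variables (l2 : R) (omega : set P) (J : nat) (Lambda lambda beta gamma : R).
Hypothesis l20 : 0 < l2.
Hypothesis oo : open omega.
Hypothesis sb : smooth_boundary omega.
Hypothesis clQ : closure omega `<=` cellQ l2.
Hypothesis Lambda0 : 0 < Lambda.
Hypothesis least : smallest_mixed_eigenvalue l2 omega Lambda.
Hypothesis beta0 : 0 < beta.
Hypothesis gamma0 : 0 < gamma.
Hypothesis gap : lambda + (beta + gamma) ^+ 2 < Lambda.
Local Notation Omega := (Omega_bullet l2 omega J).
Local Notation wp := (weight_plus beta gamma).
Local Notation wn := (weight_plus (- beta) (- gamma)).
Local Notation wm := (weight_minus beta (- gamma)).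
Local Notation kk := (gamma ^+ 2 + beta ^+ 2).
Local Notation K := (Num.max 0 (lambda + kk)).

(** The squared rates add up to less than [(beta + gamma)^2]. *)
Lemma K_lt : K < Lambda.
Proof.
rewrite gt_max Lambda0; apply: le_lt_trans gap; rewrite lerD2l.
have := mulr_ge0 (ltW beta0) (ltW gamma0); lra.
Qed.

Let strip : R := 2 * expR (2 * beta * ((2 * J + 1)%:R * l2)).
Let bound_cst : R := (2 + 2 * kk) * (estimate_cst Lambda K * (1 + strip ^+ 2)).

Lemma strip_bound (A F N : R) : 0 <= A -> 0 <= F -> 0 <= N ->
  A * (F + strip ^+ 2 * N) <= A * (1 + strip ^+ 2) * (F + N).
Proof.
move=> A0 F0 N0; have S0 := sqr_ge0 strip; rewrite -mulrA ler_wpM2l//.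
have := mulr_ge0 S0 F0; lra.
Qed.

(** All the constants of [a_priori] other than [Cn] are uniform in the
    regularization, so that the latter can be removed. *)
Lemma real_estimate : exists2 c : R, 0 <= c & forall f u p,
  measurable_fun (Omega : set plane) (f : plane -> R) ->
  sqint pm Omega (fun x => wp x * f x) ->
  rW1 Omega wn (boundary Omega) u p ->
  (forall v q, rW1 Omega wp (boundary Omega) v q ->
    Rintegral pm Omega (fun x => p 0 x * q 0 x) + Rintegral pm Omega (fun x => p 1 x * q 1 x)
    - lambda * Rintegral pm Omega (fun x => u x * v x) = Rintegral pm Omega (fun x => f x * v x)) ->
  rW1 Omega wm (boundary Omega) u p /\
  (energy Omega wm u p <=
    (c * (sq Omega (fun x => wp x * f x) + sq Omega (fun x => wn x * u x)))%R%:E)%E.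
Proof.
have K0 : 0 <= K by rewrite le_max lexx.
have lK : lambda + kk <= K by rewrite le_max lexx orbT.
have kk0 : 0 <= 2 + 2 * kk by rewrite addr_ge0// mulr_ge0// addr_ge0// sqr_ge0.
have e0 : 0 <= estimate_cst Lambda K by exact: estimate_cst_ge0 K0 K_lt.
exists bound_cst; first by rewrite mulr_ge0// mulr_ge0// addr_ge0// sqr_ge0.
move=> f u p mf sf rWu weak.
have mO := @Omega_measurable R l2 omega J.
have q0 (h : P -> R) : 0 <= sq Omega h by apply: Rintegral_ge0 => x _; exact: sqr_ge0.
have main n : (energy Omega (wreg beta gamma (@harmonic R n)) u p <=
   (bound_cst * (sq Omega (fun x => wp x * f x) + sq Omega (fun x => wn x * u x)))%R%:E)%E.
  have n0 := @eps_gt0 R n; have n1 := @eps_le1 R n.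
  apply: le_trans (a_priori (Cn := @harmonic R n ^- 2) (C1 := strip)
    (k := rate beta gamma) (wp := wp) (D' := outer_cells l2 omega J)
    (S := Xi_plus l2 J) (Z := grid l2) (Lambda := Lambda) (K := K)
    mO _ _ _ _ _ _ _ _ _ _ _ rWu mf sf weak _ _ _ _ _ _ _ K0 lK K_lt) _.
  - exact: continuous_weight_plus.
  - exact: continuous_weight_plus.
  - exact: smooth_wreg.
  - exact: wreg_gt0.
  - by move=> x; exact: expR_gt0.
  - exact: wn_wp.
  - exact: rate_ge0.
  - by rewrite invr_ge0 exprn_ge0// ltW.
  - by move=> x; exact: wreg_le_wn.
  - exact: wreg_le_wp.
  - exact: pd_wreg_le.
  - exact: outer_cells_measurable.
  - exact: grid_measurable.
  - exact: outer_cells_sub.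
  - exact: Omega_sub.
  - exact: grid_null.
  - move=> x [x1 /andP[x2 x3]]; apply: wreg_strip => //.
      by apply: le_trans (ltW x1); rewrite /l1 invr_ge0.
    by rewrite ger0_norm ?ltW// (lt_trans l20).
  - by move=> g tg; exact: (domain_inequality l20 oo sb clQ (ltW Lambda0) least tg).
  rewrite lee_fin /bound_cst -[leRHS]mulrA ler_wpM2l//.
  exact: strip_bound.
split; first exact: (rW1_wm beta0 gamma0 mO rWu main).
exact: (energy_wm mO rWu main).
Qed.

End Real.
End Assembly.

(** * The estimate for complex functions *)

Section Complex.
Context {R : realType}.
Local Notation P := (R * R)%type.
Local Notation C := (R[i]).
Local Notation pm := (@plane_measure R).
Local Notation plane := (@plane R).
Notation sq D f := (Rintegral pm D (fun x => f x ^+ 2)).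

Lemma scal_real_r (D : set P) (g : P -> C) (v : P -> R) :
  scal D g (fun x => v x +i* 0) =
  (Rintegral pm D (fun x => re g x * v x)) +i* (Rintegral pm D (fun x => im g x * v x)).
Proof.
rewrite /scal /cintegral; congr (_ +i* _); apply: eq_Rintegral => x _.
  by rewrite /re; case: (g x) => a b /=; ring.
by rewrite /im; case: (g x) => a b /=; ring.
Qed.

Lemma gscal_real_r (D : set P) (g : 'I_2 -> P -> C) (v : 'I_2 -> P -> R) :
  gscal D g (fun j x => v j x +i* 0) =
  (Rintegral pm D (fun x => re2 g 0 x * v 0 x) + Rintegral pm D (fun x => re2 g 1 x * v 1 x)) +i*
  (Rintegral pm D (fun x => im2 g 0 x * v 0 x) + Rintegral pm D (fun x => im2 g 1 x * v 1 x)).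
Proof.
rewrite /gscal !big_ord_recr big_ord0/= add0r !scal_real_r.
have -> : widen_ord (leqnSn 1) ord_max = 0 :> 'I_2 by exact: val_inj.
by have -> : ord_max = 1 :> 'I_2 by exact: val_inj.
Qed.

(** Tested with real functions, the equation splits: the real and the imaginary
    part of the solution solve the same real problem. *)
Lemma weak_real (D G : set P) (w : P -> R) (lambda : R) (f u : P -> C) (du : 'I_2 -> P -> C) :
  measurable (D : set plane) -> continuous w ->
  (forall v dv, W1 D w G v dv ->
    gscal D du dv - lambda%:C * scal D u v = scal D f v) ->
  forall v q, rW1 D w G v q ->
  (Rintegral pm D (fun x => re2 du 0 x * q 0 x) + Rintegral pm D (fun x => re2 du 1 x * q 1 x)
    - lambda * Rintegral pm D (fun x => re u x * v x) = Rintegral pm D (fun x => re f x * v x)) /\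
  (Rintegral pm D (fun x => im2 du 0 x * q 0 x) + Rintegral pm D (fun x => im2 du 1 x * q 1 x)
    - lambda * Rintegral pm D (fun x => im u x * v x) = Rintegral pm D (fun x => im f x * v x)).
Proof.
move=> mD cw weak v q vq.
have H : W1 D w G (fun x => v x +i* 0) (fun j x => q j x +i* 0).
  by apply: rW1_W1 => //; exact: rW1_0.
have /eqP := weak _ _ H; rewrite gscal_real_r !scal_real_r eq_complex/=.
by rewrite !mul0r subr0 addr0 => /andP[/eqP <- /eqP <-].
Qed.

Lemma L2_sqint (D : set P) (w : P -> R) (f : P -> C) :
  measurable (D : set plane) -> continuous w -> L2 D w f ->
  [/\ sqint pm D (fun x => w x * re f x), sqint pm D (fun x => w x * im f x) &
   L2norm D w f =
   (Num.sqrt (sq D (fun x => w x * re f x) + sq D (fun x => w x * im f x)))%:E].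
Proof.
move=> mD cw [mf foo]; have [mr mi] := mf.
have mw : measurable_fun (D : set plane) (w : plane -> R) by exact: continuous_plane_measurable.
have mwr : measurable_fun (D : set plane) ((fun x => w x * re f x) : plane -> R) by exact: measurable_funM.
have mwi : measurable_fun (D : set plane) ((fun x => w x * im f x) : plane -> R) by exact: measurable_funM.
have E : L2sq D w f = (\int[pm]_(x in D) ((w x * re f x) ^+ 2 + (w x * im f x) ^+ 2)%:E)%E.
  by rewrite L2sqE//; apply: eq_integral => x _; rewrite !exprMn.
have ig : pm.-integrable D (EFin \o (fun x => (w x * re f x) ^+ 2 + (w x * im f x) ^+ 2)).
  apply: intg_ereal_lt => //.
  - by apply: measurable_funD; exact: measurable_funX.
  - by move=> x _; rewrite addr_ge0 ?sqr_ge0.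
  by rewrite -E; move: foo; rewrite /L2norm; case: (L2sq _ _ _) => //= r _; rewrite ltry.
have ir : pm.-integrable D (EFin \o (fun x => (w x * re f x) ^+ 2)).
  apply: (intg_le mD _ ig); first exact: measurable_funX.
  by move=> x _; rewrite ger0_norm ?sqr_ge0// lerDl sqr_ge0.
have ii : pm.-integrable D (EFin \o (fun x => (w x * im f x) ^+ 2)).
  apply: (intg_le mD _ ig); first exact: measurable_funX.
  by move=> x _; rewrite ger0_norm ?sqr_ge0// lerDr sqr_ge0.
by split=> //; rewrite /L2norm E (Int_ereal mD ig) (RintegralD mD ir ii).
Qed.

Lemma sqrt_combine (c F1 F2 N1 N2 E1 E2 : R) : 0 <= c -> 0 <= F1 -> 0 <= F2 ->
  0 <= N1 <= E1 -> 0 <= N2 <= E2 ->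
  c * (F1 + N1) + c * (F2 + N2) <=
  (Num.sqrt c * (Num.sqrt (F1 + F2) + Num.sqrt (E1 + E2))) ^+ 2.
Proof.
move=> c0 F10 F20 /andP[N10 NE1] /andP[N20 NE2].
rewrite exprMn sqr_sqrtr// -mulrDr ler_wpM2l//.
have F0 : 0 <= F1 + F2 by lra.
have E0 : 0 <= E1 + E2 by lra.
rewrite sqrrD !sqr_sqrtr//.
have : 0 <= Num.sqrt (F1 + F2) * Num.sqrt (E1 + E2) by rewrite mulr_ge0 ?sqrtr_ge0.
rewrite mulr2n; lra.
Qed.

End Complex.

Theorem lemma9 (R : realType) (l2 : R) (omega : set (R * R)) (J : nat)
    (Lambda lambda beta gamma : R) :
  0 < l2 ->
  omega !=set0 -> open omega -> smooth_boundary omega ->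
  closure omega `<=` cellQ l2 ->
  connected (Omega_circ l2 omega) ->
  (0 < J)%N ->
  0 < Lambda -> smallest_mixed_eigenvalue l2 omega Lambda ->
  lambda < Lambda -> 0 < beta -> 0 < gamma ->
  lambda + (beta + gamma) ^+ 2 < Lambda ->
  let Omega := Omega_bullet l2 omega J in
  exists c : R,
    forall (f u : R * R -> R[i]) (du : 'I_2 -> R * R -> R[i]),
      L2 Omega (weight_plus beta gamma) f ->
      W1plus0 (- beta) (- gamma) Omega u du ->
      (forall (v : R * R -> R[i]) (dv : 'I_2 -> R * R -> R[i]),
         W1plus0 beta gamma Omega v dv ->
         gscal Omega du dv - lambda%:C * scal Omega u v = scal Omega f v) ->
      W1minus0 beta (- gamma) Omega u du /\
      (W1norm Omega (weight_minus beta (- gamma)) u du <=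
        c%:E * (L2norm Omega (weight_plus beta gamma) f +
                W1norm Omega (weight_plus (- beta) (- gamma)) u du))%E.
Proof.
move=> l20 _ oo sb clQ _ _ L0 least _ beta0 gamma0 gap Omega.
have [c c0 est] := real_estimate J l20 oo sb clQ L0 least beta0 gamma0 gap.
have mO : measurable (Omega : set plane) := @Omega_measurable R l2 omega J.
have cp := @continuous_weight_plus R; have cm := @continuous_weight_minus R.
exists (Num.sqrt c) => f u du Lf Wu weak.
have [sfr sfi Lnorm] := L2_sqint mO (cp beta gamma) Lf.
have [[mfr mfi] _] := Lf.
have [Wr Wi] := W1_rW1 mO (cp _ _) Wu.
have weakR := weak_real mO (cp _ _) weak.
have [Vr Er] := est _ _ _ mfr sfr Wr (fun v q vq => (weakR v q vq).1).
have [Vi Ei] := est _ _ _ mfi sfi Wi (fun v q vq => (weakR v q vq).2).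
have mu : cmpair Omega u du by case: Wu.
split; first exact: (rW1_W1 mO (cm _ _) Vr Vi).
have [Nr ENr Nr_le] := rW1_real_energy mO (cp _ _) Wr.
have [Ni ENi Ni_le] := rW1_real_energy mO (cp _ _) Wi.
rewrite Lnorm (W1norm_energy mO (cm _ _) mu) (W1norm_energy mO (cp _ _) mu) ENr ENi.
rewrite -(EFinD Nr Ni) -[sqrte (Nr + Ni)%:E]/((Num.sqrt (Nr + Ni))%:E) -EFinD -EFinM.
apply: sqrte_le.
- by rewrite adde_ge0// energy_ge0.
- by rewrite mulr_ge0 ?addr_ge0 ?sqrtr_ge0.
apply: (le_trans (leeD Er Ei)); rewrite -EFinD lee_fin.
by apply: sqrt_combine => //; apply: Rintegral_ge0 => x _; exact: sqr_ge0.
Qed.
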